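(* Let $H$ be a Hilbert space, let $(T_t)_{t\ge0}$ be a bounded $C_0$-semigroup on $H$ with infinitesimal generator $-A$, and let $C=\sup_{t\ge0}\|T_t\|$. Then there exists a unique bounded algebra homomorphism $\rho_{0,A}\colon\mathcal{A}_0(\mathbb{C}_+)\to B(H)$ such that $$\rho_{0,A}(L_b)=\int_0^\infty b(t)T_t\,dt\qquad\text{for all } b\in L^1(0,\infty).$$ Moreover $\|\rho_{0,A}\|\le C^2$.
   Context: $\mathbb{C}_+=\{z:\mathrm{Re}\,z>0\}$. $H^1(\mathbb{R})=\{h\in L^1(\mathbb{R}):\widehat h(u)=0\ \forall u\le0\}$, $\widehat h(u)=\int h(t)e^{-itu}dt$. $\mathcal{A}_0(\mathbb{R})$ is the set of $F\colon\mathbb{R}\to\mathbb{C}$ with $F=\sum_kf_k\star h_k$ pointwise for some $(f_k)\subset C_0(\mathbb{R})$, $(h_k)\subset H^1(\mathbb{R})$, $\sum_k\|f_k\|_\infty\|h_k\|_1<\infty$, with norm $\|F\|_{\mathcal{A}_0}=\inf\sum_k\|f_k\|_\infty\|h_k\|_1$; such $F$ lie in $H^\infty(\mathbb{R})$ (bounded functions with analytic Poisson extension $\mathcal{P}[F]$ to the upper half-plane). For such $F$ set $\widetilde F(z)=\mathcal{P}[F](iz)$, $z\in\mathbb{C}_+$, and $\mathcal{A}_0(\mathbb{C}_+)=\{\widetilde F:F\in\mathcal{A}_0(\mathbb{R})\}$ with $\|\widetilde F\|_{\mathcal{A}_0}=\|F\|_{\mathcal{A}_0}$; it is a Banach algebra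 under pointwise multiplication. For $b\in L^1(0,\infty)$, $L_b(z)=\int_0^\infty e^{-tz}b(t)dt$ ($z\in\mathbb{C}_+$) is the Laplace transform; $L_b=\widetilde F$ with $F(u)=\widehat b(-u)$, and $L_b\in\mathcal{A}_0(\mathbb{C}_+)$. The integral $\int_0^\infty b(t)T_tdt$ is in the strong sense. *)

(* Defs.v *)
From HB Require Import structures.
From mathcomp Require Import all_boot all_order all_algebra.
From mathcomp Require Import all_classical all_reals all_analysis.
From mathcomp Require Import complex.
Import Order.TTheory GRing.Theory Num.Theory.
Import numFieldNormedType.Exports.
Set Implicit Arguments.
Unset Strict Implicit.
Unset Printing Implicit Defensive.
Local Open Scope ring_scope.
Local Open Scope classical_set_scope.

Definition rC {R : realType} (x : R) : complex R := Complex x 0.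
Definition cI {R : realType} : complex R := Complex 0 1.
Definition cabs {R : realType} (z : complex R) : R :=
  Num.sqrt (complex.Re z ^+ 2 + complex.Im z ^+ 2).
Definition cconj {R : realType} (z : complex R) : complex R :=
  Complex (complex.Re z) (- complex.Im z).
Definition cexp {R : realType} (z : complex R) : complex R :=
  Complex (expR (complex.Re z) * cos (complex.Im z)) (expR (complex.Re z) * sin (complex.Im z)).

Definition ccvg {R : realType} (u : nat -> complex R) (l : complex R) :=
  cabs (u n - l) @[n --> \oo] --> 0.

Definition cintegrable {R : realType} (D : set R) (f : R -> complex R) :=
  (@lebesgue_measure R).-integrable D (EFin \o (fun x => complex.Re (f x))) /\
  (@lebesgue_measure R).-integrable D (EFin \o (fun x => complex.Im (f x))).

Definition cint {R : realType} (D : set R) (f : R -> complex R) : complex R :=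
  Complex (Rintegral (@lebesgue_measure R) D (fun x => complex.Re (f x)))
          (Rintegral (@lebesgue_measure R) D (fun x => complex.Im (f x))).

Definition is_C0 {R : realType} (f : R -> complex R) :=
  (forall x : R, cabs (f y - f x) @[y --> x] --> 0) /\
  cabs (f y) @[y --> +oo] --> 0 /\
  cabs (f y) @[y --> -oo] --> 0.

Definition supnorm {R : realType} (f : R -> complex R) : R :=
  sup (range (fun x => cabs (f x))).

Definition L1norm {R : realType} (h : R -> complex R) : R :=
  Rintegral (@lebesgue_measure R) setT (fun x => cabs (h x)).

Definition fourier {R : realType} (h : R -> complex R) (u : R) : complex R :=
  cint setT (fun t => h t * cexp (Complex 0 (- (t * u)))).

Definition is_H1 {R : realType} (h : R -> complex R) :=
  cintegrable setT h /\ (forall u : R, u <= 0 -> fourier h u = 0).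

Definition conv {R : realType} (f h : R -> complex R) (x : R) : complex R :=
  cint setT (fun t => f (x - t) * h t).

Definition A0_rep {R : realType} (F : R -> complex R)
    (f h : nat -> R -> complex R) (S : R) :=
  (forall k, is_C0 (f k)) /\ (forall k, is_H1 (h k)) /\
  series (fun k => supnorm (f k) * L1norm (h k)) n @[n --> \oo] --> S /\
  (forall x : R, ccvg (fun n => \sum_(0 <= k < n) conv (f k) (h k) x) (F x)).

Definition in_A0R {R : realType} (F : R -> complex R) :=
  exists f h S, A0_rep F f h S.

Definition normA0R {R : realType} (F : R -> complex R) : R :=
  inf [set S : R | exists f h, A0_rep F f h S].

Definition poisson_ext {R : realType} (F : R -> complex R) (w : complex R)
    : complex R :=
  cint setT (fun t =>
    F t * rC (complex.Im w / (pi * ((complex.Re w - t) ^+ 2 + complex.Im w ^+ 2)))).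

Definition Cplus (R : realType) := {z : complex R | 0 < complex.Re z}.

Definition tildeF {R : realType} (F : R -> complex R) : Cplus R -> complex R :=
  fun z => poisson_ext F (cI * val z).

Definition in_A0C {R : realType} (Phi : Cplus R -> complex R) :=
  exists F, in_A0R F /\ Phi = tildeF F.

Definition normA0C {R : realType} (Phi : Cplus R -> complex R) : R :=
  inf [set normA0R F | F in [set F | in_A0R F /\ Phi = tildeF F]].

Definition L1_pos {R : realType} (b : R -> complex R) :=
  cintegrable `[0, +oo[ b.

Definition laplace {R : realType} (b : R -> complex R) : Cplus R -> complex R :=
  fun z => cint `[0, +oo[ (fun t => cexp (- (rC t * val z)) * b t).

Definition is_inner_product {R : realType} {H : lmodType (complex R)}
    (ip : H -> H -> complex R) :=
  (forall (a : complex R) (x y z : H), ip (a *: x + y) z = a * ip x z + ip y z) /\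
  (forall x y : H, ip y x = cconj (ip x y)) /\
  (forall x : H, 0 <= complex.Re (ip x x)) /\
  (forall x : H, ip x x = 0 -> x = 0).

Definition hnorm {R : realType} {H : lmodType (complex R)}
    (ip : H -> H -> complex R) (x : H) : R := Num.sqrt (complex.Re (ip x x)).

Definition is_hilbert {R : realType} {H : lmodType (complex R)}
    (ip : H -> H -> complex R) :=
  is_inner_product ip /\
  (forall u : nat -> H,
     (forall e : R, 0 < e -> exists N, forall m n, (N <= m)%N -> (N <= n)%N ->
        hnorm ip (u m - u n) < e) ->
     exists l : H, hnorm ip (u n - l) @[n --> \oo] --> 0).

Definition is_bounded_op {R : realType} {H : lmodType (complex R)}
    (ip : H -> H -> complex R) (S : H -> H) :=
  (forall (a : complex R) (x y : H), S (a *: x + y) = a *: S x + S y) /\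
  (exists M : R, forall x, hnorm ip (S x) <= M * hnorm ip x).

Definition opnorm {R : realType} {H : lmodType (complex R)}
    (ip : H -> H -> complex R) (S : H -> H) : R :=
  sup [set hnorm ip (S x) | x in [set x | hnorm ip x <= 1]].

Definition is_C0_semigroup {R : realType} {H : lmodType (complex R)}
    (ip : H -> H -> complex R) (T : R -> H -> H) :=
  (forall t : R, 0 <= t -> is_bounded_op ip (T t)) /\
  T 0 = id /\
  (forall s t : R, 0 <= s -> 0 <= t -> T (s + t) = T s \o T t) /\
  (forall x : H, hnorm ip (T t x - x) @[t --> 0^'+] --> 0).

Definition is_bounded_semigroup {R : realType} {H : lmodType (complex R)}
    (ip : H -> H -> complex R) (T : R -> H -> H) :=
  exists M : R, forall t : R, 0 <= t -> opnorm ip (T t) <= M.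

Definition sg_bound {R : realType} {H : lmodType (complex R)}
    (ip : H -> H -> complex R) (T : R -> H -> H) : R :=
  sup [set opnorm ip (T t) | t in `[0, +oo[].

(* S = \int_0^oo b(t) T_t dt  (strong integral), characterised through
   <S x, y> = \int_0^oo b(t) <T_t x, y> dt for all x, y *)
Definition is_int_bT {R : realType} {H : lmodType (complex R)}
    (ip : H -> H -> complex R) (T : R -> H -> H) (b : R -> complex R)
    (S : H -> H) :=
  forall x y : H, ip (S x) y = cint `[0, +oo[ (fun t => b t * ip (T t x) y).

Definition is_bdd_alg_hom {R : realType} {H : lmodType (complex R)}
    (ip : H -> H -> complex R) (rho : (Cplus R -> complex R) -> H -> H) :=
  (forall Phi, in_A0C Phi -> is_bounded_op ip (rho Phi)) /\
  (forall Phi Psi, in_A0C Phi -> in_A0C Psi ->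
     rho (fun z => Phi z + Psi z) = (fun x => rho Phi x + rho Psi x)) /\
  (forall (a : complex R) Phi, in_A0C Phi ->
     rho (fun z => a * Phi z) = (fun x => a *: rho Phi x)) /\
  (forall Phi Psi, in_A0C Phi -> in_A0C Psi ->
     rho (fun z => Phi z * Psi z) = rho Phi \o rho Psi) /\
  (exists M : R, forall Phi, in_A0C Phi -> opnorm ip (rho Phi) <= M * normA0C Phi).

(* Main.v *)
Require Import Defs.
From HB Require Import structures.
From mathcomp Require Import all_boot all_order all_algebra.
From mathcomp Require Import all_classical all_reals all_analysis.
From mathcomp Require Import measurable_realfun complex ring lra.
Import Order.TTheory GRing.Theory Num.Theory.
Import numFieldNormedType.Exports.
Set Implicit Arguments.
Unset Strict Implicit.
Unset Printing Implicit Defensive.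
Local Open Scope ring_scope.
Local Open Scope classical_set_scope.

(** Everything rests on the bound [C^2 S] for the norm of the integral of [b(t) T_t] when the
    transform of [b] has a representation as the sum of [f_k * h_k] with the sum of
    [|f_k|_oo |h_k|_1] equal to [S]. By linearity one treats a single term, that is, the integral
    over the half-line of the product of the Fourier transforms of [f] and [h] with
    [<T_t x, y>]. Sampled on a lattice, the transform of [h] gives the coefficients of an analytic
    polynomial which is dominated on the unit circle by a trigonometric polynomial of mean
    [|h|_1]. The Fejer-Riesz theorem writes the latter as [|q|^2], so the former is a product of
    two analytic factors with the same square mean, and [<T_(s+t) x, y> = <T_s x, T_t^* y>]
    splits accordingly: Cauchy-Schwarz and Parseval give the bound.

    General elements [F] of A_0 are tested against integrable kernels [M_n] whose transforms
    converge boundedly to [t |-> <T_t x, y>], and [rho Phi] is the weak limit of the integrals of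
    [Phi(1/n - iu) M_n(u)]. On Laplace transforms this limit is the integral of [b(t) T_t].
    Laplace transforms are dense in A_0, and the bound for the damped semigroups
    [e^(-2t/n) T_t], being uniform in [n], carries the existence of the limit and the
    multiplicativity over to A_0; density also gives uniqueness. *)

(** The constant C^2 has one factor C from each side of the splitting: one from the orbit of x under
    T_s, one from the orbit of y under the adjoints. Classically the splitting is the factorization
    of an H^1 function into two H^2 functions. Sampling reduces it to polynomials, at the price of
    the Fejer weights 1 - n / N, which make the sampled polynomial an average of h against a
    nonnegative kernel and hence dominated by the same average of |h|. The lattice step pi / A is
    dictated by the support [-A, A] of f, which then fills exactly one period. An orbit is bounded
    but not integrable, so the kernels need two regularizations: a damping e^(-t/n), and a smoothing
    by a density whose transform decays like u^-2. The height 1/n of the line damps once more,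
    whence the rate 2/n. On Laplace transforms the pairing is then exactly a matrix coefficient of
    an operator built from a damped semigroup with the same bound C. The pairing reads only the
    values of Phi in the half-plane, so rho depends on Phi and not on the choice of F, and sums and
    products can be tested directly. *)

Section real_limits.
Context {R : realType}.

Lemma cvgn_ge (u : nat -> R) (a l : R) : u n @[n --> \oo] --> l ->
  (forall n, a <= u n) -> a <= l.
Proof.
move=> cv h; rewrite -(cvg_lim _ cv)//; apply: limr_ge; last exact: nearW.
by apply/cvg_ex; exists l.
Qed.

End real_limits.

(** * Complex numbers in coordinates *)

Section complex_basics.
Context {R : realType}.
Implicit Types (z w : complex R) (x y : R).
Local Notation Re := complex.Re.
Local Notation Im := complex.Im.

Lemma ReD z w : Re (z + w) = Re z + Re w. Proof. by case: z w => [a b] [c d]. Qed.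
Lemma ImD z w : Im (z + w) = Im z + Im w. Proof. by case: z w => [a b] [c d]. Qed.
Lemma ReN z : Re (- z) = - Re z. Proof. by case: z. Qed.
Lemma ImN z : Im (- z) = - Im z. Proof. by case: z. Qed.
Lemma ReB z w : Re (z - w) = Re z - Re w. Proof. by rewrite ReD ReN. Qed.
Lemma ImB z w : Im (z - w) = Im z - Im w. Proof. by rewrite ImD ImN. Qed.
Lemma ReM z w : Re (z * w) = Re z * Re w - Im z * Im w.
Proof. by case: z w => [a b] [c d]. Qed.
Lemma ImM z w : Im (z * w) = Re z * Im w + Im z * Re w.
Proof. by case: z w => [a b] [c d] /=; rewrite [b * c]mulrC. Qed.

Lemma complex_eqP z w : Re z = Re w -> Im z = Im w -> z = w.
Proof. by case: z w => [a b] [c d] /= -> ->. Qed.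

Lemma rCD x y : rC (x + y) = rC x + rC y :> complex R.
Proof. by apply: complex_eqP; rewrite ?ReD ?ImD /= ?addr0. Qed.
Lemma rCM x y : rC (x * y) = rC x * rC y :> complex R.
Proof. by apply: complex_eqP; rewrite ?ReM ?ImM /= ?mulr0 ?mul0r ?subr0 ?addr0. Qed.
Lemma rCN x : rC (- x) = - rC x :> complex R.
Proof. by apply: complex_eqP; rewrite ?ReN ?ImN /= ?oppr0. Qed.
Lemma rC0 : rC 0 = 0 :> complex R. Proof. by []. Qed.
Lemma rC1 : rC 1 = 1 :> complex R. Proof. by []. Qed.
Lemma rC_sum (I : Type) (r : seq I) (P : pred I) (F : I -> R) :
  rC (\sum_(i <- r | P i) F i) = \sum_(i <- r | P i) rC (F i).
Proof. exact: (big_morph rC rCD rC0). Qed.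
Lemma rCMn x n : rC (x *+ n) = rC x *+ n :> complex R.
Proof. by elim: n => [|n IH]; rewrite ?mulr0n// !mulrS rCD IH. Qed.
Lemma rC_nat n : rC n%:R = n%:R :> complex R.
Proof. by rewrite rCMn. Qed.

Lemma cabs_normc z : cabs z = ComplexField.Normc.normc z.
Proof. by case: z. Qed.
Lemma cabs_ge0 z : 0 <= cabs z. Proof. exact: sqrtr_ge0. Qed.
Lemma cabsM z w : cabs (z * w) = cabs z * cabs w.
Proof. by rewrite !cabs_normc ComplexField.Normc.normcM. Qed.
Lemma cabs0 : cabs (0 : complex R) = 0.
Proof. by rewrite cabs_normc ComplexField.Normc.normc0. Qed.
Lemma cabs1 : cabs (1 : complex R) = 1.
Proof. by rewrite cabs_normc ComplexField.Normc.normc1. Qed.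
Lemma cabsD z w : cabs (z + w) <= cabs z + cabs w.
Proof. by rewrite !cabs_normc; exact: le_normcD. Qed.
Lemma cabsN z : cabs (- z) = cabs z.
Proof. by rewrite !cabs_normc normcN. Qed.
Lemma cabsB z w : cabs (z - w) <= cabs z + cabs w.
Proof. by rewrite -(cabsN w); exact: cabsD. Qed.
Lemma cabs_distC z w : cabs (z - w) = cabs (w - z).
Proof. by rewrite -cabsN opprB. Qed.
Lemma cabs_eq0 z : cabs z = 0 -> z = 0.
Proof. by rewrite cabs_normc => /ComplexField.Normc.eq0_normc. Qed.
Lemma cabsV z : cabs z^-1 = (cabs z)^-1.
Proof. by rewrite !cabs_normc ComplexField.Normc.normcV. Qed.
Lemma cabsX z n : cabs (z ^+ n) = cabs z ^+ n.
Proof. by elim: n => [|n IH]; rewrite ?expr0 ?cabs1// !exprS cabsM IH. Qed.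
Lemma cabs_rC x : cabs (rC x) = `|x|.
Proof. by rewrite /cabs /= expr0n /= addr0 sqrtr_sqr. Qed.
Lemma cabs_sum (I : Type) (r : seq I) (P : pred I) (F : I -> complex R) :
  cabs (\sum_(i <- r | P i) F i) <= \sum_(i <- r | P i) cabs (F i).
Proof.
elim/big_ind2 : _ => //; first by rewrite cabs0.
by move=> ? ? ? ? h1 h2; rewrite (le_trans (cabsD _ _))// lerD.
Qed.
Lemma sqr_cabs z : cabs z ^+ 2 = Re z ^+ 2 + Im z ^+ 2.
Proof. by rewrite sqr_sqrtr// addr_ge0// sqr_ge0. Qed.
Lemma le_Re_cabs z : `|Re z| <= cabs z.
Proof.
rewrite -(@ler_pXn2r _ 2)// ?nnegrE ?cabs_ge0// sqr_cabs real_normK ?num_real//.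
by rewrite lerDl sqr_ge0.
Qed.
Lemma le_Im_cabs z : `|Im z| <= cabs z.
Proof.
rewrite -(@ler_pXn2r _ 2)// ?nnegrE ?cabs_ge0// sqr_cabs real_normK ?num_real//.
by rewrite lerDr sqr_ge0.
Qed.
Lemma cabs_le_ReIm z : cabs z <= `|Re z| + `|Im z|.
Proof.
rewrite -(@ler_pXn2r _ 2)// ?nnegrE ?cabs_ge0 ?addr_ge0// sqr_cabs.
rewrite sqrrD !real_normK ?num_real// -addrA [_ *+ 2 + _]addrC addrA lerDl.
by rewrite mulrn_wge0// mulr_ge0.
Qed.
Lemma Re_le_cabs z : Re z <= cabs z.
Proof. exact: le_trans (ler_norm _) (le_Re_cabs _). Qed.

Lemma cconjc z : cconj z = conjc z. Proof. by case: z. Qed.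
Lemma cconjD z w : cconj (z + w) = cconj z + cconj w.
Proof. by rewrite !cconjc rmorphD. Qed.
Lemma cconjM z w : cconj (z * w) = cconj z * cconj w.
Proof. by rewrite !cconjc rmorphM. Qed.
Lemma cconjN z : cconj (- z) = - cconj z.
Proof. by rewrite !cconjc rmorphN. Qed.
Lemma cconjX z n : cconj (z ^+ n) = cconj z ^+ n.
Proof. by rewrite !cconjc rmorphXn. Qed.
Lemma cconjV z : cconj z^-1 = (cconj z)^-1.
Proof. by rewrite !cconjc fmorphV. Qed.
Lemma cconjK : involutive (@cconj R).
Proof. by move=> z; rewrite !cconjc conjcK. Qed.
Lemma cconj0 : cconj 0 = 0 :> complex R. Proof. by rewrite cconjc conjc0. Qed.
Lemma cconj1 : cconj 1 = 1 :> complex R. Proof. by rewrite cconjc conjc1. Qed.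
Lemma cconj_rC x : cconj (rC x) = rC x.
Proof. by rewrite /cconj /= oppr0. Qed.
Lemma cconj_sum (I : Type) (r : seq I) (P : pred I) (F : I -> complex R) :
  cconj (\sum_(i <- r | P i) F i) = \sum_(i <- r | P i) cconj (F i).
Proof. exact: (big_morph (@cconj R) cconjD cconj0). Qed.
Lemma cabs_conj z : cabs (cconj z) = cabs z.
Proof. by rewrite /cabs /= sqrrN. Qed.
Lemma mul_cconj z : z * cconj z = rC (cabs z ^+ 2).
Proof.
rewrite sqr_cabs; apply: complex_eqP; rewrite ?ReM ?ImM /=; first by rewrite mulrN opprK -!expr2.
by rewrite mulrN mulrC addNr.
Qed.

Lemma cexpD z w : cexp (z + w) = cexp z * cexp w.
Proof.
apply: complex_eqP; rewrite ?ReM ?ImM /= ReD ImD expRD ?cosD ?sinD; ring.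
Qed.
Lemma cexp0 : cexp 0 = 1 :> complex R.
Proof. by rewrite /cexp /= expR0 cos0 sin0 mulr1 mulr0. Qed.
Lemma cabs_cexp z : cabs (cexp z) = expR (Re z).
Proof.
rewrite /cabs /= !exprMn -mulrDr cos2Dsin2 mulr1 sqrtr_sqr ger0_norm// expR_ge0.
Qed.
Lemma cconj_cexp z : cconj (cexp z) = cexp (cconj z).
Proof. by rewrite /cexp /cconj /= cosN sinN mulrN. Qed.
Lemma cexpMn z n : cexp (z *+ n) = cexp z ^+ n.
Proof. by elim: n => [|n IH]; rewrite ?mulr0n ?cexp0// mulrS cexpD IH exprS. Qed.

Lemma unit_cexp x : cabs (cexp (Complex 0 x)) = 1.
Proof. by rewrite cabs_cexp expR0. Qed.

End complex_basics.

(** * Integration of complex functions *)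

Section cint_toolkit.
Context {R : realType}.
Local Notation Re := complex.Re.
Local Notation Im := complex.Im.
Local Notation mu := (@lebesgue_measure R).
Implicit Types (D : set R) (f g h : R -> complex R).

Lemma lintegrableZ D (k : R) (f : R -> R) : measurable D ->
  mu.-integrable D (EFin \o f) -> mu.-integrable D (EFin \o (fun x => k * f x)).
Proof. by move=> mD fi; exact: (@integrableZl _ _ _ mu D mD k _ fi). Qed.

Lemma lintegrableD D (f g : R -> R) : measurable D ->
  mu.-integrable D (EFin \o f) -> mu.-integrable D (EFin \o g) ->
  mu.-integrable D (EFin \o (fun x => f x + g x)).
Proof. by move=> mD fi gi; exact: (@integrableD _ _ _ mu D mD _ _ fi gi). Qed.

Lemma eq_lintegrable D (f g : R -> R) : measurable D -> (forall x, D x -> f x = g x) ->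
  mu.-integrable D (EFin \o f) -> mu.-integrable D (EFin \o g).
Proof.
move=> mD fg; apply: (@eq_integrable _ _ _ mu D mD) => x /set_mem Dx /=.
by rewrite fg.
Qed.

Definition cmeas D f :=
  measurable_fun D (fun x => Re (f x)) /\ measurable_fun D (fun x => Im (f x)).

Lemma cmeas_ext D f g : (forall x, D x -> f x = g x) -> cmeas D f -> cmeas D g.
Proof.
move=> fg [mr mi]; split; [apply: eq_measurable_fun mr|apply: eq_measurable_fun mi];
  by move=> x /set_mem xD; rewrite fg.
Qed.

Lemma cmeas_cst D (c : complex R) : cmeas D (fun=> c).
Proof. by split; exact: measurable_cst. Qed.

Lemma cmeasD D f g : cmeas D f -> cmeas D g -> cmeas D (fun x => f x + g x).
Proof.
move=> [fr fi] [gr gi]; split.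
  by under eq_fun do rewrite ReD; exact: measurable_funD.
by under eq_fun do rewrite ImD; exact: measurable_funD.
Qed.

Lemma cmeasN D f : cmeas D f -> cmeas D (fun x => - f x).
Proof.
move=> [fr fi]; split.
  by under eq_fun do rewrite ReN; exact: measurableT_comp.
by under eq_fun do rewrite ImN; exact: measurableT_comp.
Qed.

Lemma cmeasB D f g : cmeas D f -> cmeas D g -> cmeas D (fun x => f x - g x).
Proof. by move=> mf mg; apply: cmeasD => //; exact: cmeasN. Qed.

Lemma cmeasM D f g : cmeas D f -> cmeas D g -> cmeas D (fun x => f x * g x).
Proof.
move=> [fr fi] [gr gi]; split.
  under eq_fun do rewrite ReM.
  by apply: measurable_funB; exact: measurable_funM.
under eq_fun do rewrite ImM.
by apply: measurable_funD; exact: measurable_funM.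
Qed.

Lemma cmeas_sum D (I : Type) (r : seq I) (F : I -> R -> complex R) :
  (forall i, cmeas D (F i)) -> cmeas D (fun x => \sum_(i <- r) F i x).
Proof.
move=> mF; elim: r => [|i r IH].
  by under eq_fun do rewrite big_nil; exact: cmeas_cst.
by under eq_fun do rewrite big_cons; exact: cmeasD.
Qed.

Lemma cmeas_cabs D f : cmeas D f -> measurable_fun D (fun x => cabs (f x)).
Proof.
move=> [fr fi]; apply: (measurableT_comp (continuous_measurable_fun (@sqrt_continuous R))).
by apply: measurable_funD; exact: measurable_funX.
Qed.

Lemma cintegrable_meas D f : cintegrable D f -> cmeas D f.
Proof.
by move=> [/measurable_int/measurable_EFinP ? /measurable_int/measurable_EFinP ?].
Qed.

Lemma integrable_cabs D f : measurable D -> cintegrable D f ->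
  mu.-integrable D (EFin \o (fun x => cabs (f x))).
Proof.
move=> mD fi; have [fr fim] := fi.
apply: (@le_integrable _ _ _ mu D mD _
  (EFin \o (fun x => `|Re (f x)| + `|Im (f x)|))).
- by apply/measurable_EFinP; apply: cmeas_cabs; exact: cintegrable_meas.
- move=> x Dx /=; rewrite lee_fin ger0_norm ?cabs_ge0//.
  by rewrite [leRHS]ger0_norm ?addr_ge0// cabs_le_ReIm.
- exact: (lintegrableD mD (integrable_norm fr) (integrable_norm fim)).
Qed.

Lemma cintegrable_le D f (g : R -> R) : measurable D -> cmeas D f ->
  mu.-integrable D (EFin \o g) -> (forall x, D x -> cabs (f x) <= g x) ->
  cintegrable D f.
Proof.
move=> mD [fr fi] ig fg; split.
- apply: le_integrable ig => //; first exact/measurable_EFinP.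
  move=> x Dx /=; rewrite lee_fin (le_trans (le_Re_cabs _))// (le_trans (fg _ Dx))//.
  exact: ler_norm.
- apply: le_integrable ig => //; first exact/measurable_EFinP.
  move=> x Dx /=; rewrite lee_fin (le_trans (le_Im_cabs _))// (le_trans (fg _ Dx))//.
  exact: ler_norm.
Qed.

Lemma cintegrable_ext D f g : measurable D -> (forall x, D x -> f x = g x) ->
  cintegrable D f -> cintegrable D g.
Proof.
move=> mD fg [fr fi]; split; [apply: eq_integrable fr|apply: eq_integrable fi] => //;
  by move=> x /set_mem Dx /=; rewrite fg.
Qed.

Lemma cintegrable0 D : measurable D -> cintegrable D (fun=> 0 : complex R).
Proof. by move=> mD; split; exact: integrable0. Qed.

Lemma cintegrableD D f g : measurable D -> cintegrable D f -> cintegrable D g ->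
  cintegrable D (fun x => f x + g x).
Proof.
move=> mD [fr fi] [gr gi]; split.
  by apply: eq_lintegrable (lintegrableD mD fr gr) => // x _; rewrite ReD.
by apply: eq_lintegrable (lintegrableD mD fi gi) => // x _; rewrite ImD.
Qed.

Lemma cintegrable_mulb D f g (K : R) : measurable D -> cintegrable D f ->
  cmeas D g -> (forall x, D x -> cabs (g x) <= K) ->
  cintegrable D (fun x => f x * g x).
Proof.
move=> mD fi mg gK.
apply: (@cintegrable_le _ _ (fun x => K * cabs (f x))) => //.
- by apply: cmeasM => //; exact: cintegrable_meas.
- exact: (lintegrableZ K mD (integrable_cabs mD fi)).
- by move=> x Dx; rewrite cabsM mulrC ler_wpM2r ?cabs_ge0// gK.
Qed.

Lemma cintegrable_bmul D f g (K : R) : measurable D -> cintegrable D f ->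
  cmeas D g -> (forall x, D x -> cabs (g x) <= K) ->
  cintegrable D (fun x => g x * f x).
Proof.
move=> mD fi mg gK; apply: cintegrable_ext (cintegrable_mulb mD fi mg gK) => //.
by move=> x _; rewrite mulrC.
Qed.

Lemma cintegrableZ D f (a : complex R) : measurable D -> cintegrable D f ->
  cintegrable D (fun x => a * f x).
Proof.
by move=> mD fi; apply: (cintegrable_bmul mD fi (cmeas_cst D a)) => x _; exact: lexx.
Qed.

Lemma cintegrableN D f : measurable D -> cintegrable D f -> cintegrable D (fun x => - f x).
Proof.
by move=> mD fi; under eq_fun do rewrite -mulN1r; exact: cintegrableZ.
Qed.

Lemma cintegrableB D f g : measurable D -> cintegrable D f -> cintegrable D g ->
  cintegrable D (fun x => f x - g x).
Proof. by move=> mD fi gi; apply: cintegrableD => //; exact: cintegrableN. Qed.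

Lemma cintegrable_sum D (I : Type) (r : seq I) (F : I -> R -> complex R) :
  measurable D -> (forall i, cintegrable D (F i)) ->
  cintegrable D (fun x => \sum_(i <- r) F i x).
Proof.
move=> mD mF; elim: r => [|i r IH].
  by under eq_fun do rewrite big_nil; exact: cintegrable0.
by under eq_fun do rewrite big_cons; exact: cintegrableD.
Qed.

Lemma eq_cint D f g : (forall x, D x -> f x = g x) -> cint D f = cint D g.
Proof.
by move=> fg; congr Complex; apply: eq_Rintegral => x /set_mem Dx; rewrite fg.
Qed.

Lemma cint0 D : cint D (fun=> 0) = 0 :> complex R.
Proof.
by rewrite /cint /= /Rintegral integral0.
Qed.

Lemma cintD D f g : measurable D -> cintegrable D f -> cintegrable D g ->
  cint D (fun x => f x + g x) = cint D f + cint D g.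
Proof.
move=> mD [fr fi] [gr gi]; apply: complex_eqP; rewrite ?ReD ?ImD /cint /=.
  by rewrite -RintegralD//; apply: eq_Rintegral => x _; rewrite ReD.
by rewrite -RintegralD//; apply: eq_Rintegral => x _; rewrite ImD.
Qed.

Lemma cintZ D f (a : complex R) : measurable D -> cintegrable D f ->
  cint D (fun x => a * f x) = a * cint D f.
Proof.
move=> mD [fr fi]; apply: complex_eqP; rewrite ?ReM ?ImM /cint /=.
  rewrite -!RintegralZl// -RintegralB//.
  - by apply: eq_Rintegral => x _; rewrite ReM.
  - exact: (lintegrableZ (Re a) mD fr).
  - exact: (lintegrableZ (Im a) mD fi).
rewrite -!RintegralZl// -RintegralD//.
- by apply: eq_Rintegral => x _; rewrite ImM.
- exact: (lintegrableZ (Re a) mD fi).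
- exact: (lintegrableZ (Im a) mD fr).
Qed.

Lemma cintZr D f (a : complex R) : measurable D -> cintegrable D f ->
  cint D (fun x => f x * a) = cint D f * a.
Proof. by move=> mD fi; rewrite mulrC -cintZ//; apply: eq_cint => x _; rewrite mulrC. Qed.

Lemma cintN D f : measurable D -> cintegrable D f ->
  cint D (fun x => - f x) = - cint D f.
Proof.
by move=> mD fi; rewrite -mulN1r -cintZ//; apply: eq_cint => x _; rewrite mulN1r.
Qed.

Lemma cintB D f g : measurable D -> cintegrable D f -> cintegrable D g ->
  cint D (fun x => f x - g x) = cint D f - cint D g.
Proof.
move=> mD fi gi; rewrite cintD ?cintN//; exact: cintegrableN.
Qed.

Lemma cint_sum D (I : Type) (r : seq I) (F : I -> R -> complex R) :
  measurable D -> (forall i, cintegrable D (F i)) ->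
  cint D (fun x => \sum_(i <- r) F i x) = \sum_(i <- r) cint D (F i).
Proof.
move=> mD mF; elim: r => [|i r IH].
  by rewrite big_nil -[RHS](cint0 D); apply: eq_cint => x _; rewrite big_nil.
rewrite big_cons -IH -cintD//; first by apply: eq_cint => x _; rewrite big_cons.
exact: cintegrable_sum.
Qed.

(* Rotating the integral onto the positive axis reduces to real parts. *)
Lemma cabs_cint D f : measurable D -> cintegrable D f ->
  cabs (cint D f) <= Rintegral mu D (fun x => cabs (f x)).
Proof.
move=> mD fi; set c := cint D f.
have [c0|c0] := eqVneq (cabs c) 0.
  by rewrite c0; apply: Rintegral_ge0 => x _; exact: cabs_ge0.
have cp : 0 < cabs c by rewrite lt_neqAle eq_sym c0 cabs_ge0.
pose a := cconj c * rC (cabs c)^-1.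
have aE : cabs a = 1 by rewrite cabsM cabs_conj cabs_rC gtr0_norm ?invr_gt0// divff.
have -> : cabs c = Re (cint D (fun x => a * f x)).
  rewrite cintZ// -/c /a mulrAC [_ * c]mulrC mul_cconj -rCM /= expr2.
  by rewrite -mulrA divff// mulr1.
rewrite /cint /=; apply: le_Rintegral => //.
- by have [] := cintegrableZ a mD fi.
- exact: integrable_cabs.
- by move=> x _; rewrite (le_trans (Re_le_cabs _))// cabsM aE mul1r.
Qed.

Lemma cabs_cint_le D f (g : R -> R) : measurable D -> cmeas D f ->
  mu.-integrable D (EFin \o g) -> (forall x, D x -> cabs (f x) <= g x) ->
  cabs (cint D f) <= Rintegral mu D g.
Proof.
move=> mD mf ig fg; have fi := cintegrable_le mD mf ig fg.
by rewrite (le_trans (cabs_cint mD fi))//; apply: le_Rintegral => //; exact: integrable_cabs.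
Qed.

Lemma L1norm_ge0 h : 0 <= L1norm h.
Proof. by apply: Rintegral_ge0 => x _; exact: cabs_ge0. Qed.

Lemma cabs_cint_mulb f g (K : R) : cintegrable setT f ->
  cmeas setT g -> (forall x, cabs (g x) <= K) ->
  cabs (cint setT (fun x => f x * g x)) <= K * L1norm f.
Proof.
move=> fi mg gK; rewrite /L1norm -RintegralZl//; last exact: integrable_cabs.
apply: cabs_cint_le => //.
- by apply: cmeasM => //; exact: cintegrable_meas.
- exact: (lintegrableZ K measurableT (integrable_cabs measurableT fi)).
- by move=> x _; rewrite cabsM mulrC ler_wpM2r ?cabs_ge0.
Qed.

Lemma ccvgP (u : nat -> complex R) l : ccvg u l <->
  (Re (u n) @[n --> \oo] --> Re l /\ Im (u n) @[n --> \oo] --> Im l).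
Proof.
split=> [ul|[ur ui]].
  split; apply/cvgrPdist_lt => e e0; move/cvgrPdist_lt : ul => /(_ e e0);
    apply: filterS => n; rewrite sub0r normrN ger0_norm ?cabs_ge0//;
    apply: le_lt_trans; rewrite cabs_distC.
    by rewrite -ReB le_Re_cabs.
  by rewrite -ImB le_Im_cabs.
apply: (@squeeze_cvgr _ _ _ _ (fun=> 0) (fun n => `|Re (u n) - Re l| + `|Im (u n) - Im l|)).
- by apply: nearW => n; rewrite cabs_ge0 /= -ReB -ImB cabs_le_ReIm.
- exact: cvg_cst.
- rewrite -(addr0 0); apply: cvgD; rewrite -(@normr0 _ R) -(subrr (Re l)).
    by apply: cvg_norm; apply: cvgB => //; exact: cvg_cst.
  by rewrite (subrr (Re l)) -(subrr (Im l)); apply: cvg_norm; apply: cvgB => //; exact: cvg_cst.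
Qed.

Lemma cint_dominated D (f_ : nat -> R -> complex R) f (g : R -> R) :
  measurable D -> (forall n, cmeas D (f_ n)) -> cmeas D f ->
  mu.-integrable D (EFin \o g) ->
  (forall n x, D x -> cabs (f_ n x) <= g x) ->
  (forall x, D x -> ccvg (f_ ^~ x) (f x)) ->
  ccvg (fun n => cint D (f_ n)) (cint D f).
Proof.
move=> mD mf_ [fr fi] ig dom cv; apply/ccvgP; rewrite /cint /=.
have key (u_ : nat -> R -> R) (u : R -> R) : (forall n, measurable_fun D (u_ n)) ->
    measurable_fun D u -> (forall n x, D x -> `|u_ n x| <= g x) ->
    (forall x, D x -> u_ n x @[n --> \oo] --> u x) ->
    Rintegral mu D (u_ n) @[n --> \oo] --> Rintegral mu D u.
  move=> mu_ mu' ug cu.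
  have [|||||iu _] := @dominated_convergence _ _ R mu D mD
    (fun n => EFin \o u_ n) (EFin \o u) (EFin \o g).
  - by move=> n; apply/measurable_EFinP; exact: mu_.
  - by apply/measurable_EFinP; exact: mu'.
  - apply: aeW => x Dx /=; apply: cvg_EFin; first exact: nearW.
    exact: cu.
  - exact: ig.
  - by apply: aeW => x n Dx /=; rewrite lee_fin ug.
  move=> h; rewrite /Rintegral; apply: fine_cvg.
  by rewrite fineK//; exact: integrable_fin_num.
split; apply: key => //.
- by move=> n; have [] := mf_ n.
- by move=> n x Dx; exact: le_trans (le_Re_cabs _) (dom _ _ Dx).
- by move=> x /cv/ccvgP[].
- by move=> n; have [] := mf_ n.
- by move=> n x Dx; exact: le_trans (le_Im_cabs _) (dom _ _ Dx).
- by move=> x /cv/ccvgP[].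
Qed.

End cint_toolkit.

(** * Fubini, translation and reflection of integrals *)

Section fubini_translation.
Context {R : realType}.
Local Notation Re := complex.Re.
Local Notation Im := complex.Im.
Local Notation mu := (@lebesgue_measure R).

Section real_fubini.
Variables (u : R * R -> R) (p q : R -> R).
Hypothesis mu_ : measurable_fun [set: R * R] u.
Hypothesis ip : mu.-integrable setT (EFin \o p).
Hypothesis iq : mu.-integrable setT (EFin \o q).
Hypothesis dom : forall x y, `|u (x, y)| <= p x * q y.

Lemma integrable_section1 x : mu.-integrable setT (EFin \o (fun y => u (x, y))).
Proof.
apply: (@le_integrable _ _ _ mu setT measurableT _ (EFin \o (fun y => p x * q y))).
- apply/measurable_EFinP; exact: (measurableT_comp mu_ (measurable_pair1 x)).
- by move=> y _ /=; rewrite lee_fin (le_trans (dom _ _))// ler_norm.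
- exact: (lintegrableZ (p x) measurableT iq).
Qed.

Lemma integrable_section2 y : mu.-integrable setT (EFin \o (fun x => u (x, y))).
Proof.
apply: (@le_integrable _ _ _ mu setT measurableT _ (EFin \o (fun x => q y * p x))).
- apply/measurable_EFinP; exact: (measurableT_comp mu_ (measurable_pair2 y)).
- by move=> x _ /=; rewrite lee_fin (le_trans (dom _ _))// mulrC ler_norm.
- exact: (lintegrableZ (q y) measurableT ip).
Qed.

(** Tonelli reduces this to the iterated integral of [|u|], which is at most the product of the
    integrals of [|p|] and [|q|]. *)
Lemma integrable_prod_dom : (mu \x mu)%E.-integrable setT (EFin \o u).
Proof.
apply/integrable12ltyP; first by apply/measurable_EFinP; exact: mu_.
have qfin : (\int[mu]_y `|(EFin \o q) y| < +oo)%E by have /integrableP[] := iq.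
have pfin : (\int[mu]_x `|(EFin \o p) x| < +oo)%E by have /integrableP[] := ip.
set Q := (\int[mu]_y `|(EFin \o q) y|)%E in qfin.
have Q0 : (0 <= Q)%E by apply: integral_ge0.
apply: (@le_lt_trans _ _ (\int[mu]_x (`|(EFin \o p) x| * Q))%E).
  apply: ge0_le_integral => //.
  - by move=> x _; exact: integral_ge0.
  - apply: (@measurable_fun_fubini_tonelli_F _ _ _ _ R mu (abse \o (EFin \o u))) => //.
    + by apply: measurableT_comp => //; apply/measurable_EFinP; exact: mu_.
    + by move=> z; exact: abse_ge0.
  - apply: emeasurable_funM => //; apply: measurableT_comp => //.
    by apply/measurable_EFinP; have /measurable_int/measurable_EFinP := ip.
  - move=> x _; rewrite /Q -ge0_integralZl//; last first.
      by apply: measurableT_comp => //; have /measurable_int := iq.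
    apply: ge0_le_integral => //.
    + apply: measurableT_comp => //; apply/measurable_EFinP.
      exact: (measurableT_comp mu_ (measurable_pair1 x)).
    + apply: emeasurable_funM => //; apply: measurableT_comp => //.
      by have /measurable_int := iq.
    + by move=> y _ /=; rewrite lee_fin (le_trans (dom _ _))// -normrM ler_norm.
rewrite ge0_integralZr//; last by apply: measurableT_comp => //; have /measurable_int := ip.
by rewrite lte_mul_pinfty// ?integral_ge0// ge0_fin_numE// integral_ge0.
Qed.

Lemma Rintegral_fubini :
  Rintegral mu setT (fun x => Rintegral mu setT (fun y => u (x, y))) =
  Rintegral mu setT (fun y => Rintegral mu setT (fun x => u (x, y))).
Proof.
rewrite /Rintegral; congr fine.
under eq_integral => x _.
  rewrite fineK; last by apply: (@integrable_fin_num _ _ _ mu) => //; exact: integrable_section1.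
  over.
under [RHS]eq_integral => y _.
  rewrite fineK; last by apply: (@integrable_fin_num _ _ _ mu) => //; exact: integrable_section2.
  over.
exact: (Fubini integrable_prod_dom).
Qed.

End real_fubini.

Definition jmeas (k : R * R -> complex R) :=
  measurable_fun [set: R * R] (fun z => Re (k z)) /\
  measurable_fun [set: R * R] (fun z => Im (k z)).

Lemma jmeasM k l : jmeas k -> jmeas l -> jmeas (fun z => k z * l z).
Proof.
move=> [fr fi] [gr gi]; split.
  under eq_fun do rewrite ReM.
  by apply: measurable_funB; exact: measurable_funM.
under eq_fun do rewrite ImM.
by apply: measurable_funD; exact: measurable_funM.
Qed.

Lemma jmeas_comp (f : R -> complex R) (phi : R * R -> R) :
  cmeas setT f -> measurable_fun setT phi -> jmeas (fun z => f (phi z)).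
Proof. by move=> [fr fi] mphi; split; [exact: (measurableT_comp fr mphi)|exact: (measurableT_comp fi mphi)]. Qed.

Lemma jmeas_section1 k x : jmeas k -> cmeas setT (fun y => k (x, y)).
Proof.
by move=> [kr ki]; split; [exact: (measurableT_comp kr (measurable_pair1 x))|
  exact: (measurableT_comp ki (measurable_pair1 x))].
Qed.

Lemma jmeas_section2 k y : jmeas k -> cmeas setT (fun x => k (x, y)).
Proof.
by move=> [kr ki]; split; [exact: (measurableT_comp kr (measurable_pair2 y))|
  exact: (measurableT_comp ki (measurable_pair2 y))].
Qed.

Section kernel_fubini.
Variables (a b : R -> complex R) (k : R * R -> complex R) (K : R).
Hypothesis ia : cintegrable setT a.
Hypothesis ib : cintegrable setT b.
Hypothesis mk : jmeas k.
Hypothesis bk : forall z, cabs (k z) <= K.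

Let G (z : R * R) := a z.1 * (b z.2 * k z).

Let mG : jmeas G.
Proof.
apply: jmeasM; first by apply: jmeas_comp measurable_fst; exact: cintegrable_meas.
by apply: jmeasM => //; apply: jmeas_comp measurable_snd; exact: cintegrable_meas.
Qed.

Let dG x y : cabs (G (x, y)) <= cabs (a x) * (K * cabs (b y)).
Proof.
rewrite /G /= !cabsM ler_wpM2l ?cabs_ge0// mulrC ler_wpM2r ?cabs_ge0//.
Qed.

Let ipa := integrable_cabs measurableT ia.
Let iqb := lintegrableZ K measurableT (integrable_cabs measurableT ib).

Let domRe x y : `|Re (G (x, y))| <= cabs (a x) * (K * cabs (b y)).
Proof. exact: le_trans (le_Re_cabs _) (dG _ _). Qed.
Let domIm x y : `|Im (G (x, y))| <= cabs (a x) * (K * cabs (b y)).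
Proof. exact: le_trans (le_Im_cabs _) (dG _ _). Qed.

Let inner1 x : cintegrable setT (fun y => b y * k (x, y)).
Proof. by apply: (cintegrable_mulb measurableT ib (jmeas_section1 x mk)) => y _; exact: bk. Qed.
Let inner2 y : cintegrable setT (fun x => a x * k (x, y)).
Proof. by apply: (cintegrable_mulb measurableT ia (jmeas_section2 y mk)) => x _; exact: bk. Qed.

(** A bounded kernel between two integrable weights is dominated by a product of integrable
    functions of one variable. The exchanges of transforms, convolutions and Poisson means below are
    instances. *)
Lemma cint_fubini :
  cint setT (fun x => a x * cint setT (fun y => b y * k (x, y))) =
  cint setT (fun y => b y * cint setT (fun x => a x * k (x, y))).
Proof.
transitivity (cint setT (fun x => cint setT (fun y => G (x, y)))).
  by apply: eq_cint => x _; rewrite -cintZ.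
transitivity (cint setT (fun y => cint setT (fun x => G (x, y)))); last first.
  by apply: eq_cint => x _; rewrite -cintZ//; apply: eq_cint => y _; rewrite /G /= mulrCA.
have [mr mi] := mG.
by apply: complex_eqP; rewrite /cint /=; [exact: (Rintegral_fubini mr ipa iqb domRe)|
  exact: (Rintegral_fubini mi ipa iqb domIm)].
Qed.

End kernel_fubini.

(** Tonelli makes the integrals of the positive and negative parts measurable as extended reals;
    their difference and [fine] preserve measurability. *)
Lemma measurable_Rintegral_section (u : R * R -> R) :
  measurable_fun [set: R * R] u ->
  measurable_fun setT (fun x => Rintegral mu setT (fun y => u (x, y))).
Proof.
move=> mu_; rewrite /Rintegral.
apply: (measurableT_comp (@fine_measurable R setT measurableT)).
have mEu : measurable_fun [set: R * R] (EFin \o u) by apply/measurable_EFinP.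
under eq_fun do rewrite integralE.
apply: emeasurable_funB.
- rewrite (_ : (fun x => _) = fubini_F mu ((EFin \o u)^\+)%E); last first.
    by apply/funext => x; apply: eq_integral => y _; rewrite !funeposE.
  exact: (@measurable_fun_fubini_tonelli_F _ _ _ _ R mu ((EFin \o u)^\+)%E
    (measurable_funepos mEu) (fun z => funepos_ge0 _ z)).
- rewrite (_ : (fun x => _) = fubini_F mu ((EFin \o u)^\-)%E); last first.
    by apply/funext => x; apply: eq_integral => y _; rewrite !funenegE.
  exact: (@measurable_fun_fubini_tonelli_F _ _ _ _ R mu ((EFin \o u)^\-)%E
    (measurable_funeneg mEu) (fun z => funeneg_ge0 _ z)).
Qed.

Lemma cmeas_cint_kernel (b : R -> complex R) (k : R * R -> complex R) :
  cmeas setT b -> jmeas k ->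
  cmeas setT (fun x => cint setT (fun y => b y * k (x, y))).
Proof.
move=> mb mk.
have [mr mi] : jmeas (fun z => b z.2 * k z).
  by apply: jmeasM => //; apply: jmeas_comp measurable_snd.
by split; rewrite /cint /=; [exact: (measurable_Rintegral_section mr)|
  exact: (measurable_Rintegral_section mi)].
Qed.

Section measure_preserving.
Variable phi : measurableTypeR R -> measurableTypeR R.
Hypothesis mphi : measurable_fun setT phi.
Hypothesis phi_itv : forall a b : R, mu (phi @^-1` `]a, b]%classic) = mu `]a, b]%classic.
HB.instance Definition _ := isMeasurableFun.Build _ _ _ _ phi mphi.

(** The pushforward of Lebesgue measure under [phi] agrees with Lebesgue measure on half-open
    intervals, hence on all measurable sets by uniqueness. *)
Lemma ge0_integral_preserving (f : measurableTypeR R -> \bar R) : measurable_fun setT f ->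
  (forall x, 0 <= f x)%E -> (\int[mu]_x f (phi x) = \int[mu]_x f x)%E.
Proof.
move=> mf f0.
rewrite [RHS](eq_measure_integral (pushforward mu phi)); last first.
  move=> A mA _; apply: (@lebesgue_measure_unique R (pushforward mu phi)) => //.
  by move=> X [[a b] _ <-]; rewrite -[LHS]phi_itv.
by rewrite ge0_integral_pushforward.
Qed.

Lemma Rintegral_preserving (f : R -> R) : measurable_fun setT f ->
  Rintegral mu setT (fun x => f (phi x)) = Rintegral mu setT f.
Proof.
move=> mf; rewrite /Rintegral; congr fine.
rewrite [LHS]integralE [RHS]integralE; congr (_ - _)%E.
  have mfp : measurable_fun setT ((EFin \o f)^\+)%E.
    by apply: measurable_funepos; apply/measurable_EFinP; exact: mf.
  rewrite -[RHS](@ge0_integral_preserving (EFin \o f)^\+%E mfp (fun x => funepos_ge0 _ x)).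
  by apply: eq_integral => x _; rewrite !funeposE.
have mfn : measurable_fun setT ((EFin \o f)^\-)%E.
  by apply: measurable_funeneg; apply/measurable_EFinP; exact: mf.
rewrite -[RHS](@ge0_integral_preserving (EFin \o f)^\-%E mfn (fun x => funeneg_ge0 _ x)).
by apply: eq_integral => x _; rewrite !funenegE.
Qed.

Lemma integrable_preserving (f : R -> R) : mu.-integrable setT (EFin \o f) ->
  mu.-integrable setT (EFin \o (fun x => f (phi x))).
Proof.
move=> /integrableP[mf fi]; apply/integrableP; split; first exact: (measurableT_comp mf mphi).
rewrite (@ge0_integral_preserving (fun x => `|(EFin \o f) x|%E))//.
exact: measurableT_comp.
Qed.

Lemma cint_preserving (f : R -> complex R) : cmeas setT f ->
  cint setT (fun x => f (phi x)) = cint setT f.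
Proof.
by move=> [mr mi]; congr Complex; [exact: (Rintegral_preserving mr)|exact: (Rintegral_preserving mi)].
Qed.

Lemma cintegrable_preserving (f : R -> complex R) : cintegrable setT f ->
  cintegrable setT (fun x => f (phi x)).
Proof.
by move=> [ir ii]; split; [exact: (integrable_preserving ir)|exact: (integrable_preserving ii)].
Qed.

End measure_preserving.

Lemma cmeas_comp (f : R -> complex R) (phi : R -> R) : cmeas setT f ->
  measurable_fun setT phi -> cmeas setT (fun x => f (phi x)).
Proof.
by move=> [mr mi] mphi; split; [exact: (measurableT_comp mr mphi)|exact: (measurableT_comp mi mphi)].
Qed.

Section shift_opp.
Variable c : R.

Lemma measurable_shift : measurable_fun [set: R] (fun x : R => x + c).
Proof. by apply: measurable_funD => //; exact: measurable_cst. Qed.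

Let shift_itv (a b : R) : mu ((fun x : R => x + c) @^-1` `]a, b]%classic) = mu `]a, b]%classic.
Proof.
have -> : (fun x : R => x + c) @^-1` `]a, b] = `]a - c, b - c]%classic.
  by apply/seteqP; split => x /=; rewrite !in_itv /= ltrBlDr lerBrDr.
rewrite !lebesgue_measure_itv /= !lte_fin ltrD2r; case: ifP => // _.
by congr (_%:E); ring.
Qed.

Let opp_itv (a b : R) : mu ((fun x : R => - x) @^-1` `]a, b]%classic) = mu `]a, b]%classic.
Proof.
have -> : (fun x : R => - x) @^-1` `]a, b] = `[- b, - a[%classic.
  by apply/seteqP; split => x /=; rewrite !in_itv /= ltrNr lerNl andbC.
rewrite !lebesgue_measure_itv /= !lte_fin ltrN2; case: ifP => // _.
by congr (_%:E); ring.
Qed.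

Let measurable_opp : measurable_fun [set: R] (fun x : R => - x).
Proof. exact: measurable_funN. Qed.

Lemma Rintegral_shift (f : R -> R) : measurable_fun setT f ->
  Rintegral mu setT (fun x => f (x + c)) = Rintegral mu setT f.
Proof. exact: (Rintegral_preserving measurable_shift shift_itv). Qed.

Lemma integrable_shift (f : R -> R) : mu.-integrable setT (EFin \o f) ->
  mu.-integrable setT (EFin \o (fun x => f (x + c))).
Proof. exact: (integrable_preserving measurable_shift shift_itv). Qed.

Lemma cint_shift (f : R -> complex R) : cmeas setT f ->
  cint setT (fun x => f (x + c)) = cint setT f.
Proof. exact: (cint_preserving measurable_shift shift_itv). Qed.

Lemma cintegrable_shift (f : R -> complex R) : cintegrable setT f ->
  cintegrable setT (fun x => f (x + c)).
Proof. exact: (cintegrable_preserving measurable_shift shift_itv). Qed.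

Lemma cmeas_shift (f : R -> complex R) : cmeas setT f -> cmeas setT (fun x => f (x + c)).
Proof. by move=> mf; exact: (cmeas_comp mf measurable_shift). Qed.

Lemma cint_opp (f : R -> complex R) : cmeas setT f ->
  cint setT (fun x => f (- x)) = cint setT f.
Proof. exact: (cint_preserving measurable_opp opp_itv). Qed.

Lemma cintegrable_opp (f : R -> complex R) : cintegrable setT f ->
  cintegrable setT (fun x => f (- x)).
Proof. exact: (cintegrable_preserving measurable_opp opp_itv). Qed.

Lemma cmeas_opp (f : R -> complex R) : cmeas setT f -> cmeas setT (fun x => f (- x)).
Proof. by move=> mf; exact: (cmeas_comp mf measurable_opp). Qed.

End shift_opp.

End fubini_translation.

(** * Polynomials on the unit circle *)

Section unit_circle.
Context {R : realType}.
Local Notation C := (complex R).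
Implicit Types (z w : C).

Lemma cabs_neq0 z : cabs z != 0 -> z != 0.
Proof. by apply: contraNneq => ->; rewrite cabs0. Qed.

Lemma unit_conj z : cabs z = 1 -> cconj z = z^-1.
Proof.
move=> z1; have z0 : z != 0 by rewrite cabs_neq0// z1 oner_neq0.
by apply: (mulfI z0); rewrite mul_cconj z1 expr1n divff.
Qed.

Lemma unit_mul_conj z : cabs z = 1 -> z * cconj z = 1.
Proof. by move=> z1; rewrite mul_cconj z1 expr1n. Qed.

Definition omega (M : nat) : C := cexp (Complex 0 (2 * pi / M%:R)).

Lemma omegaX M n : omega M ^+ n = cexp (Complex 0 (n%:R * (2 * pi / M%:R))).
Proof.
rewrite -cexpMn; congr cexp.
elim: n => [|n IH]; first by rewrite mulr0n mul0r.
by rewrite mulrS IH; apply: complex_eqP; rewrite ?ReD ?ImD /= ?addr0 -?natr1; ring.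
Qed.

Lemma cabs_omegaX M n : cabs (omega M ^+ n) = 1.
Proof. by rewrite omegaX unit_cexp. Qed.

Lemma omegaXM M : (0 < M)%N -> omega M ^+ M = 1.
Proof.
move=> M0; rewrite omegaX mulrC divfK ?pnatr_eq0 -?lt0n//.
by rewrite /cexp /= expR0 !mul1r mulr_natl cos2pi sin2pi.
Qed.

(** The real part is cos 2x with x = n pi / M strictly between 0 and pi, and cos 2x = 1 would force
    sin x = 0. *)
Lemma omegaX_neq1 M n : (0 < n < M)%N -> omega M ^+ n != 1.
Proof.
move=> /andP[n0 nM]; have M0 : (0 < M)%N by exact: leq_trans nM.
rewrite omegaX; apply/eqP => /(congr1 (@complex.Re R)) /=.
rewrite expR0 mul1r.
pose x : R := n%:R * (pi / M%:R).
have -> : n%:R * (2 * pi / M%:R) = x *+ 2 by rewrite /x mulr2n; ring.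
rewrite cosD -!expr2 cos2sin2 => h.
have : sin x ^+ 2 = 0 by lra.
move=> /eqP; rewrite sqrf_eq0 => /eqP.
apply/eqP; rewrite gt_eqF// sin_gt0_pi// /x mulr_gt0 ?divr_gt0 ?ltr0n ?pi_gt0//=.
by rewrite mulrCA gtr_pMr ?pi_gt0// ltr_pdivrMr ?ltr0n// mul1r ltr_nat.
Qed.

Lemma omegaX_inj M k l : (k < M)%N -> (l < M)%N -> omega M ^+ k = omega M ^+ l -> k = l.
Proof.
wlog kl : k l / (k <= l)%N.
  move=> h kM lM e; have [kl|/ltnW lk] := leqP k l; first exact: h.
  by apply/esym/h.
move=> kM lM; rewrite -(subnKC kl) exprD => /esym/eqP.
rewrite -[eqbRHS]mulr1 (inj_eq (mulfI _)); last by rewrite cabs_neq0// cabs_omegaX oner_neq0.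
have [lk|] := ltnP k l; last by move=> lk _; rewrite (@anti_leq k l) ?kl ?lk// subnn addn0.
by rewrite (negPf (omegaX_neq1 _))// subn_gt0 lk (leq_ltn_trans (leq_subr _ _)).
Qed.

(** The grid of roots of unity is rotated by an arbitrary z because the grid estimates are
    integrated over z later. For k different from l the terms form a geometric progression whose
    ratio is an M-th root of unity other than 1. *)
Lemma grid_orth M z k l : cabs z = 1 -> (k < M)%N -> (l < M)%N ->
  \sum_(j < M) (z * omega M ^+ j) ^+ k * cconj ((z * omega M ^+ j) ^+ l) =
  if k == l then M%:R else 0.
Proof.
move=> z1 kM lM; have M0 : (0 < M)%N by exact: leq_trans kM.
pose zeta := omega M ^+ k * cconj (omega M ^+ l).
have E (j : 'I_M) : (z * omega M ^+ j) ^+ k * cconj ((z * omega M ^+ j) ^+ l) =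
    z ^+ k * cconj (z ^+ l) * zeta ^+ j.
  rewrite exprMn [(z * _) ^+ l]exprMn cconjM /zeta exprMn mulrACA.
  congr (_ * (_ * _)); first exact: exprAC.
  by rewrite -cconjX; congr cconj; exact: exprAC.
under eq_bigr do rewrite E.
rewrite -mulr_sumr; have [kl|kl] := eqVneq k l.
  have zeta1 : zeta = 1 by rewrite /zeta kl unit_mul_conj// cabs_omegaX.
  rewrite -kl unit_mul_conj ?cabsX ?z1 ?expr1n// mul1r.
  by under eq_bigr do rewrite zeta1 expr1n; rewrite sumr_const card_ord.
have zeta1 : zeta != 1.
  apply: contra kl => /eqP h; apply/eqP; apply: (@omegaX_inj M) => //.
  have := congr1 (fun w => w * omega M ^+ l) h; rewrite /zeta mul1r -mulrA.
  by rewrite [cconj _ * _]mulrC unit_mul_conj ?cabs_omegaX// mulr1.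
suff -> : \sum_(j < M) zeta ^+ j = 0 by rewrite mulr0.
apply: (mulfI (_ : zeta - 1 != 0)); first by rewrite subr_eq0.
rewrite mulr0 -subrX1 /zeta exprMn -!exprM mulnC exprM omegaXM// expr1n.
by rewrite -cconjX -exprM mulnC exprM omegaXM// expr1n cconj1 mulr1 subrr.
Qed.

(** The weight [G] is arbitrary so that scalar sums ([G] constant 1) and sums of vectors ([G] a Gram
    matrix) fall under one identity. As all exponents are below M, orthogonality on the grid is
    exact. *)
Lemma grid_parseval M m z (c : nat -> C) (G : nat -> nat -> C) : cabs z = 1 -> (m <= M)%N ->
  \sum_(j < M) \sum_(k < m) \sum_(l < m) (c k * (z * omega M ^+ j) ^+ k) *
     cconj (c l * (z * omega M ^+ j) ^+ l) * G k l =
  M%:R * \sum_(k < m) c k * cconj (c k) * G k k.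
Proof.
move=> z1 mM; rewrite exchange_big /= mulr_sumr; apply: eq_bigr => k _.
rewrite exchange_big /= (bigD1 k)//= [X in _ + X]big1 ?addr0.
  transitivity (c k * cconj (c k) * G k k * \sum_(j < M) (z * omega M ^+ j) ^+ k *
    cconj ((z * omega M ^+ j) ^+ k)).
    by rewrite mulr_sumr; apply: eq_bigr => j _; rewrite cconjM; ring.
  by rewrite grid_orth ?eqxx ?(leq_trans (ltn_ord _))// mulrC.
move=> l lk.
transitivity (c k * cconj (c l) * G k l * \sum_(j < M) (z * omega M ^+ j) ^+ k *
    cconj ((z * omega M ^+ j) ^+ l)).
  by rewrite mulr_sumr; apply: eq_bigr => j _; rewrite cconjM; ring.
rewrite grid_orth ?(leq_trans (ltn_ord _))// ifN ?mulr0//.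
by rewrite eq_sym.
Qed.

(** Roots of unity of large order are more zeros than the degree of P - Q allows. *)
Lemma poly_eq_circle (P Q : {poly C}) : (forall z, cabs z = 1 -> P.[z] = Q.[z]) -> P = Q.
Proof.
move=> PQ; apply/eqP; rewrite -subr_eq0; apply/eqP.
pose M := (size (P - Q)).+1.
apply: (@roots_geq_poly_eq0 _ _ [seq omega M ^+ (i : nat) | i <- iota 0 M]).
- apply/allP => w /mapP[i _ ->]; rewrite rootE !hornerE PQ ?subrr//.
  exact: cabs_omegaX.
- rewrite map_inj_in_uniq ?iota_uniq// => i j; rewrite !mem_iota !add0n /=.
  exact: omegaX_inj.
- by rewrite size_map size_iota.
Qed.

(** The conjugate-reciprocal polynomial for the formal degree 2n. A polynomial equals its own
    reciprocal when z^(-n) P(z) is real on the unit circle, and this reflects its roots in the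
    circle. *)
Definition revconj (n : nat) (P : {poly C}) : {poly C} :=
  \poly_(i < n.*2.+1) cconj P`_(n.*2 - i).

Lemma horner_revconj n (P : {poly C}) w : w != 0 -> (size P <= n.*2.+1)%N ->
  (revconj n P).[w] = w ^+ n.*2 * cconj P.[(cconj w)^-1].
Proof.
move=> w0 sP; rewrite (horner_poly) (horner_coef_wide _ sP) cconj_sum mulr_sumr.
rewrite [LHS](reindex_inj rev_ord_inj) /=; apply: eq_bigr => i _.
rewrite subSS subKn -1?ltnS// cconjM cconjX cconjV cconjK mulrCA; congr (_ * _).
by rewrite expfB_cond ?(negPf w0) ?add0n -1?ltnS// exprVn.
Qed.

Lemma revconj_id n (P : {poly C}) : (size P <= n.*2.+1)%N ->
  (forall z, cabs z = 1 -> exists2 r, 0 < r & P.[z] * cconj z ^+ n = rC r) ->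
  revconj n P = P.
Proof.
move=> sP Ppos; apply: poly_eq_circle => z z1.
have z0 : z != 0 by rewrite cabs_neq0// z1 oner_neq0.
have [r _ rE] := Ppos _ z1; rewrite horner_revconj// [cconj z]unit_conj// invrK.
have PE : P.[z] = rC r * z ^+ n.
  by rewrite -rE -mulrA -exprMn [cconj z * z]mulrC unit_mul_conj// expr1n mulr1.
rewrite PE cconjM cconj_rC cconjX unit_conj// -addnn exprD mulrCA; congr (_ * _).
by rewrite -mulrA -exprMn divff// expr1n mulr1.
Qed.

(* The roots of P come in pairs b, 1 / conj b; each step of the induction splits off one pair. *)
Lemma fejer_riesz d (P : {poly C}) : (size P <= d.*2.+1)%N ->
  (forall z, cabs z = 1 -> exists2 r, 0 < r & P.[z] * cconj z ^+ d = rC r) ->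
  exists (c : C) (s : seq C), [/\ c != 0, all (fun b => cabs b < 1) s &
    forall z, cabs z = 1 ->
      rC (cabs (c * \prod_(b <- s) (1 - b * z)) ^+ 2) = P.[z] * cconj z ^+ d].
Proof.
elim: d P => [|d IH] P sP Ppos.
  have [r r0 rE] := Ppos 1 cabs1.
  have Pc := size1_polyC sP; set c := P`_0 in Pc.
  move: rE; rewrite Pc hornerC expr0 mulr1 => cr.
  exists (rC (Num.sqrt r)), [::]; split => //.
    by rewrite cabs_neq0// cabs_rC normr_eq0 gt_eqF// sqrtr_gt0.
  move=> z z1; rewrite big_nil mulr1 hornerC mulr1 cr cabs_rC real_normK ?num_real//.
  by rewrite sqr_sqrtr// ltW.
have Prev := revconj_id sP Ppos.
(* A root at 0 lowers the degree at both ends: the coefficient of degree 2d + 2 is conjugate to the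
   constant one, so dividing by X leaves a polynomial of degree at most 2d. *)
have [P0|P0] := eqVneq P.[0] 0.
  have /factor_theorem[P1 PE] : root P 0 by rewrite rootE P0.
  rewrite subr0 in PE.
  have P1nz : P1 != 0.
    apply/eqP => P10; have [r r0] := Ppos 1 cabs1.
    by rewrite PE P10 mul0r horner0 mul0r => /(congr1 (@complex.Re R))/= e; rewrite -e ltxx in r0.
  have Pz z : cabs z = 1 -> P.[z] * cconj z ^+ d.+1 = P1.[z] * cconj z ^+ d.
    move=> z1; rewrite PE hornerM hornerX exprS -mulrA; congr (_ * _).
    by rewrite mulrA unit_mul_conj// mul1r.
  have lead0 : P`_(d.+1.*2) = 0.
    by rewrite -Prev coef_poly ltnSn subnn -horner_coef0 P0 cconj0.
  have sP1 : (size P1 <= d.*2.+1)%N.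
    move: sP; rewrite PE size_mulX// ltnS doubleS leq_eqVlt => /orP[/eqP sE|].
      move: lead0; rewrite PE coefMX doubleS /= => /eqP.
      have -> : d.*2.+1 = (size P1).-1 by rewrite sE.
      by rewrite -lead_coefE lead_coef_eq0 (negPf P1nz).
    by rewrite ltnS.
  have [z|c [s [c0 sl sE]]] := IH P1 sP1.
    by move=> z1; rewrite -Pz//; exact: Ppos.
  by exists c, s; split => // z z1; rewrite sE// Pz.
have lead0 : P`_(d.+1.*2) != 0.
  by rewrite -Prev coef_poly ltnSn subnn -horner_coef0 cconjc conjc_eq0.
have sPgt : (d.+1.*2 < size P)%N.
  by rewrite ltnNge; apply/negP => h; rewrite nth_default ?eqxx in lead0.
have /closed_rootP[al al_root] : size P != 1%N.
  by rewrite gtn_eqF// (leq_trans _ sPgt).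
(* Strict positivity keeps the roots off the circle, so one root of every reflected pair lies
   strictly inside. *)
have circ_nroot z : cabs z = 1 -> ~~ root P z.
  move=> z1; apply/negP; rewrite rootE => /eqP h; have [r r0] := Ppos _ z1.
  by rewrite h mul0r => /(congr1 (@complex.Re R))/= e; rewrite -e ltxx in r0.
have nroot0 w : root P w -> w != 0 by apply: contraTneq => ->; rewrite rootE.
have inv_root w : root P w -> root P (cconj w)^-1.
  move=> rw; have w0 := nroot0 _ rw.
  have cw0 : cconj w != 0 by rewrite cconjc conjc_eq0.
  rewrite rootE -Prev horner_revconj ?invr_eq0// cconjV invrK cconjK.
  by move: rw; rewrite rootE => /eqP ->; rewrite cconj0 mulr0.
have [be be_root be1] : exists2 be, root P be & cabs be < 1.
  have [|al1|al1] := ltgtP (cabs al) 1; first by exists al.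
    exists (cconj al)^-1; first exact: inv_root.
    by rewrite cabsV cabs_conj invf_lt1// (lt_trans _ al1).
  by have := circ_nroot _ al1; rewrite al_root.
have be0 := nroot0 _ be_root.
have cbe0 : cconj be != 0 by rewrite cconjc conjc_eq0.
pose ga := (cconj be)^-1.
have ga_root : root P ga by exact: inv_root.
have cbega : cabs ga > 1.
  rewrite cabsV cabs_conj invf_gt1// lt_neqAle cabs_ge0 andbT eq_sym.
  by apply: contra be0 => /eqP/cabs_eq0 ->.
have bega : ga != be by apply/eqP => e; move: cbega; rewrite e ltNge ltW.
have /factor_theorem[P1 PE] := be_root.
have : root P1 ga.
  move: ga_root; rewrite PE rootM root_XsubC (negPf bega) orbF; exact.
move=> /factor_theorem[P2 P1E].
(* Since X - ga = - ga (1 - conj be X), moving the constant into [P3] leaves the factor (1 - conj be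
   z)(z - be), which equals z |1 - conj be z|^2 on the circle. *)
pose P3 := (- ga) *: P2.
have P3E : P = P3 * (1 - cconj be *: 'X) * ('X - be%:P).
  rewrite PE P1E /P3 -scalerAl scalerAr; congr (_ * _ * _).
  by rewrite scalerBr scalerA mulNr mulVf// scaleN1r opprK scaleNr alg_polyC addrC.
have Pnz : P != 0 by apply: contraNneq P0 => ->; rewrite horner0.
have P2nz : P2 != 0.
  by apply: contraNneq Pnz => h; rewrite PE P1E h !mul0r.
have sP3 : (size P3 <= d.*2.+1)%N.
  rewrite /P3 size_scale ?oppr_eq0 ?invr_eq0//; move: sP.
  rewrite PE P1E !size_mul ?polyXsubC_eq0 ?mulf_neq0// ?size_XsubC ?polyXsubC_eq0//.
  by rewrite !addn2 /= doubleS !ltnS.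
have key z : cabs z = 1 ->
    P3.[z] * cconj z ^+ d * rC (cabs (1 - cconj be * z) ^+ 2) = P.[z] * cconj z ^+ d.+1.
  move=> z1; rewrite P3E !hornerM !hornerE -mul_cconj exprS.
  have -> : cconj (1 - cconj be * z) = cconj z * (z - be).
    rewrite cconjD cconjN cconjM cconjK cconj1 mulrBr [cconj z * z]mulrC unit_mul_conj//.
    by rewrite [be * _]mulrC.
  ring.
have nz1 z : cabs z = 1 -> 0 < cabs (1 - cconj be * z).
  move=> z1; rewrite lt_neqAle cabs_ge0 andbT eq_sym; apply/eqP => /cabs_eq0/eqP.
  rewrite subr_eq0 => /eqP/(congr1 cabs); rewrite cabs1 cabsM z1 mulr1 cabs_conj => e.
  by rewrite -e ltxx in be1.
have [z z1|c [s [c0 sl sE]]] := IH P3 sP3.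
  have [r r0 rE] := Ppos _ z1; have n0 := nz1 _ z1.
  exists (r / cabs (1 - cconj be * z) ^+ 2); first by rewrite divr_gt0// exprn_gt0.
  rewrite rCM -rE -key// -[RHS]mulrA -rCM divff ?rC1 ?mulr1//.
  by rewrite gt_eqF// exprn_gt0.
exists c, (cconj be :: s); split => //=; first by rewrite cabs_conj be1.
move=> z z1; rewrite big_cons mulrCA cabsM exprMn rCM sE// mulrC; exact: key.
Qed.

End unit_circle.

(** * The coefficient norm and approximate inverses of polynomials *)

Section poly_l1.
Context {R : realType}.
Local Notation C := (complex R).
Implicit Types (p q : {poly C}).

Definition l1 p : R := \sum_(i < size p) cabs p`_i.

Lemma l1_wide n p : (size p <= n)%N -> l1 p = \sum_(i < n) cabs p`_i.
Proof.
move=> sp; rewrite /l1 -(subnKC sp) big_split_ord /= [X in _ + X]big1 ?addr0//.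
by move=> i _; rewrite nth_default ?cabs0// leq_addr.
Qed.

Lemma l1_ge0 p : 0 <= l1 p.
Proof. by apply: sumr_ge0 => i _; exact: cabs_ge0. Qed.

Lemma l1_0 : l1 0 = 0. Proof. by rewrite /l1 size_poly0 big_ord0. Qed.

Lemma l1D p q : l1 (p + q) <= l1 p + l1 q.
Proof.
pose n := maxn (size p) (size q).
rewrite (@l1_wide n (p + q)) ?size_polyD// (@l1_wide n p) ?leq_maxl// (@l1_wide n q) ?leq_maxr//.
by rewrite -big_split; apply: ler_sum => i _; rewrite coefD cabsD.
Qed.

Lemma l1_sum (I : Type) (r : seq I) (F : I -> {poly C}) :
  l1 (\sum_(i <- r) F i) <= \sum_(i <- r) l1 (F i).
Proof.
elim: r => [|i r IH]; first by rewrite !big_nil l1_0.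
by rewrite !big_cons (le_trans (l1D _ _))// lerD2l.
Qed.

Lemma l1Z (c : C) p : l1 (c *: p) <= cabs c * l1 p.
Proof.
rewrite (@l1_wide (size p) (c *: p)) ?size_scale_leq// /l1 mulr_sumr.
by apply: ler_sum => i _; rewrite coefZ cabsM.
Qed.

Lemma l1MXn p n : l1 ('X^n * p) <= l1 p.
Proof.
rewrite (@l1_wide (n + size p) ('X^n * p)); last first.
  by rewrite (leq_trans (size_polyMleq _ _))// size_polyXn addSn.
rewrite big_split_ord /= [X in X + _]big1 ?add0r; last first.
  by move=> i _; rewrite coefXnM ltn_ord cabs0.
by apply: ler_sum => i _; rewrite coefXnM ltnNge leq_addr /= addKn.
Qed.

Lemma l1M p q : l1 (p * q) <= l1 p * l1 q.
Proof.
rewrite -{1}(coefK p) poly_def mulr_suml (le_trans (l1_sum _ _))//.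
rewrite {2}/l1 mulr_suml; apply: ler_sum => i _.
rewrite -scalerAl (le_trans (l1Z _ _))// ler_wpM2l ?cabs_ge0//.
exact: l1MXn.
Qed.

Lemma cabs_horner_l1 p (z : C) : cabs z = 1 -> cabs p.[z] <= l1 p.
Proof.
move=> z1; rewrite horner_coef (le_trans (cabs_sum _ _ _))//.
by apply: ler_sum => i _; rewrite cabsM cabsX z1 expr1n mulr1.
Qed.

(** Truncating the geometric series of 1 / (1 - b X) leaves the error - (b X)^N, whose coefficient
    norm is |b|^N. *)
Lemma approx_inverse_factor (b : C) (e : R) : cabs b < 1 -> 0 < e ->
  exists w E : {poly C}, (1 - b *: 'X) * w = 1 + E /\ l1 E <= e.
Proof.
move=> b1 e0.
have : cabs b ^+ n @[n --> \oo] --> 0.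
  by apply: cvg_expr; rewrite ger0_norm ?cabs_ge0.
move=> /cvgrPdist_le /(_ e e0) [N _ /(_ N (leqnn N))].
rewrite sub0r normrN ger0_norm ?exprn_ge0 ?cabs_ge0// => bN.
exists (\sum_(i < N) (b *: 'X) ^+ i), (- (b *: 'X) ^+ N); split.
  by rewrite -opprB mulNr -subrX1 opprB.
rewrite -scaleN1r (le_trans (l1Z _ _))// cabsN cabs1 mul1r exprZn.
rewrite (le_trans (l1Z _ _))// cabsX (le_trans _ bN)// ler_piMr ?exprn_ge0 ?cabs_ge0//.
rewrite /l1 size_polyXn big_ord_recr /= big1 ?add0r ?coefXn ?eqxx ?cabs1//.
by move=> i _; rewrite coefXn ltn_eqF// cabs0.
Qed.

(** Allows division by the Fejer-Riesz factor, which has no zero in the closed disc, without leaving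
    polynomials. *)
Lemma approx_inverse (s : seq C) (e : R) : all (fun b => cabs b < 1) s -> 0 < e ->
  exists w E : {poly C}, (\prod_(b <- s) (1 - b *: 'X)) * w = 1 + E /\ l1 E <= e.
Proof.
elim: s e => [|b s IH] e /= => [_ e0|/andP[b1 s1] e0].
  by exists 1, 0; rewrite big_nil mulr1 addr0 l1_0 ltW.
(* The error of the product is E1 + E2 + E1 E2, hence three shares of e / 3; the bound 1 tames the
   quadratic term. *)
pose e' := Num.min 1 (e / 3); have e'0 : 0 < e' by rewrite lt_min ltr01 divr_gt0.
have [w1 [E1 [h1 l1E1]]] := approx_inverse_factor b1 e'0.
have [w2 [E2 [h2 l1E2]]] := IH e' s1 e'0.
exists (w1 * w2), (E1 + E2 + E1 * E2); split.
  by rewrite big_cons mulrACA h1 h2; ring.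
have e'1 : e' <= 1 by rewrite ge_min lexx.
have e'3 : e' <= e / 3 by rewrite ge_min lexx orbT.
have h : l1 (E1 * E2) <= e'.
  rewrite (le_trans (l1M _ _))// (le_trans (ler_pM _ _ l1E1 l1E2)) ?l1_ge0//.
  by rewrite ler_piMr// ltW.
have h' := l1D (E1 + E2) (E1 * E2); have h'' := l1D E1 E2.
lra.
Qed.

End poly_l1.

(** * Hilbert spaces *)

Section hilbert.
Context {R : realType} {H : lmodType (complex R)}.
Variable ip : H -> H -> complex R.
Local Notation C := (complex R).
Local Notation Re := complex.Re.
Local Notation Im := complex.Im.
Local Notation nrm := (hnorm ip).

Section inner_product.
Hypothesis Hip : is_inner_product ip.

Lemma ip_lin a x y z : ip (a *: x + y) z = a * ip x z + ip y z.
Proof. by case: Hip. Qed.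
Lemma ip_sym x y : ip y x = cconj (ip x y).
Proof. by case: Hip => _ []. Qed.
Lemma ipDl x y z : ip (x + y) z = ip x z + ip y z.
Proof. by rewrite -{1}(scale1r x) ip_lin mul1r. Qed.
Lemma ip0l z : ip 0 z = 0.
Proof. by apply: (@addrI _ (ip 0 z)); rewrite addr0 -ipDl addr0. Qed.
Lemma ipZl a x z : ip (a *: x) z = a * ip x z.
Proof. by rewrite -{1}(addr0 (a *: x)) ip_lin ip0l addr0. Qed.
Lemma ipNl x z : ip (- x) z = - ip x z.
Proof. by rewrite -scaleN1r ipZl mulN1r. Qed.
Lemma ipBl x y z : ip (x - y) z = ip x z - ip y z.
Proof. by rewrite ipDl ipNl. Qed.
Lemma ipDr x y z : ip z (x + y) = ip z x + ip z y.
Proof. by rewrite ip_sym ipDl cconjD -!ip_sym. Qed.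
Lemma ip0r z : ip z 0 = 0.
Proof. by rewrite ip_sym ip0l cconj0. Qed.
Lemma ipZr a x z : ip z (a *: x) = cconj a * ip z x.
Proof. by rewrite ip_sym ipZl cconjM -ip_sym. Qed.
Lemma ipNr x z : ip z (- x) = - ip z x.
Proof. by rewrite ip_sym ipNl cconjN -ip_sym. Qed.
Lemma ipBr x y z : ip z (x - y) = ip z x - ip z y.
Proof. by rewrite ipDr ipNr. Qed.
Lemma ip_suml (I : Type) (r : seq I) (F : I -> H) z :
  ip (\sum_(i <- r) F i) z = \sum_(i <- r) ip (F i) z.
Proof. exact: (big_morph (ip^~ z) (fun x y => ipDl x y z) (ip0l z)). Qed.
Lemma ip_sumr (I : Type) (r : seq I) (F : I -> H) z :
  ip z (\sum_(i <- r) F i) = \sum_(i <- r) ip z (F i).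
Proof. exact: (big_morph (ip z) (fun x y => ipDr x y z) (ip0r z)). Qed.

Lemma Im_ip x : Im (ip x x) = 0.
Proof. by have := congr1 (@complex.Im R) (ip_sym x x) => /= h; lra. Qed.
Lemma sqr_nrm x : nrm x ^+ 2 = Re (ip x x).
Proof. by rewrite sqr_sqrtr//; case: Hip => _ [_ [/(_ x)]]. Qed.
Lemma ip_nrm x : ip x x = rC (nrm x ^+ 2).
Proof. by apply: complex_eqP; rewrite /= ?sqr_nrm ?Im_ip. Qed.
Lemma nrm_ge0 x : 0 <= nrm x. Proof. exact: sqrtr_ge0. Qed.
Lemma nrm_eq0 x : nrm x = 0 -> x = 0.
Proof. by move=> x0; case: Hip => _ [_ [_]]; apply; rewrite ip_nrm x0 expr0n. Qed.
Lemma nrm0 : nrm 0 = 0.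
Proof. by rewrite /hnorm ip0l sqrtr0. Qed.
Lemma nrmZ a x : nrm (a *: x) = cabs a * nrm x.
Proof.
apply/eqP; rewrite -(@eqrXn2 _ 2)// ?mulr_ge0 ?nrm_ge0 ?cabs_ge0//.
by rewrite exprMn sqr_nrm ipZl ipZr mulrA mul_cconj ip_nrm -rCM.
Qed.
Lemma nrmN x : nrm (- x) = nrm x.
Proof. by rewrite -scaleN1r nrmZ cabsN cabs1 mul1r. Qed.
Lemma nrm_distC x y : nrm (x - y) = nrm (y - x).
Proof. by rewrite -nrmN opprB. Qed.

Lemma cauchy_schwarz x y : cabs (ip x y) <= nrm x * nrm y.
Proof.
have [y0|y0] := eqVneq (nrm y) 0.
  by rewrite (nrm_eq0 y0) ip0r cabs0 nrm0 mulr0.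
have yp : 0 < nrm y by rewrite lt_neqAle eq_sym y0 nrm_ge0.
have yp2 : 0 < nrm y ^+ 2 by rewrite exprn_gt0.
pose a := ip x y * rC (nrm y ^+ 2)^-1.
have := sqr_ge0 (nrm (x - a *: y)).
rewrite sqr_nrm.
have E : a * rC (nrm y ^+ 2) = ip x y.
  by rewrite /a -mulrA -rCM mulVf ?gt_eqF// mulr1.
have -> : ip (x - a *: y) (x - a *: y) = rC (nrm x ^+ 2) - a * cconj (ip x y).
  rewrite ipBl !ipBr !ipZl !ipZr !ip_nrm (ip_sym x y) -E cconjM cconj_rC; ring.
rewrite /a mulrAC mul_cconj -rCM ReB /= subr_ge0 ler_pdivrMr// => h.
by rewrite -(@ler_pXn2r _ 2)// ?nnegrE ?mulr_ge0 ?nrm_ge0 ?cabs_ge0// exprMn.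
Qed.

Lemma nrmD x y : nrm (x + y) <= nrm x + nrm y.
Proof.
rewrite -(@ler_pXn2r _ 2)// ?nnegrE ?addr_ge0 ?nrm_ge0//.
rewrite sqr_nrm ipDl !ipDr !ReD !ip_nrm /= sqrrD.
have h1 : Re (ip x y) <= nrm x * nrm y.
  exact: le_trans (Re_le_cabs _) (cauchy_schwarz _ _).
have h2 : Re (ip y x) = Re (ip x y) by rewrite ip_sym.
by rewrite h2; lra.
Qed.
Lemma nrmB x y : nrm (x - y) <= nrm x + nrm y.
Proof. by rewrite -(nrmN y) nrmD. Qed.

Lemma parallelogram x y : nrm (x - y) ^+ 2 = 2 * nrm x ^+ 2 + 2 * nrm y ^+ 2 - nrm (x + y) ^+ 2.
Proof. by rewrite !sqr_nrm !(ipDl, ipDr, ipNl, ipNr) !(ReD, ReN); ring. Qed.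

Lemma ip_eq0 x : (forall y, ip x y = 0) -> x = 0.
Proof. by move=> h; case: Hip => _ [_ [_]]; apply. Qed.

Lemma ip_inj x y : (forall z, ip x z = ip y z) -> x = y.
Proof. by move=> h; apply/eqP; rewrite -subr_eq0; apply/eqP/ip_eq0 => z; rewrite ipBl h subrr. Qed.

Lemma nrm_le_ip x (K : R) : 0 <= K -> (forall y, cabs (ip x y) <= K * nrm y) -> nrm x <= K.
Proof.
move=> K0 h; have [->|x0] := eqVneq (nrm x) 0; first by [].
have xp : 0 < nrm x by rewrite lt_neqAle eq_sym x0 nrm_ge0.
have := h x; rewrite ip_nrm cabs_rC ger0_norm ?sqr_ge0// expr2.
by rewrite ler_pM2r.
Qed.

End inner_product.

Hypothesis HH : is_hilbert ip.
Let Hip : is_inner_product ip. Proof. by case: HH. Qed.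

(** The hyperplane phi = 1 has a point l of least norm by completeness; l is orthogonal to the
    kernel of phi, so l / |l|^2 represents phi. *)
Lemma riesz (phi : H -> C) (K : R) : (forall a x y, phi (a *: x + y) = a * phi x + phi y) ->
  (forall x, cabs (phi x) <= K * nrm x) -> exists y, forall x, phi x = ip x y.
Proof.
move=> lphi bphi.
have phiD x y : phi (x + y) = phi x + phi y by rewrite -{1}(scale1r x) lphi mul1r.
have phi0 : phi 0 = 0 by apply: (@addrI _ (phi 0)); rewrite addr0 -phiD addr0.
have phiZ a x : phi (a *: x) = a * phi x by rewrite -{1}(addr0 (a *: x)) lphi phi0 addr0.
have phiB x y : phi (x - y) = phi x - phi y by rewrite phiD -scaleN1r phiZ mulN1r.
have [[x0 hx0]|h0] := pselect (exists x, phi x != 0); last first.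
  exists 0 => x; rewrite (ip0r Hip); apply/eqP; apply: contrapT => h.
  by apply: h0; exists x; exact/negP.
pose A := [set nrm x ^+ 2 | x in [set x | phi x = 1]].
have Ane : A !=set0.
  by exists (nrm ((phi x0)^-1 *: x0) ^+ 2); exists ((phi x0)^-1 *: x0) => //=; rewrite phiZ mulVf.
have Ainf : has_inf A.
  by split => //; exists 0 => _ [x _ <-]; exact: sqr_ge0.
pose d := inf A.
have dle x : phi x = 1 -> d <= nrm x ^+ 2.
  by move=> hx; apply: ge_inf; [case: Ainf|exists x].
have /choice[u hu] n : exists x, phi x = 1 /\ nrm x ^+ 2 < d + n.+1%:R^-1.
  have [_ [x hx <-] lt] := @inf_adherent _ A n.+1%:R^-1 ltac:(by rewrite invr_gt0) Ainf.
  by exists x.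
(* The midpoint of x and y stays in the hyperplane, so the parallelogram identity makes minimizing
   sequences Cauchy. *)
have close x y : phi x = 1 -> phi y = 1 ->
    nrm (x - y) ^+ 2 <= 2 * (nrm x ^+ 2 - d) + 2 * (nrm y ^+ 2 - d).
  move=> hx hy; rewrite (parallelogram Hip).
  have := dle (rC 2^-1 *: (x + y)).
  rewrite phiZ phiD hx hy -rC1 -rCD -rCM mulVf ?rC1; last by rewrite pnatr_eq0.
  move=> /(_ erefl); rewrite (nrmZ Hip) cabs_rC ger0_norm ?invr_ge0// exprMn => h.
  lra.
have [l hl] : exists l, nrm (u n - l) @[n --> \oo] --> 0.
  case: HH => _; apply => e e0.
  have /cvgrPdist_lt/(_ (e ^+ 2 / 4)) : (n.+1%:R^-1 : R) @[n --> \oo] --> 0 by exact: cvg_harmonic.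
  move=> /(_ ltac:(by rewrite divr_gt0 ?exprn_gt0)) [N _ hN]; exists N => m n Nm Nn.
  rewrite -(@ltr_pXn2r _ 2)// ?nnegrE ?nrm_ge0 ?(ltW e0)//.
  have [um1 um2] := hu m; have [un1 un2] := hu n.
  rewrite (le_lt_trans (close _ _ um1 un1))//.
  have := hN _ Nm; have := hN _ Nn; rewrite /= !sub0r !normrN !ger0_norm ?invr_ge0// => a1 a2.
  by move: um2 un2 a1 a2; move: (m.+1%:R^-1) (n.+1%:R^-1) => e1 e2 *; lra.
have phil : phi l = 1.
  apply/eqP; rewrite -subr_eq0; apply/eqP/cabs_eq0/eqP; rewrite eq_le cabs_ge0 andbT.
  apply/ler_addgt0Pl => e e0; rewrite addr0.
  have K1 : 0 < `|K| + 1 by rewrite ltr_wpDl.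
  move/cvgrPdist_lt : hl => /(_ (e / (`|K| + 1))) /(_ ltac:(by rewrite divr_gt0)) [N _ /(_ N (leqnn N))].
  rewrite /= sub0r normrN ger0_norm ?nrm_ge0// => hN.
  have [uN1 _] := hu N; rewrite -uN1 -phiB (le_trans (bphi _))//.
  rewrite (nrm_distC Hip) (le_trans (_ : _ <= (`|K| + 1) * nrm (u N - l)))//.
    by rewrite ler_wpM2r ?nrm_ge0// (le_trans (ler_norm _))// lerDl.
  by rewrite mulrC -ler_pdivlMr// ltW.
have dl : nrm l ^+ 2 <= d.
  have key n : nrm l <= Num.sqrt (d + n.+1%:R^-1) + nrm (u n - l).
    have := nrmB Hip (u n) (u n - l); rewrite opprB addrCA subrr addr0 => h.
    rewrite (le_trans h)// lerD2r -(@ler_pXn2r _ 2)// ?nnegrE ?nrm_ge0 ?sqrtr_ge0//.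
    have [h1 h2] := hu n; rewrite [Num.sqrt (d + _) ^+ 2]sqr_sqrtr ?(ltW h2)//.
    by rewrite (le_trans _ (ltW h2))// sqr_ge0.
  have d0 : 0 <= d by apply: lb_le_inf => // _ [x _ <-]; exact: sqr_ge0.
  rewrite -(@sqr_sqrtr _ d)// ler_pXn2r ?nnegrE ?nrm_ge0 ?sqrtr_ge0//.
  have : Num.sqrt (d + n.+1%:R^-1) + nrm (u n - l) @[n --> \oo] --> Num.sqrt d.
    rewrite -[X in _ --> X]addr0; apply: cvgD => //.
    apply: continuous_cvg; first exact: sqrt_continuous.
    by rewrite -[X in _ --> X]addr0; apply: cvgD; [exact: cvg_cst|exact: cvg_harmonic].
  by move=> cv; exact: (cvgn_ge cv key).
(* Otherwise removing from l its component along k would stay in the hyperplane and shorten l. *)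
have orth k : phi k = 0 -> ip k l = 0.
  move=> k0; apply/eqP; apply: contrapT => /negP h.
  have kn0 : nrm k != 0.
    by apply: contra h => /eqP/(nrm_eq0 Hip) ->; rewrite (ip0l Hip).
  have kp : 0 < nrm k ^+ 2 by rewrite exprn_gt0// lt_neqAle eq_sym kn0 nrm_ge0.
  pose t := ip l k * rC (nrm k ^+ 2)^-1.
  have : d <= nrm (l - t *: k) ^+ 2 by apply: dle; rewrite phiB phiZ k0 mulr0 subr0.
  rewrite (sqr_nrm Hip).
  have E : t * rC (nrm k ^+ 2) = ip l k by rewrite /t -mulrA -rCM mulVf ?gt_eqF// mulr1.
  have -> : ip (l - t *: k) (l - t *: k) = rC (nrm l ^+ 2) - t * cconj (ip l k).
    rewrite (ipBl Hip) !(ipBr Hip) !(ipZl Hip) !(ipZr Hip) !(ip_nrm Hip) (ip_sym Hip l k).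
    rewrite -E cconjM cconj_rC; ring.
  rewrite /t mulrAC mul_cconj -rCM ReB /= => h'.
  have : 0 < cabs (ip l k) ^+ 2 / nrm k ^+ 2.
    rewrite divr_gt0// exprn_gt0// lt_neqAle cabs_ge0 andbT eq_sym.
    apply: contra h => /eqP/cabs_eq0 h0; rewrite (ip_sym Hip) h0 cconj0//.
  by move=> h''; have := le_trans dl h'; rewrite lerBrDr gerDl leNgt h''.
have lp : 0 < nrm l ^+ 2.
  rewrite exprn_gt0// lt_neqAle nrm_ge0 andbT eq_sym; apply/eqP => /(nrm_eq0 Hip) l0.
  by move: phil; rewrite l0 phi0 => /esym/eqP; rewrite oner_eq0.
exists (rC (nrm l ^+ 2)^-1 *: l) => x; rewrite (ipZr Hip) cconj_rC.
have /orth : phi (x - phi x *: l) = 0 by rewrite phiB phiZ phil mulr1 subrr.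
rewrite (ipBl Hip) (ipZl Hip) (ip_nrm Hip) => /eqP; rewrite subr_eq0 => /eqP ->.
by rewrite mulrCA -rCM mulVf ?gt_eqF// mulr1.
Qed.

(** The operator is assembled from Riesz vectors, one for each x. Riesz is applied to the conjugate
    of the form because a(x, y) is antilinear in y. All weak integrals of semigroups become
    operators in this way. *)
Lemma bounded_op_of_form (a : H -> H -> C) (K : R) : 0 <= K ->
  (forall c x y z, a (c *: x + y) z = c * a x z + a y z) ->
  (forall c x y z, a z (c *: x + y) = cconj c * a z x + a z y) ->
  (forall x y, cabs (a x y) <= K * nrm x * nrm y) ->
  exists S : H -> H, [/\ is_bounded_op ip S, (forall x y, ip (S x) y = a x y) &
    forall x, nrm (S x) <= K * nrm x].
Proof.
move=> K0 al ar ab.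
have /choice[S hS] x : exists w, forall y, ip w y = a x y.
  have [|y|w hw] := @riesz (fun y => cconj (a x y)) (K * nrm x).
  - by move=> c y z; rewrite ar cconjD cconjM cconjK.
  - by rewrite cabs_conj.
  by exists w => y; rewrite (ip_sym Hip) -hw cconjK.
have bS x : nrm (S x) <= K * nrm x.
  by apply: (nrm_le_ip Hip) => [|y]; rewrite ?mulr_ge0 ?nrm_ge0// hS.
exists S; split => //; split; last by exists K.
by move=> c x y; apply: (ip_inj Hip) => z; rewrite (ip_lin Hip) !hS al.
Qed.

Lemma adjoint_exists (S : H -> H) (K : R) : 0 <= K ->
  (forall a x y, S (a *: x + y) = a *: S x + S y) -> (forall x, nrm (S x) <= K * nrm x) ->
  exists S' : H -> H, (forall x y, ip (S x) y = ip x (S' y)) /\ forall y, nrm (S' y) <= K * nrm y.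
Proof.
move=> K0 lS bS.
have [|c x y z|x y|S' [_ hS' bS']] := @bounded_op_of_form (fun y x => ip y (S x)) K K0.
- by move=> c x y z; rewrite (ip_lin Hip).
- by rewrite lS (ipDr Hip) (ipZr Hip).
- rewrite (le_trans (cauchy_schwarz Hip _ _))// mulrC mulrAC ler_wpM2r ?nrm_ge0//.
exists S'; split => // x y.
by rewrite (ip_sym Hip) -hS' -(ip_sym Hip).
Qed.

End hilbert.

(** * Hankel forms and factorization *)

Section hankel_grid.
Context {R : realType} {H : lmodType (complex R)}.
Variable ip : H -> H -> complex R.
Hypothesis Hip : is_inner_product ip.
Local Notation C := (complex R).
Local Notation nrm := (hnorm ip).
Variables (X Y : nat -> H) (psi : nat -> C) (A B : R).
Hypothesis A0 : 0 < A.
Hypothesis B0 : 0 < B.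
Hypothesis psiE : forall k l, psi (k + l)%N = ip (X k) (Y l).
Hypothesis XA : forall k, nrm (X k) <= A.
Hypothesis YB : forall k, nrm (Y k) <= B.

(** The Hadamard product of the coefficients with [psi]. The matrix [psi] (k + l) is a Hankel matrix
    which by [psiE] factors through H. *)
Definition twist (p : {poly C}) : {poly C} := \poly_(n < size p) (p`_n * psi n).

Lemma coef_twist p n : (twist p)`_n = p`_n * psi n.
Proof. by rewrite coef_poly; case: ltnP => // h; rewrite nth_default// mul0r. Qed.

Lemma twistD p q : twist (p + q) = twist p + twist q.
Proof. by apply/polyP => i; rewrite coefD !coef_twist coefD mulrDl. Qed.

Lemma twist0 : twist 0 = 0.
Proof. by apply/polyP => i; rewrite coef_twist !coef0 mul0r. Qed.

Lemma twist_sum (I : Type) (r : seq I) (F : I -> {poly C}) :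
  twist (\sum_(i <- r) F i) = \sum_(i <- r) twist (F i).
Proof. exact: (big_morph twist twistD twist0). Qed.

(** Each pair (k, l) contributes [psi] (k + l) = <X_k, Y_l>, so a factorization of the polynomial
    separates the two families of vectors. The conjugate on the coefficients of q undoes the
    antilinearity of the second slot. *)
Lemma twistM p q (z : C) : (twist (p * q)).[z] =
  ip (\sum_(k < size p) (p`_k * z ^+ k) *: X k)
     (\sum_(l < size q) (cconj (q`_l * z ^+ l)) *: Y l).
Proof.
have -> : p * q = \sum_(k < size p) \sum_(l < size q) (p`_k * q`_l) *: 'X^(k + l).
  rewrite -{1}(coefK p) -{1}(coefK q) !poly_def mulr_suml; apply: eq_bigr => k _.
  rewrite mulr_sumr; apply: eq_bigr => l _.
  by rewrite -scalerAl -scalerAr scalerA exprD.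
rewrite twist_sum horner_sum (ip_suml Hip); apply: eq_bigr => k _.
rewrite twist_sum horner_sum (ip_sumr Hip); apply: eq_bigr => l _.
have -> : twist ((p`_k * q`_l) *: 'X^(k + l)) = (p`_k * q`_l * psi (k + l)%N) *: 'X^(k + l).
  apply/polyP => i; rewrite coef_twist !coefZ coefXn; case: eqP => [->|_]; first by rewrite !mulr1.
  by rewrite !mulr0 mul0r.
rewrite hornerZ hornerXn (ipZl Hip) (ipZr Hip) cconjK psiE exprD; ring.
Qed.

(** A crude bound in terms of the coefficient norm, for error terms and integrability. *)
Lemma cabs_twist_le p (z : C) : cabs z = 1 -> cabs (twist p).[z] <= A * B * l1 p.
Proof.
move=> z1; rewrite (le_trans (cabs_horner_l1 _ z1))//.
rewrite (@l1_wide _ (size p)) ?size_poly// /l1 mulr_sumr; apply: ler_sum => n _.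
rewrite coef_twist cabsM mulrC ler_wpM2r ?cabs_ge0//.
rewrite -[X in psi X](addn0 n) psiE (le_trans (cauchy_schwarz Hip _ _))//.
by rewrite ler_pM ?nrm_ge0.
Qed.

Lemma vector_parseval (Z : nat -> H) (K : R) (M m : nat) (z : C) (c : nat -> C) :
  (forall k, nrm (Z k) <= K) -> cabs z = 1 -> (m <= M)%N ->
  \sum_(j < M) nrm (\sum_(k < m) (c k * (z * omega M ^+ j) ^+ k) *: Z k) ^+ 2 <=
  M%:R * (K ^+ 2 * \sum_(k < m) cabs (c k) ^+ 2).
Proof.
move=> ZK z1 mM.
have E : rC (\sum_(j < M) nrm (\sum_(k < m) (c k * (z * omega M ^+ j) ^+ k) *: Z k) ^+ 2) =
    rC (M%:R * \sum_(k < m) cabs (c k) ^+ 2 * nrm (Z k) ^+ 2).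
  rewrite rC_sum rCM rC_nat rC_sum.
  under [in RHS]eq_bigr do rewrite rCM -mul_cconj -(ip_nrm Hip).
  rewrite -(@grid_parseval R M m z c (fun k l => ip (Z k) (Z l)))//.
  apply: eq_bigr => j _; rewrite -(ip_nrm Hip) (ip_suml Hip); apply: eq_bigr => k _.
  rewrite (ip_sumr Hip); apply: eq_bigr => l _.
  by rewrite (ipZl Hip) (ipZr Hip) mulrA.
have := congr1 (@complex.Re R) E => /= ->.
rewrite ler_wpM2l// mulr_sumr; apply: ler_sum => k _; rewrite mulrC ler_wpM2r ?sqr_ge0//.
by rewrite ler_pXn2r ?nnegrE ?nrm_ge0// (le_trans _ (ZK k)) ?nrm_ge0.
Qed.

Lemma scalar_parseval (M : nat) (z : C) (p : {poly C}) : cabs z = 1 -> (size p <= M)%N ->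
  \sum_(j < M) cabs (p.[z * omega M ^+ j]) ^+ 2 = M%:R * \sum_(k < size p) cabs p`_k ^+ 2.
Proof.
move=> z1 mM.
have E : rC (\sum_(j < M) cabs (p.[z * omega M ^+ j]) ^+ 2) =
    rC (M%:R * \sum_(k < size p) cabs p`_k ^+ 2).
  rewrite rC_sum rCM rC_nat rC_sum.
  under [in RHS]eq_bigr do rewrite -mul_cconj -[_ * cconj _]mulr1.
  rewrite -(@grid_parseval R M (size p) z (fun k => p`_k) (fun k l => 1))//.
  apply: eq_bigr => j _; rewrite -mul_cconj horner_coef mulr_suml; apply: eq_bigr => k _.
  by rewrite cconj_sum mulr_sumr; apply: eq_bigr => l _; rewrite mulr1.
by have := congr1 (@complex.Re R) E.
Qed.

(** The weights balance the two sides: the square means will be about A^2 L and B^2 L, so both terms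
    become A B L. *)
Lemma ip_AMGM (x y : H) : cabs (ip x y) <= 2^-1 * (B / A * nrm x ^+ 2 + A / B * nrm y ^+ 2).
Proof.
rewrite (le_trans (cauchy_schwarz Hip _ _))//.
have AB0 : 0 < A * B by rewrite mulr_gt0.
have E : 2^-1 * (B / A * nrm x ^+ 2 + A / B * nrm y ^+ 2) - nrm x * nrm y =
  (B * nrm x - A * nrm y) ^+ 2 / (2 * (A * B)).
  by field; rewrite !gt_eqF.
by rewrite -subr_ge0 E divr_ge0 ?sqr_ge0// mulr_ge0// ltW.
Qed.

Variables (Hp P : {poly C}) (d : nat) (pp : C -> R) (L : R).
Hypothesis sP : (size P <= d.*2.+1)%N.
Hypothesis PE : forall z, cabs z = 1 -> P.[z] * cconj z ^+ d = rC (pp z).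
Hypothesis HpP : forall z, cabs z = 1 -> cabs Hp.[z] <= pp z.
Hypothesis meanP : forall M z, (d < M)%N -> cabs z = 1 ->
  \sum_(j < M) pp (z * omega M ^+ j) <= M%:R * L.

Let cabs_grid (z : C) M j : cabs z = 1 -> cabs (z * omega M ^+ j) = 1.
Proof. by move=> z1; rewrite cabsM cabs_omegaX z1 mulr1. Qed.

(* If pp + e = |q|^2 and v approximates Hp / q, then q v approximates Hp, and [twistM] writes its
   twist as an inner product. *)
Lemma hankel_grid_bound_aux (e : R) : 0 < e -> e <= 1 ->
  exists2 M, (0 < M)%N & forall z, cabs z = 1 ->
  \sum_(j < M) cabs (twist Hp).[z * omega M ^+ j] <=
    M%:R * (A * B * (2^-1 * (L + e) + 2^-1 * ((1 + e) ^+ 2 * L) + e * l1 Hp)).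
Proof.
move=> e0 e1.
(* On the circle the added monomial turns [pp] into pp + e, which has the strict positivity that
   Fejer-Riesz asks for. *)
pose P' := P + rC e *: 'X^d.
have sP' : (size P' <= d.*2.+1)%N.
  rewrite (leq_trans (size_polyD _ _))// geq_max sP (leq_trans (size_scale_leq _ _))//.
  by rewrite size_polyXn ltnS -addnn leq_addr.
have pp0 z : cabs z = 1 -> 0 <= pp z by move=> /HpP; apply: le_trans; exact: cabs_ge0.
have P'E z : cabs z = 1 -> P'.[z] * cconj z ^+ d = rC (pp z + e).
  move=> z1; rewrite !hornerE mulrDl PE// rCD; congr (_ + _).
  by rewrite -mulrA -exprMn unit_mul_conj// expr1n mulr1.
have [z z1|c [s [c0 s1 qE]]] := fejer_riesz sP'.
  by exists (pp z + e); rewrite ?P'E// ltr_wpDl// pp0.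
have [w [E [wE El1]]] := approx_inverse s1 e0.
pose q := c *: \prod_(b <- s) (1 - b *: 'X).
pose v := c^-1 *: (w * Hp).
have qv : q * v = Hp + Hp * E.
  rewrite /q /v -scalerAl -scalerAr scalerA divff// scale1r mulrA wE; ring.
have qz z : cabs z = 1 -> cabs q.[z] ^+ 2 = pp z + e.
  move=> z1; have := qE _ z1; rewrite P'E// => /(congr1 (@complex.Re R))/= <-.
  rewrite hornerZ horner_prod; congr (cabs (_ * _) ^+ 2).
  by apply: eq_bigr => b _; rewrite !hornerE.
(* From |q v| <= (1 + e) pp and |q|^2 = pp + e. Hence q and v both have square mean close to L,
   although only their product was prescribed. *)
have vz z : cabs z = 1 -> cabs v.[z] ^+ 2 <= (1 + e) ^+ 2 * pp z.
  move=> z1; have pe0 : 0 < pp z + e by rewrite ltr_wpDl// pp0.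
  have h : cabs q.[z] * cabs v.[z] <= pp z * (1 + e).
    rewrite -cabsM -hornerM qv -[X in X + _]mulr1 -mulrDr hornerM cabsM.
    rewrite ler_pM ?cabs_ge0 ?HpP// hornerD (le_trans (cabsD _ _))// hornerC cabs1 lerD2l.
    by rewrite (le_trans (cabs_horner_l1 _ z1)).
  rewrite -(ler_pM2l pe0) -{1}(qz _ z1) -exprMn.
  apply: (@le_trans _ _ ((pp z * (1 + e)) ^+ 2)).
    by rewrite ler_pXn2r ?nnegrE ?mulr_ge0 ?cabs_ge0 ?pp0// addr_ge0// ltW.
  have -> : (pp z + e) * ((1 + e) ^+ 2 * pp z) = (pp z * (1 + e)) ^+ 2 + e * ((1 + e) ^+ 2 * pp z).
    by ring.
  by rewrite lerDl mulr_ge0 ?(ltW e0)// mulr_ge0 ?sqr_ge0 ?pp0.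
(* The grid is finer than all degrees involved, so that Parseval on it is exact for q and v and
   [meanP] applies. *)
pose M := (maxn d (maxn (size q) (size v))).+1.
have M0 : (0 < M)%N by [].
have dM : (d < M)%N by rewrite ltnS leq_max leqnn.
have qM : (size q <= M)%N by rewrite ltnW// ltnS !leq_max leqnn orbT.
have vM : (size v <= M)%N by rewrite ltnW// ltnS !leq_max leqnn !orbT.
exists M => // z z1.
have tw j : cabs (twist Hp).[z * omega M ^+ j] <= cabs (twist (q * v)).[z * omega M ^+ j]
     + A * B * (e * l1 Hp).
  have -> : twist Hp = twist (q * v) + twist (- (Hp * E)) by rewrite -twistD qv addrK.
  rewrite hornerD (le_trans (cabsD _ _))// lerD2l (le_trans (cabs_twist_le _ (cabs_grid _ _ z1)))//.
  rewrite ler_wpM2l ?mulr_ge0 ?(ltW A0) ?(ltW B0)// -scaleN1r (le_trans (l1Z _ _))// cabsN cabs1 mul1r.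
  by rewrite (le_trans (l1M _ _))// mulrC ler_wpM2r ?l1_ge0.
apply: (le_trans (ler_sum _ (fun (j : 'I_M) _ => tw j))).
rewrite big_split /= sumr_const card_ord -[X in _ + X]mulr_natl.
pose U j := \sum_(k < size q) (q`_k * (z * omega M ^+ j) ^+ k) *: X k.
pose V j := \sum_(l < size v) (cconj (v`_l * (z * omega M ^+ j) ^+ l)) *: Y l.
have Uj : \sum_(j < M) nrm (U j) ^+ 2 <= M%:R * (A ^+ 2 * (L + e)).
  rewrite (le_trans (vector_parseval (fun k => q`_k) XA z1 qM))//.
  rewrite mulrCA [leRHS]mulrCA ler_wpM2l ?sqr_ge0// -(scalar_parseval z1 qM).
  under eq_bigr do rewrite qz ?cabs_grid//.
  by rewrite big_split /= sumr_const card_ord -[X in _ + X]mulr_natl mulrDr lerD2r meanP.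
have Vj : \sum_(j < M) nrm (V j) ^+ 2 <= M%:R * (B ^+ 2 * ((1 + e) ^+ 2 * L)).
  have -> : \sum_(j < M) nrm (V j) ^+ 2 = M%:R * \sum_(l < size v) cabs v`_l ^+ 2 * nrm (Y l) ^+ 2.
    suff EE : rC (\sum_(j < M) nrm (V j) ^+ 2) =
       rC (M%:R * \sum_(l < size v) cabs v`_l ^+ 2 * nrm (Y l) ^+ 2).
      by have := congr1 (@complex.Re R) EE.
    rewrite rC_sum rCM rC_nat rC_sum.
    under [in RHS]eq_bigr do rewrite rCM -mul_cconj -(ip_nrm Hip).
    rewrite -(@grid_parseval R M (size v) z (fun k => v`_k) (fun k l => ip (Y l) (Y k)))//.
    apply: eq_bigr => j _; rewrite -(ip_nrm Hip) (ip_sumr Hip); apply: eq_bigr => k _.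
    rewrite (ip_suml Hip); apply: eq_bigr => l _.
    by rewrite (ipZl Hip) (ipZr Hip) cconjK; ring.
  apply: (@le_trans _ _ (M%:R * (B ^+ 2 * \sum_(l < size v) cabs v`_l ^+ 2))).
    rewrite ler_wpM2l// mulr_sumr; apply: ler_sum => k _; rewrite mulrC ler_wpM2r ?sqr_ge0//.
    by rewrite ler_pXn2r ?nnegrE ?nrm_ge0// ltW.
  rewrite mulrCA [leRHS]mulrCA ler_wpM2l ?sqr_ge0// -(scalar_parseval z1 vM).
  apply: (@le_trans _ _ (\sum_(j < M) (1 + e) ^+ 2 * pp (z * omega M ^+ j))).
    by apply: ler_sum => j _; rewrite vz// cabs_grid.
  by rewrite -mulr_sumr mulrCA ler_wpM2l ?sqr_ge0// meanP.
rewrite [A * B * (_ + _)]mulrDr [M%:R * (_ + _)]mulrDr lerD2r.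
apply: (@le_trans _ _ (\sum_(j < M) 2^-1 * (B / A * nrm (U j) ^+ 2 + A / B * nrm (V j) ^+ 2))).
  by apply: ler_sum => j _; rewrite twistM ip_AMGM.
rewrite -mulr_sumr big_split /= -!mulr_sumr.
have eqle (a b : R) : a = b -> a <= b by move->.
have h1 : B / A * \sum_(j < M) nrm (U j) ^+ 2 <= M%:R * (A * B * (L + e)).
  apply: le_trans (ler_wpM2l _ Uj) _; first by rewrite divr_ge0 ?ltW.
  by apply: eqle; field; rewrite gt_eqF.
have h2 : A / B * \sum_(j < M) nrm (V j) ^+ 2 <= M%:R * (A * B * ((1 + e) ^+ 2 * L)).
  apply: le_trans (ler_wpM2l _ Vj) _; first by rewrite divr_ge0 ?ltW.
  by apply: eqle; field; rewrite gt_eqF.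
rewrite (le_trans (ler_wpM2l _ (lerD h1 h2))) ?invr_ge0//.
by apply: eqle; ring.
Qed.

Hypothesis L0 : 0 <= L.

Lemma hankel_grid_bound (e : R) : 0 < e ->
  exists2 M, (0 < M)%N & forall z, cabs z = 1 ->
  \sum_(j < M) cabs (twist Hp).[z * omega M ^+ j] <= M%:R * (A * B * L + e).
Proof.
(* For t <= 1 the previous bound with t in place of e exceeds A B L by at most t K. *)
move=> e0; pose K := A * B * (2 + 2 * L + l1 Hp).
have AB0 : 0 < A * B by rewrite mulr_gt0.
have K0 : 0 < K by rewrite mulr_gt0// -addrA ltr_wpDr// addr_ge0 ?l1_ge0// mulr_ge0.
pose t := Num.min 1 (e / K).
have t0 : 0 < t by rewrite lt_min ltr01 divr_gt0.
have t1 : t <= 1 by rewrite ge_min lexx.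
have te : t * K <= e by rewrite -ler_pdivlMr// ge_min lexx orbT.
have [M M0 hM] := hankel_grid_bound_aux t0 t1.
exists M => // z /hM h; apply: (le_trans h); rewrite ler_wpM2l//.
apply: le_trans (_ : _ <= A * B * L + t * K) _; last by rewrite lerD2l.
have tt : t ^+ 2 <= t by rewrite expr2 ler_piMr// ltW.
have -> : A * B * L + t * K = A * B * (L + t * (2 + 2 * L + l1 Hp)) by rewrite /K; ring.
rewrite ler_wpM2l ?(ltW AB0)//.
have lp := l1_ge0 Hp; have LL : t ^+ 2 * L <= t * L by rewrite ler_wpM2r.
rewrite -subr_ge0.
have -> : L + t * (2 + 2 * L + l1 Hp) - (2^-1 * (L + t) + 2^-1 * ((1 + t) ^+ 2 * L) + t * l1 Hp) =
  2^-1 * (3 * t + t * L + (t * L - t ^+ 2 * L)) by field.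
have t00 := ltW t0; have tL : 0 <= t * L by exact: mulr_ge0.
by rewrite mulr_ge0 ?invr_ge0// addr_ge0 ?subr_ge0// addr_ge0// mulr_ge0.
Qed.

End hankel_grid.

(** * Fourier transforms and Poisson kernels *)

Section kernels.
Context {R : realType}.
Local Notation C := (complex R).
Local Notation Re := complex.Re.
Local Notation Im := complex.Im.
Local Notation mu := (@lebesgue_measure R).

Definition ccont (f : R -> C) := forall x : R, cabs (f y - f x) @[y --> x] --> 0.

Lemma ccont_Re f : ccont f -> continuous (fun x => Re (f x)).
Proof.
move=> cf x; apply/cvgrPdist_lt => e e0; move/cvgrPdist_lt : (cf x) => /(_ e e0).
apply: filterS => y; rewrite sub0r normrN ger0_norm ?cabs_ge0//; apply: le_lt_trans.
by rewrite cabs_distC -ReB le_Re_cabs.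
Qed.

Lemma ccont_Im f : ccont f -> continuous (fun x => Im (f x)).
Proof.
move=> cf x; apply/cvgrPdist_lt => e e0; move/cvgrPdist_lt : (cf x) => /(_ e e0).
apply: filterS => y; rewrite sub0r normrN ger0_norm ?cabs_ge0//; apply: le_lt_trans.
by rewrite cabs_distC -ImB le_Im_cabs.
Qed.

Lemma ccontP f : continuous (fun x => Re (f x)) -> continuous (fun x => Im (f x)) -> ccont f.
Proof.
move=> cr ci x.
apply: (@squeeze_cvgr _ _ _ _ (fun=> 0) (fun y => `|Re (f y) - Re (f x)| + `|Im (f y) - Im (f x)|)).
- by apply: nearW => n; rewrite cabs_ge0 /= -ReB -ImB cabs_le_ReIm.
- exact: cvg_cst.
- have aux (g : R -> R) : continuous g -> `|g y - g x| @[y --> x] --> (0 : R).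
    move=> cg; rewrite -(@normr0 _ R) -(subrr (g x)).
    by apply: cvg_norm; apply: cvgB; [exact: cg|exact: cvg_cst].
  have := cvgD (aux _ cr) (aux _ ci); rewrite addr0. exact.
Qed.

Lemma cmeas_ccont f : ccont f -> cmeas setT f.
Proof.
by move=> cf; split; apply: continuous_measurable_fun; [exact: ccont_Re|exact: ccont_Im].
Qed.

Definition ei (s : R) : C := cexp (Complex 0 s).

Lemma cabs_ei s : cabs (ei s) = 1. Proof. exact: unit_cexp. Qed.
Lemma eiD s t : ei (s + t) = ei s * ei t.
Proof. by rewrite /ei -cexpD; congr cexp; apply: complex_eqP; rewrite ?ReD ?ImD /= ?addr0. Qed.
Lemma ei0 : ei 0 = 1. Proof. exact: cexp0. Qed.
Lemma ccont_ei : ccont ei.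
Proof.
apply: ccontP.
  rewrite (_ : (fun x => _) = cos); first exact: continuous_cos.
  by apply/funext => x /=; rewrite expR0 mul1r.
rewrite (_ : (fun x => _) = sin); first exact: continuous_sin.
by apply/funext => x /=; rewrite expR0 mul1r.
Qed.
Lemma cmeas_ei : cmeas setT ei. Proof. exact: cmeas_ccont ccont_ei. Qed.
Lemma cmeas_ei_mul u : cmeas setT (fun t => ei (t * u)).
Proof. by apply: (cmeas_comp cmeas_ei); exact: measurable_funM. Qed.
Lemma jmeas_ei (phi : R * R -> R) : measurable_fun setT phi -> jmeas (fun z => ei (phi z)).
Proof. exact: (jmeas_comp cmeas_ei). Qed.

Lemma measurable_prodR : measurable_fun [set: R * R] (fun z : R * R => z.1 * z.2).
Proof. exact: measurable_funM. Qed.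

Lemma RintegralFTC (f F : R -> R) (b : R) : 0 < b -> continuous f ->
  (forall x : R, is_derive x (1 : R) F (f x)) -> Rintegral mu `[0, b] f = F b - F 0.
Proof.
move=> b0 cf dF; rewrite /Rintegral (@continuous_FTC2 _ f F)//.
- exact: continuous_subspaceT.
- have cF x : {for x, continuous F}.
    by apply/differentiable_continuous/derivable1_diffP; exact: ex_derive.
  split.
  + by move=> x _; exact: ex_derive.
  + by apply: cvg_at_right_filter; exact: cF.
  + by apply: cvg_at_left_filter; exact: cF.
- by move=> x _; rewrite derive1E; exact: derive_val.
Qed.

Lemma cint_mkcond (D : set R) (p : pred R) (f : R -> C) : (forall x, D x <-> p x) ->
  cint D f = cint setT (fun x => if p x then f x else 0).
Proof.
move=> Dp; congr Complex; rewrite Rintegral_mkcond; apply: eq_Rintegral => x _;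
  rewrite patchE; case: ifPn => [/set_mem/Dp ->//|/negP h];
  by case: ifPn => // /Dp/mem_set.
Qed.

Lemma cintegrable_mkcond (D : set R) (p : pred R) (f : R -> C) : measurable D ->
  (forall x, D x <-> p x) ->
  cintegrable D f <-> cintegrable setT (fun x => if p x then f x else 0).
Proof.
move=> mD Dp.
have key (g : R -> R) : mu.-integrable D (EFin \o g) <->
    mu.-integrable setT (EFin \o (fun x => if p x then g x else 0)).
  have -> : EFin \o (fun x => if p x then g x else 0) = (EFin \o g) \_ D.
    apply/funext => x /=; rewrite patchE; case: (boolP (x \in D)) => [/set_mem/Dp ->//|/negP h].
    by case: ifPn => // /Dp/mem_set.
  exact: (@integrable_mkcond _ _ _ mu D).
split=> -[fr fi]; split.
- by move/key : fr; apply: eq_lintegrable => // x _; case: ifP.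
- by move/key : fi; apply: eq_lintegrable => // x _; case: ifP.
- by apply/key; move: fr; apply: eq_lintegrable => // x _; case: ifP.
- by apply/key; move: fi; apply: eq_lintegrable => // x _; case: ifP.
Qed.

Lemma cmeas_mkcond (p : pred R) (f : R -> C) : measurable [set x | p x] ->
  cmeas setT f -> cmeas setT (fun x => if p x then f x else 0).
Proof.
move=> mp [fr fi].
have mp' : measurable_fun [set: R] p by apply: (measurable_fun_bool true); rewrite setTI.
split.
  rewrite (_ : (fun x => _) = (fun x => if p x then Re (f x) else 0)).
    exact: measurable_fun_ifT.
  by apply/funext => x; case: ifP.
rewrite (_ : (fun x => _) = (fun x => if p x then Im (f x) else 0)).
  exact: measurable_fun_ifT.
by apply/funext => x; case: ifP.
Qed.

Lemma ge0_itvcy (x : R) : `[0, +oo[%classic x <-> 0 <= x.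
Proof. by rewrite /= in_itv /= andbT. Qed.

Lemma continuous_linear (a : R) : continuous (fun t : R => - (a * t)).
Proof. by move=> x; apply: cvgN; apply: cvgM; [exact: cvg_cst|exact: cvg_id]. Qed.

Lemma continuous_expR_lin (a : R) : continuous (fun t : R => expR (- (a * t))).
Proof.
move=> x; apply: (@continuous_comp _ _ _ (fun t : R => - (a * t)) expR).
  exact: continuous_linear.
exact: continuous_expR.
Qed.

Lemma cvgy_expRN (a : R) : 0 < a -> expR (- (a * t)) @[t --> +oo] --> (0 : R).
Proof.
move=> a0; apply: (@cvg_comp _ _ _ (fun t : R => a * t) (fun t => expR (- t))); last exact: cvgr_expR.
by apply: gt0_cvgMry => //; exact: cvg_id.
Qed.

Lemma integrable_expR (a : R) : 0 < a ->
  mu.-integrable `[0, +oo[ (EFin \o (fun t : R => expR (- (a * t)))).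
Proof.
move=> a0.
have dF (x : R) : is_derive x (1 : R) (fun t : R => - a^-1 * expR (- (a * t))) (expR (- (a * x))).
  by apply: is_derive_eq; rewrite /GRing.scale /=; field; rewrite gt_eqF.
have cF : continuous (fun t : R => - a^-1 * expR (- (a * t))).
  by move=> x; apply/differentiable_continuous/derivable1_diffP; exact: ex_derive.
apply/integrableP; split.
  apply/measurable_EFinP; apply: measurable_funTS.
  by apply: continuous_measurable_fun; exact: continuous_expR_lin.
under eq_integral do rewrite /= ger0_norm ?expR_ge0//.
rewrite (@ge0_continuous_FTC2y _ _ (fun t : R => - a^-1 * expR (- (a * t))) 0 0).
- by rewrite -EFinB ltry.
- by move=> x _; exact: expR_ge0.
- by apply: continuous_subspaceT; exact: continuous_expR_lin.
- rewrite -[X in _ --> X](mulr0 (- a^-1)); apply: cvgM; first exact: cvg_cst.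
  exact: cvgy_expRN.
- by move=> x _; exact: ex_derive.
- by apply: cvg_at_right_filter; exact: cF.
- by move=> x _; rewrite derive1E; exact: derive_val.
Qed.

Definition lexp (z : C) (t : R) : C := cexp (- (rC t * z)).

Lemma lexpE (z : C) t : lexp z t = Complex (expR (- (Re z * t)) * cos (- (Im z * t)))
  (expR (- (Re z * t)) * sin (- (Im z * t))).
Proof.
rewrite /lexp /cexp ReN ImN ReM ImM /= !mul0r subr0 addr0.
by rewrite [Re z * t]mulrC [Im z * t]mulrC.
Qed.

Lemma cabs_lexp (z : C) t : cabs (lexp z t) = expR (- (Re z * t)).
Proof. by rewrite cabs_cexp ReN ReM /= mul0r subr0 mulrC. Qed.

Lemma ccont_lexp (z : C) : ccont (lexp z).
Proof.
apply: ccontP => x; apply/differentiable_continuous/derivable1_diffP.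
  have -> : (fun x => Re (lexp z x)) = (fun t => expR (- (Re z * t)) * cos (- (Im z * t))).
    by apply/funext => t; rewrite lexpE.
  exact: ex_derive.
have -> : (fun x => Im (lexp z x)) = (fun t => expR (- (Re z * t)) * sin (- (Im z * t))).
  by apply/funext => t; rewrite lexpE.
exact: ex_derive.
Qed.

Lemma cmeas_lexp (z : C) : cmeas setT (lexp z). Proof. exact: cmeas_ccont (@ccont_lexp z). Qed.

(** Half-line integrals are carried to the whole line, where Fubini and the translation lemmas
    apply. *)
Definition pos (f : R -> C) (t : R) : C := if 0 <= t then f t else 0.

Lemma measurable_ge0 : measurable [set x : R | 0 <= x].
Proof. by rewrite -set_itvcy. Qed.

Lemma cint_pos f : cint `[0, +oo[ f = cint setT (pos f).
Proof. exact: cint_mkcond ge0_itvcy. Qed.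

Lemma cintegrable_pos f : cintegrable `[0, +oo[ f <-> cintegrable setT (pos f).
Proof. exact: (cintegrable_mkcond _ (measurable_itv _) ge0_itvcy). Qed.

Lemma cmeas_pos f : cmeas setT f -> cmeas setT (pos f).
Proof. exact: cmeas_mkcond measurable_ge0. Qed.

Lemma integrable_pos_expR (a : R) : 0 < a ->
  mu.-integrable setT (EFin \o (fun t : R => if 0 <= t then expR (- (a * t)) else 0)).
Proof.
move=> a0; have [+ _] : cintegrable setT (pos (fun t => rC (expR (- (a * t))))).
  apply/cintegrable_pos; split; first exact: integrable_expR.
  exact: integrable0.
by apply: eq_lintegrable => // x _; rewrite /pos; case: ifP.
Qed.

Lemma cintegrable_lexp (z : C) : 0 < Re z -> cintegrable setT (pos (lexp z)).
Proof.
move=> z0; apply: (cintegrable_le _ _ (integrable_pos_expR z0)) => //.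
  by apply: cmeas_pos; exact: cmeas_lexp.
by move=> x _; rewrite /pos; case: ifP => _; rewrite ?cabs_lexp ?cabs0.
Qed.

Lemma cint_lexp_itv (z : C) (b : R) : 0 < b -> cint `[0, b] (fun t => - z * lexp z t) = lexp z b - 1.
Proof.
move=> b0.
have lexp0 : lexp z 0 = 1 by rewrite /lexp rC0 mul0r oppr0 cexp0.
rewrite -lexp0; apply: complex_eqP; rewrite ?ReB ?ImB /cint.
  apply: (@RintegralFTC (fun t => Re (- z * lexp z t)) (fun t => Re (lexp z t))) => //.
    move=> x.
    have -> : (fun t => Re (- z * lexp z t)) = (fun t => Re (- z) * Re (lexp z t) - Im (- z) * Im (lexp z t)).
      by apply/funext => t; rewrite ReM.
    by apply: cvgB; apply: cvgM; try exact: cvg_cst; [exact: (ccont_Re (@ccont_lexp z))|exact: (ccont_Im (@ccont_lexp z))].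
  move=> x; rewrite (_ : (fun t => _) = (fun t => expR (- (Re z * t)) * cos (- (Im z * t)))); last first.
    by apply/funext => t; rewrite lexpE.
  apply: is_derive_eq; rewrite ReM ReN ImN lexpE /= /GRing.scale /=; ring.
apply: (@RintegralFTC (fun t => Im (- z * lexp z t)) (fun t => Im (lexp z t))) => //.
  move=> x.
  have -> : (fun t => Im (- z * lexp z t)) = (fun t => Re (- z) * Im (lexp z t) + Im (- z) * Re (lexp z t)).
    by apply/funext => t; rewrite ImM.
  by apply: cvgD; apply: cvgM; try exact: cvg_cst; [exact: (ccont_Im (@ccont_lexp z))|exact: (ccont_Re (@ccont_lexp z))].
move=> x; rewrite (_ : (fun t => _) = (fun t => expR (- (Re z * t)) * sin (- (Im z * t)))); last first.
  by apply/funext => t; rewrite lexpE.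
apply: is_derive_eq; rewrite ImM ReN ImN lexpE /= /GRing.scale /=; ring.
Qed.

Lemma ccvg_unique (u : nat -> C) l l' : ccvg u l -> ccvg u l' -> l = l'.
Proof.
move=> /ccvgP[ar ai] /ccvgP[br bi].
by apply: complex_eqP; [exact: (cvg_unique _ ar br)|exact: (cvg_unique _ ai bi)].
Qed.

(** The integrals of - z e^(-tz) over [0, n + 1] converge by domination to - z times the integral,
    and by the explicit primitive to -1. *)
Lemma cint_lexp (z : C) : 0 < Re z -> cint setT (pos (lexp z)) = z^-1.
Proof.
move=> z0; have zn0 : z != 0 by apply/eqP => e; rewrite e ltxx in z0.
have zi := cintegrable_lexp z0.
apply: (@mulfI _ (- z)); first by rewrite oppr_eq0.
rewrite -cintZ//; have -> : - z * z^-1 = -1 by rewrite mulNr divff.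
have lim1 : ccvg (fun n => cint `[0, n.+1%:R] (fun t => - z * lexp z t))
    (cint setT (fun t => - z * pos (lexp z) t)).
  have E n : cint `[0, n.+1%:R] (fun t => - z * lexp z t) =
      cint setT (fun t => if (0 <= t) && (t <= n.+1%:R) then - z * lexp z t else 0).
    by apply: cint_mkcond => x; rewrite /= in_itv.
  under [X in ccvg X]eq_fun do rewrite E.
  apply: (@cint_dominated _ _ _ _ (fun t => cabs z * (if 0 <= t then expR (- (Re z * t)) else 0))) => //.
  - move=> n; apply: cmeas_mkcond.
      by rewrite (_ : [set x | _] = `[0, n.+1%:R]%classic) //; apply/seteqP; split => x; rewrite /= in_itv.
    by apply: cmeasM; [exact: cmeas_cst|exact: cmeas_lexp].
  - by apply: cmeasM; [exact: cmeas_cst|exact: cintegrable_meas].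
  - exact: (lintegrableZ _ measurableT (integrable_pos_expR z0)).
  - move=> n x _; case: ifPn => [/andP[-> _]|_]; first by rewrite cabsM cabsN cabs_lexp.
    by rewrite cabs0 mulr_ge0 ?cabs_ge0//; case: ifP => // _; exact: expR_ge0.
  - move=> x _; have [x0|x0] := leP 0 x; last first.
      have -> : pos (lexp z) x = 0 by rewrite /pos leNgt x0.
      by rewrite mulr0 /ccvg; apply: cvg_near_cst; apply: nearW => n; rewrite /= subrr cabs0.
    rewrite /ccvg /pos x0 /=; apply: cvg_near_cst; near=> n.
    have -> : x <= n.+1%:R.
      near: n; exists `|Num.ceil x|%N => // n /= h.
      rewrite (le_trans (ceil_ge _))// (le_trans (ler_norm _))//.
      by rewrite -intr_norm -natr_absz ler_nat (leq_trans h).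
    by rewrite subrr cabs0.
have lim2 : ccvg (fun n => cint `[0, n.+1%:R] (fun t => - z * lexp z t)) (-1).
  have E n : cabs (cint `[0, n.+1%:R] (fun t => - z * lexp z t) - -1) = expR (- (Re z * n.+1%:R)).
    by rewrite cint_lexp_itv// opprK subrK cabs_lexp.
  rewrite /ccvg; under eq_fun do rewrite E.
  have /cvg_pinftyP h := cvgy_expRN z0; apply: (h (fun n => n.+1%:R)).
  by rewrite (cvg_shiftS (fun n => n%:R : R)); exact: cvgr_idn.
exact: (ccvg_unique lim1 lim2).
Unshelve. all: by end_near. Qed.

End kernels.

(** * The Poisson kernel and Fourier inversion *)

Section poisson.
Context {R : realType}.
Local Notation C := (complex R).
Local Notation mu := (@lebesgue_measure R).

Definition Pois (y w : R) : R := y / (pi * (w ^+ 2 + y ^+ 2)).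

Lemma Pois_den_gt0 (y w : R) : 0 < y -> 0 < pi * (w ^+ 2 + y ^+ 2).
Proof. by move=> y0; rewrite mulr_gt0 ?pi_gt0// ltr_wpDl ?sqr_ge0// exprn_gt0. Qed.

Lemma Pois_ge0 (y w : R) : 0 < y -> 0 <= Pois y w.
Proof. by move=> y0; rewrite divr_ge0 ?ltW ?Pois_den_gt0. Qed.

Lemma Pois_le (y w : R) : 0 < y -> Pois y w <= (pi * y)^-1.
Proof.
move=> y0; rewrite /Pois ler_pdivrMr ?Pois_den_gt0//.
have := pi_gt0 R; move: (@pi R) => p p0.
have -> : (p * y)^-1 * (p * (w ^+ 2 + y ^+ 2)) = y + w ^+ 2 / y by field; rewrite !gt_eqF.
by rewrite lerDl divr_ge0 ?sqr_ge0// ltW.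
Qed.

Lemma PoisN (y w : R) : Pois y (- w) = Pois y w.
Proof. by rewrite /Pois sqrrN. Qed.

Lemma continuous_Pois (y : R) : 0 < y -> continuous (Pois y).
Proof.
move=> y0 w; apply: cvgM; first exact: cvg_cst.
apply: cvgV; first by rewrite gt_eqF// Pois_den_gt0.
apply: cvgM; first exact: cvg_cst.
by apply: cvgD; [exact: exprn_continuous|exact: cvg_cst].
Qed.

Lemma integral_Pois (y : R) : 0 < y -> (\int[mu]_w (Pois y w)%:E = 1)%E.
Proof.
move=> y0.
rewrite ge0_symfun_integralT; last 3 first.
- by move=> w; exact: Pois_ge0.
- exact: continuous_Pois.
- by move=> w /=; rewrite PoisN.
have dF (x : R) : is_derive x (1 : R) (fun w : R => pi^-1 * atan (y^-1 * w)) (Pois y x).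
  apply: is_derive_eq; rewrite /GRing.scale /= mulr1 /Pois.
  have q0' : x ^+ 2 + y ^+ 2 != 0 by rewrite gt_eqF// ltr_wpDl ?sqr_ge0// exprn_gt0.
  have := pi_gt0 R; move: (@pi R) => p p0.
  have -> : 1 + (y^-1 * x) ^+ 2 = (x ^+ 2 + y ^+ 2) / y ^+ 2 by field; rewrite gt_eqF.
  by field; rewrite ?q0' ?(gt_eqF p0) ?(gt_eqF y0).
have cF : continuous (fun w : R => pi^-1 * atan (y^-1 * w)).
  by move=> x; apply/differentiable_continuous/derivable1_diffP; exact: ex_derive.
rewrite -set_itvcy (@ge0_continuous_FTC2y _ _ (fun w : R => pi^-1 * atan (y^-1 * w)) 0 (pi^-1 * (pi / 2))).
- rewrite mulr0 atan0 mulr0 sube0 -EFinM; congr (_%:E).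
  by have := pi_gt0 R; move: (@pi R) => p p0; field; rewrite gt_eqF.
- by move=> w _; exact: Pois_ge0.
- by apply: continuous_subspaceT; exact: continuous_Pois.
- apply: cvgM; first exact: cvg_cst.
  apply: (@cvg_comp _ _ _ (fun t : R => y^-1 * t) (@atan R)); last exact: cvgy_atan.
  by apply: gt0_cvgMry; [rewrite invr_gt0|exact: cvg_id].
- by move=> x _; exact: ex_derive.
- by apply: cvg_at_right_filter; exact: cF.
- by move=> x _; rewrite derive1E; exact: derive_val.
Qed.

Lemma integrable_Pois (y : R) : 0 < y -> mu.-integrable setT (EFin \o Pois y).
Proof.
move=> y0; apply/integrableP; split.
  by apply/measurable_EFinP; apply: continuous_measurable_fun; exact: continuous_Pois.
under eq_integral do rewrite /= ger0_norm ?Pois_ge0//.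
by rewrite integral_Pois// ltry.
Qed.

Lemma Rintegral_Pois (y : R) : 0 < y -> Rintegral mu setT (Pois y) = 1.
Proof. by move=> y0; rewrite /Rintegral integral_Pois. Qed.

Lemma cintegrable_Pois (y : R) : 0 < y -> cintegrable setT (fun w => rC (Pois y w)).
Proof. by move=> y0; split; [exact: integrable_Pois|exact: integrable0]. Qed.

Lemma cint_Pois (y : R) : 0 < y -> cint setT (fun w => rC (Pois y w)) = 1.
Proof. by move=> y0; rewrite /cint Rintegral_Pois// /Rintegral integral0. Qed.

(** Comparison with the fixed kernel of height 1, whose integral is 1, bounds the mass of [Pois y]
    outside (-d, d) by y (1 + d^-2). *)
Lemma Pois_tail (y d w : R) : 0 < y -> 0 < d -> d <= `|w| ->
  Pois y w <= y * (1 + d ^- 2) * Pois 1 w.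
Proof.
move=> y0 d0 dw.
have w2 : d ^+ 2 <= w ^+ 2 by rewrite -(real_normK (num_real w)) ler_pXn2r ?nnegrE// ltW.
have d2 : 0 < d ^+ 2 by rewrite exprn_gt0.
have w20 : 0 < w ^+ 2 by exact: lt_le_trans w2.
have h : (w ^+ 2 + y ^+ 2)^-1 <= (1 + d ^- 2) / (w ^+ 2 + 1).
  apply: (@le_trans _ _ (w ^+ 2)^-1).
    by rewrite lef_pV2 ?posrE ?lerDl ?sqr_ge0// ltr_wpDr ?sqr_ge0.
  rewrite ler_pdivlMr; last by rewrite ltr_wpDr.
  by rewrite mulrDr mulVf ?gt_eqF// mulr1 lerD2l lef_pV2 ?posrE.
have -> : Pois y w = y / pi * (w ^+ 2 + y ^+ 2)^-1 by rewrite /Pois invfM mulrA.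
have -> : y * (1 + d ^- 2) * Pois 1 w = y / pi * ((1 + d ^- 2) / (w ^+ 2 + 1)).
  by rewrite /Pois expr1n [(pi * _)^-1]invfM; move: (@pi R) => p; ring.
by rewrite ler_wpM2l// divr_ge0 ?pi_ge0// ltW.
Qed.

(** Points with |w| < d contribute at most e, and the tail at most 2 K times its mass. The explicit
    form serves both convergence at one point and uniform approximation, according to whether d
    depends on v. *)
Lemma approx_identity (f : R -> C) (K e d y v : R) : cmeas setT f ->
  (forall x, cabs (f x) <= K) -> 0 < d -> 0 < y -> 0 <= e ->
  (forall w, `|w| < d -> cabs (f (v + w) - f v) <= e) ->
  cabs (cint setT (fun w => rC (Pois y w) * f (v + w)) - f v) <= e + 2 * K * (y * (1 + d ^- 2)).
Proof.
move=> mf fK d0 y0 e0 fe.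
have mfv : cmeas setT (fun w => f (v + w)).
  by apply: cmeas_ext (cmeas_shift v mf) => x _; rewrite addrC.
have iP := cintegrable_Pois y0.
have K0 : 0 <= K by exact: le_trans (cabs_ge0 _) (fK 0).
have -> : f v = cint setT (fun w => rC (Pois y w) * f v) by rewrite cintZr// cint_Pois// mul1r.
rewrite -cintB//; last 2 first.
- by apply: cintegrable_mulb => // x _; exact: fK.
- by apply: (cintegrable_mulb _ iP (cmeas_cst _ _)) => // x _; exact: fK.
pose c := y * (1 + d ^- 2).
have c0 : 0 <= c by rewrite mulr_ge0 ?(ltW y0)// addr_ge0// invr_ge0 sqr_ge0.
have ig : mu.-integrable setT (EFin \o (fun w => e * Pois y w + 2 * K * c * Pois 1 w)).
  apply: lintegrableD => //; apply: lintegrableZ => //; exact: integrable_Pois.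
have -> : e + 2 * K * c = Rintegral mu setT (fun w => e * Pois y w + 2 * K * c * Pois 1 w).
  rewrite RintegralD//; last 2 first.
  - by apply: lintegrableZ => //; exact: integrable_Pois.
  - by apply: lintegrableZ => //; exact: integrable_Pois.
  have iPy := integrable_Pois y0; have iP1 := @integrable_Pois 1 ltr01.
  rewrite (@RintegralZl _ _ _ mu setT (Pois y) e)// (@RintegralZl _ _ _ mu setT (Pois 1))//.
  by rewrite !Rintegral_Pois// !mulr1.
apply: cabs_cint_le => //.
- apply: cmeasB; apply: cmeasM => //; try exact: cmeas_cst; exact: cintegrable_meas.
- move=> w _; rewrite -mulrBr cabsM cabs_rC ger0_norm ?Pois_ge0//.
  have [wd|dw] := ltP `|w| d.
    rewrite (le_trans (ler_wpM2l _ (fe _ wd))) ?Pois_ge0// mulrC lerDl.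
    by rewrite mulr_ge0 ?Pois_ge0// mulr_ge0// mulr_ge0.
  rewrite (@le_trans _ _ (2 * K * Pois y w))//.
    rewrite mulrC ler_wpM2r ?Pois_ge0// (le_trans (cabsB _ _))//.
    by rewrite mulrDl mul1r lerD.
  rewrite (@le_trans _ _ (2 * K * c * Pois 1 w))//.
    by rewrite -[leRHS]mulrA ler_wpM2l ?mulr_ge0// Pois_tail.
  by rewrite lerDr mulr_ge0 ?Pois_ge0.
Qed.

(** The Abel summation factor; its Fourier transform is 2 pi times the Poisson kernel of height
    y. *)
Definition eabs (y t : R) : C := rC (expR (- (y * `|t|))).

Lemma cabs_eabs y t : cabs (eabs y t) = expR (- (y * `|t|)).
Proof. by rewrite cabs_rC ger0_norm ?expR_ge0. Qed.

Lemma cabs_eabs_le1 y t : 0 <= y -> cabs (eabs y t) <= 1.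
Proof. by move=> y0; rewrite cabs_eabs -expR0 ler_expR oppr_le0 mulr_ge0. Qed.

Lemma ccont_eabs y : ccont (eabs y).
Proof.
apply: ccontP => x /=; last exact: cvg_cst.
apply: (@continuous_comp _ _ _ (fun t : R => - (y * `|t|)) expR); last exact: continuous_expR.
by apply: cvgN; apply: cvgM; [exact: cvg_cst|exact: norm_continuous].
Qed.

Lemma cmeas_eabs y : cmeas setT (eabs y). Proof. exact: cmeas_ccont (@ccont_eabs y). Qed.

(** Strict variant of [pos], so that the reflected half in [eabs_split] does not count t = 0 a
    second time. *)
Definition spos (f : R -> C) (t : R) : C := if 0 < t then f t else 0.

Lemma gt0_itvoy (x : R) : `]0, +oo[%classic x <-> 0 < x.
Proof. by rewrite /= in_itv /= andbT. Qed.

Lemma cintegrable_spos f : cintegrable setT (pos f) -> cintegrable setT (spos f).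
Proof.
move=> /cintegrable_pos [fr fi]; apply/(cintegrable_mkcond _ _ gt0_itvoy) => //.
have sub : `]0, +oo[%classic `<=` (`[0, +oo[%classic : set R).
  by move=> x; rewrite /= !in_itv /= !andbT => /ltW.
by split; [apply: integrableS fr|apply: integrableS fi].
Qed.

Lemma cint_spos f : cintegrable setT (pos f) -> cint setT (spos f) = cint setT (pos f).
Proof.
move=> fi; rewrite -cint_pos -(cint_mkcond _ gt0_itvoy) /cint.
have [ir ii] : cintegrable `]0, +oo[ f.
  by apply/(cintegrable_mkcond _ _ gt0_itvoy) => //; exact: cintegrable_spos.
by congr Complex; apply: Rintegral_itv_obnd_cbnd.
Qed.

Lemma eabs_split (y u t : R) : eabs y t * ei (t * u) =
  pos (lexp (Complex y (- u))) t + spos (lexp (Complex y u)) (- t).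
Proof.
have aux (v s : R) : 0 <= s -> lexp (Complex y v) s = eabs y s * ei (- (s * v)).
  move=> s0; rewrite lexpE /eabs /ei /cexp /= ger0_norm// expR0 !mul1r [v * s]mulrC.
  by apply: complex_eqP; rewrite ?ReM ?ImM /= mul0r ?subr0 ?addr0.
rewrite /pos /spos; have [t0|t0] := leP 0 t.
  by rewrite ltNge oppr_le0 t0 /= addr0 aux// mulrN opprK.
rewrite oppr_gt0 t0 add0r aux ?oppr_ge0 ?ltW// /eabs normrN; congr (_ * ei _).
by rewrite mulNr opprK.
Qed.

Lemma cintegrable_eabs (y : R) : 0 < y -> cintegrable setT (eabs y).
Proof.
move=> y0.
have h : cintegrable setT (fun t => pos (lexp (Complex y (- 0))) t + spos (lexp (Complex y 0)) (- t)).
  apply: cintegrableD => //; first exact: cintegrable_lexp.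
  by apply: (cintegrable_opp (f := spos _)); apply: cintegrable_spos; exact: cintegrable_lexp.
by apply: cintegrable_ext h => // x _; rewrite -eabs_split mulr0 ei0 mulr1.
Qed.

Lemma invc_conj (z : C) : z^-1 = cconj z * rC (cabs z ^+ 2)^-1.
Proof.
have [->|z0] := eqVneq z 0; first by rewrite invr0 cconj0 mul0r.
have c0 : cabs z ^+ 2 != 0.
  by rewrite sqrf_eq0; apply: contra z0 => /eqP/cabs_eq0 ->.
by apply: (mulfI z0); rewrite divff// mulrA mul_cconj -rCM divff// rC1.
Qed.

Lemma cint_eabs_ei (y u : R) : 0 < y ->
  cint setT (fun t => eabs y t * ei (t * u)) = rC (2 * pi * Pois y u).
Proof.
move=> y0.
have i1 : cintegrable setT (pos (lexp (Complex y (- u)))) by exact: cintegrable_lexp.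
have i2 : cintegrable setT (pos (lexp (Complex y u))) by exact: cintegrable_lexp.
rewrite (eq_cint (fun t _ => eabs_split y u t)) cintD//; last first.
  by apply: (cintegrable_opp (f := spos _)); exact: cintegrable_spos.
rewrite (cint_opp (f := spos _)); last by apply: cintegrable_meas; exact: cintegrable_spos.
rewrite cint_spos// !cint_lexp//.
rewrite !invc_conj.
have q0 : u ^+ 2 + y ^+ 2 != 0 by rewrite gt_eqF// ltr_wpDl ?sqr_ge0// exprn_gt0.
have q1 : y ^+ 2 + u ^+ 2 != 0 by rewrite addrC.
apply: complex_eqP; rewrite !sqr_cabs ?ReD ?ImD !(ReM, ImM) /Pois /= sqrrN ?opprK.
  have := pi_gt0 R; move: (@pi R) => p p0.
  by field; rewrite ?q0 ?q1 ?(gt_eqF p0).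
by ring.
Qed.

(** The Fourier transform at - u. With this sign, [chk b] is the boundary function of the Laplace
    transform of a weight b on the half-line. *)
Definition chk (b : R -> C) (u : R) : C := cint setT (fun t => b t * ei (t * u)).

Lemma fourier_chk h u : fourier h u = chk h (- u).
Proof. by apply: eq_cint => t _; rewrite mulrN. Qed.

Lemma jmeas_ei_prod : jmeas (fun z : R * R => ei (z.1 * z.2)).
Proof. exact: jmeas_ei measurable_prodR. Qed.

Lemma cmeas_chk b : cmeas setT b -> cmeas setT (chk b).
Proof.
move=> mb; apply: (cmeas_ext _ (cmeas_cint_kernel mb (jmeas_ei measurable_prodR))) => u _.
by apply: eq_cint => t _; rewrite /= [u * t]mulrC.
Qed.

Lemma cabs_chk b u : cintegrable setT b -> cabs (chk b u) <= L1norm b.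
Proof.
move=> bi; rewrite -[leRHS]mul1r; apply: cabs_cint_mulb => //; first exact: cmeas_ei_mul.
by move=> x; rewrite cabs_ei.
Qed.

Lemma chk_exchange (a b : R -> C) : cintegrable setT a -> cintegrable setT b ->
  cint setT (fun u => a u * chk b u) = cint setT (fun t => b t * chk a t).
Proof.
move=> ai bi.
have bk (z : R * R) : cabs (ei (z.1 * z.2)) <= 1 by rewrite cabs_ei.
rewrite -(cint_fubini ai bi jmeas_ei_prod bk); apply: eq_cint => u _.
by congr (_ * _); apply: eq_cint => t _; rewrite /= [u * t]mulrC.
Qed.

(** The Abel factor makes the double integral absolutely convergent; Fubini then turns the inversion
    integral into a Poisson mean of h around v. *)
Lemma chk_abel (h : R -> C) (v y : R) : cintegrable setT h -> 0 < y ->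
  cint setT (fun u => chk h (- u) * (eabs y u * ei (u * v))) =
  rC (2 * pi) * cint setT (fun w => rC (Pois y w) * h (v + w)).
Proof.
move=> hi y0.
have ia : cintegrable setT (fun u => eabs y u * ei (u * v)).
  apply: (cintegrable_mulb _ (cintegrable_eabs y0) (cmeas_ei_mul v)) => // x _.
  by rewrite cabs_ei.
have mk : jmeas (fun z : R * R => ei (z.2 * - z.1)).
  by apply: jmeas_ei; apply: measurable_funM => //; exact: measurable_funN.
have bk (z : R * R) : cabs (ei (z.2 * - z.1)) <= 1 by rewrite cabs_ei.
have mh := cintegrable_meas hi.
transitivity (cint setT (fun t => h t * rC (2 * pi * Pois y (v - t)))).
  rewrite -(eq_cint (fun u _ => mulrC _ (chk h (- u)))).
  rewrite (cint_fubini ia hi mk bk); apply: eq_cint => t _; congr (_ * _).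
  rewrite -cint_eabs_ei//; apply: eq_cint => u _; rewrite -mulrA -eiD; congr (_ * ei _).
  by rewrite /=; ring.
have mg : cmeas setT (fun t => h t * rC (2 * pi * Pois y (v - t))).
  apply: cmeasM => //; split => /=; last exact: measurable_cst.
  apply: measurable_funM; first exact: measurable_cst.
  apply: continuous_measurable_fun => x.
  apply: (@continuous_comp _ _ _ (fun t : R => v - t) (Pois y)); last exact: continuous_Pois.
  by apply: cvgB; [exact: cvg_cst|exact: cvg_id].
rewrite -(cint_shift v mg) -cintZ//; last first.
  apply: (@cintegrable_ext _ _ (fun w => h (w + v) * rC (Pois y w))) => //.
    by move=> w _; rewrite mulrC addrC.
  apply: (cintegrable_mulb (K := (pi * y)^-1) _ (cintegrable_shift v hi)) => //.
    exact: cintegrable_meas (cintegrable_Pois y0).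
  by move=> w _; rewrite cabs_rC ger0_norm ?Pois_ge0// Pois_le.
apply: eq_cint => w _.
have -> : v - (w + v) = - w by ring.
by rewrite PoisN rCM [w + v]addrC; ring.
Qed.

Lemma ccvg_harm (u : nat -> C) l (K : R) : (forall n, cabs (u n - l) <= K * n.+1%:R^-1) -> ccvg u l.
Proof.
move=> h; apply: (@squeeze_cvgr _ _ _ _ (fun=> 0) (fun n => K * n.+1%:R^-1)).
- by apply: nearW => n; rewrite cabs_ge0 h.
- exact: cvg_cst.
- by rewrite -(mulr0 K); apply: cvgM; [exact: cvg_cst|exact: cvg_harmonic].
Qed.

Lemma ccvg_epsP (u : nat -> C) l : ccvg u l <->
  forall e, 0 < e -> exists N, forall n, (N <= n)%N -> cabs (u n - l) <= e.
Proof.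
split=> [ul e e0|h].
  move/cvgrPdist_le : ul => /(_ e e0) [N _ hN]; exists N => n /hN.
  by rewrite /= sub0r normrN ger0_norm ?cabs_ge0.
apply/cvgrPdist_le => e /h [N hN]; exists N => // n /hN.
by rewrite /= sub0r normrN ger0_norm ?cabs_ge0.
Qed.

Lemma harm_gt0 n : 0 < n.+1%:R^-1 :> R. Proof. by rewrite invr_gt0. Qed.

Lemma poisson_approx_cvg (h : R -> C) (K v : R) : cmeas setT h -> (forall x, cabs (h x) <= K) ->
  cabs (h y - h v) @[y --> v] --> 0 ->
  ccvg (fun n => cint setT (fun w => rC (Pois n.+1%:R^-1 w) * h (v + w))) (h v).
Proof.
move=> mh hK ch; apply/ccvg_epsP => e e0.
move/cvgrPdist_le : ch => /(_ (e / 2)) /(_ ltac:(by rewrite divr_gt0)) [d /= d0 hd].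
have K0 : 0 <= K by exact: le_trans (cabs_ge0 _) (hK 0).
pose B := 2 * K * (1 + d ^- 2) + 1.
have B0 : 0 < B by rewrite ltr_wpDl// mulr_ge0// ?mulr_ge0// addr_ge0// invr_ge0 sqr_ge0.
have /cvgrPdist_le/(_ (e / 2 / B)) : (n.+1%:R^-1 : R) @[n --> \oo] --> 0 by exact: cvg_harmonic.
move=> /(_ ltac:(by rewrite !divr_gt0)) [N _ hN]; exists N => n Nn.
have := hN n Nn; rewrite /= sub0r normrN ger0_norm ?invr_ge0// => hn.
apply: (le_trans (approx_identity (e := e / 2) mh hK d0 (harm_gt0 n) _ _)).
- by rewrite divr_ge0// ltW.
- move=> w wd; have hb : ball_ (fun x : R => `|x|) v d (v + w).
    by rewrite /ball_ /= opprD addNKr normrN.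
  by have := hd _ hb; rewrite /= sub0r normrN ger0_norm ?cabs_ge0.
rewrite [leRHS]splitr lerD2l (@le_trans _ _ (n.+1%:R^-1 * B))//; last by rewrite -ler_pdivlMr.
rewrite mulrCA ler_wpM2l ?invr_ge0// /B lerDl//.
Qed.

(** Abel summation at rate 1 / (n + 1): by domination the left side is the limit of the damped
    integrals, which by [chk_abel] are Poisson means and tend to the value of h at its continuity
    point v. *)
Lemma fourier_inversion (h : R -> C) (K v : R) : cintegrable setT h -> (forall x, cabs (h x) <= K) ->
  cabs (h y - h v) @[y --> v] --> 0 -> cintegrable setT (fun u => chk h (- u)) ->
  cint setT (fun u => chk h (- u) * ei (u * v)) = rC (2 * pi) * h v.
Proof.
move=> hi hK ch ih.
have mh := cintegrable_meas hi.
have lim1 : ccvg (fun n => cint setT (fun u => chk h (- u) * (eabs n.+1%:R^-1 u * ei (u * v))))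
    (cint setT (fun u => chk h (- u) * ei (u * v))).
  apply: (@cint_dominated _ _ _ _ (fun u => cabs (chk h (- u)))) => //.
  - move=> n; apply: cmeasM; first exact: cintegrable_meas.
    by apply: cmeasM; [exact: cmeas_eabs|exact: cmeas_ei_mul].
  - by apply: cmeasM; [exact: cintegrable_meas|exact: cmeas_ei_mul].
  - exact: integrable_cabs.
  - move=> n x _; rewrite !cabsM cabs_ei mulr1 ler_piMr ?cabs_ge0// cabs_eabs_le1//.
  - move=> u _.
    apply: (@ccvg_harm _ _ (cabs (chk h (- u)) * `|u|)) => n.
    rewrite -mulrBr cabsM -mulrA ler_wpM2l ?cabs_ge0//.
    rewrite -{2}(mul1r (ei _)) -mulrBl cabsM cabs_ei mulr1 -rC1 /eabs -rCN -rCD cabs_rC.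
    set x := _ * `|u|; have x0 : 0 <= x by rewrite mulr_ge0.
    rewrite distrC ger0_norm ?subr_ge0; last by rewrite -expR0 ler_expR oppr_le0.
    have := expR_ge1Dx (- x); rewrite mulrC -/x => hx; lra.
have lim2 : ccvg (fun n => cint setT (fun u => chk h (- u) * (eabs n.+1%:R^-1 u * ei (u * v))))
    (rC (2 * pi) * h v).
  have := poisson_approx_cvg mh hK ch => /ccvg_epsP hh; apply/ccvg_epsP => e e0.
  have p0 : 0 < 2 * pi :> R by rewrite mulr_gt0 ?pi_gt0.
  have [N hN] := hh (e / (2 * pi)) ltac:(by rewrite divr_gt0).
  exists N => n /hN {}hN; rewrite chk_abel// -mulrBr cabsM cabs_rC gtr0_norm//.
  by rewrite mulrC -ler_pdivlMr.
exact: ccvg_unique lim1 lim2.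
Qed.

(** Fourier inversion applied to [eabs y], whose transform is 2 pi [Pois y]. It says that the
    Poisson mean of a character at height y is the character damped by e^(-y|s|). *)
Lemma chk_Pois (y s : R) : 0 < y ->
  cint setT (fun w => rC (Pois y w) * ei (w * s)) = eabs y s.
Proof.
move=> y0.
have E u : chk (eabs y) (- u) = rC (2 * pi) * rC (Pois y u).
  by rewrite /chk cint_eabs_ei// PoisN rCM.
have := @fourier_inversion (eabs y) 1 s (cintegrable_eabs y0) (fun x => cabs_eabs_le1 x (ltW y0))
  (@ccont_eabs y s).
have -> : (fun u => chk (eabs y) (- u)) = (fun u => rC (2 * pi) * rC (Pois y u)).
  by apply/funext => u; exact: E.
move=> /(_ (cintegrableZ _ measurableT (cintegrable_Pois y0))).
have p0 : rC (2 * pi) != 0 :> C.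
  by rewrite cabs_neq0// cabs_rC normr_eq0 mulf_neq0// gt_eqF// pi_gt0.
move=> h; apply: (mulfI p0); rewrite -h -cintZ//; first by apply: eq_cint => u _; rewrite E mulrA.
by apply: (cintegrable_mulb _ (cintegrable_Pois y0) (cmeas_ei_mul s)) => // x _; rewrite cabs_ei.
Qed.

End poisson.

(** * Functions vanishing at infinity *)

Section C0_functions.
Context {R : realType}.
Local Notation C := (complex R).
Implicit Types f : R -> C.

Lemma is_C0_ccont f : is_C0 f -> ccont f. Proof. by case. Qed.

Lemma is_C0_tail f (e : R) : is_C0 f -> 0 < e ->
  exists2 A, 0 < A & forall x, A <= `|x| -> cabs (f x) <= e.
Proof.
move=> [_ [fp fn]] e0.
move/cvgrPdist_le : fp => /(_ e e0) [M1 [_ h1]].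
move/cvgrPdist_le : fn => /(_ e e0) [M2 [_ h2]].
exists (`|M1| + `|M2| + 1); first by rewrite ltr_wpDl ?addr_ge0.
move=> x; have [x0|x0] := leP 0 x.
  rewrite [`|x|]ger0_norm// => Ax; have : M1 < x.
    by have := ler_norm M1; have := normr_ge0 M2; lra.
  by move=> /h1; rewrite /= sub0r normrN ger0_norm ?cabs_ge0.
rewrite [`|x|]ltr0_norm// => Ax; have : x < M2.
  by have := ler_norm (- M2); rewrite normrN; have := normr_ge0 M1; lra.
by move=> /h2; rewrite /= sub0r normrN ger0_norm ?cabs_ge0.
Qed.

Lemma is_C0P f : ccont f -> (forall e, 0 < e ->
  exists A, forall x, A <= `|x| -> cabs (f x) <= e) -> is_C0 f.
Proof.
move=> cf h; split => //; split; apply/cvgrPdist_le => e /h [A hA].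
  exists `|A|; split; first by rewrite num_real.
  move=> x Ax; rewrite /= sub0r normrN ger0_norm ?cabs_ge0// hA//.
  by rewrite (le_trans (ler_norm _))// (le_trans (ltW Ax))// ler_norm.
exists (- `|A|); split; first by rewrite num_real.
move=> x Ax; rewrite /= sub0r normrN ger0_norm ?cabs_ge0// hA//.
by have := ler_norm A; have := ler_norm (- x); rewrite normrN; lra.
Qed.

Lemma continuous_cabs f : ccont f -> continuous (fun x => cabs (f x)).
Proof.
move=> cf x; apply/cvgrPdist_le => e e0; move/cvgrPdist_le : (cf x) => /(_ e e0).
apply: filterS => y; rewrite sub0r normrN ger0_norm ?cabs_ge0//; apply: le_trans.
rewrite ler_norml; apply/andP; split.
  by rewrite lerNl opprB lerBlDr -{1}(subrK (f x) (f y)) cabsD.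
by rewrite lerBlDr cabs_distC -{1}(subrK (f y) (f x)) cabsD.
Qed.

Lemma is_C0_bounded f : is_C0 f -> exists K, forall x, cabs (f x) <= K.
Proof.
move=> hf; have [A A0 hA] := is_C0_tail hf ltr01.
have cf := continuous_cabs (is_C0_ccont hf).
have [c _ hc] := @EVT_max R (fun x => cabs (f x)) (- A) A ltac:(lra) (continuous_subspaceT cf).
exists (Num.max 1 (cabs (f c))) => x; rewrite le_max.
have [/hA ->//|xA] := leP A `|x|; rewrite hc ?orbT// in_itv /=.
by rewrite -ler_norml ltW.
Qed.

Lemma supnorm_ub f K : (forall x, cabs (f x) <= K) -> forall x, cabs (f x) <= supnorm f.
Proof.
move=> hK x; apply: ub_le_sup; last by exists x.
by exists K => _ [y _ <-].
Qed.

Lemma supnorm_le f K : (forall x, cabs (f x) <= K) -> supnorm f <= K.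
Proof.
by move=> hK; apply: ge_sup => [|_ [y _ <-]//]; exists (cabs (f 0)), 0.
Qed.

Lemma supnorm_ge0 f : is_C0 f -> 0 <= supnorm f.
Proof. by move=> /is_C0_bounded[K hK]; exact: le_trans (cabs_ge0 _) (supnorm_ub hK 0). Qed.

Lemma cabs_C0 f x : is_C0 f -> cabs (f x) <= supnorm f.
Proof. by move=> /is_C0_bounded[K hK]; exact: supnorm_ub hK _. Qed.

Lemma ccontD f g : ccont f -> ccont g -> ccont (fun x => f x + g x).
Proof.
move=> cf cg; apply: ccontP => x.
  under eq_fun do rewrite ReD; by apply: cvgD; [exact: ccont_Re|exact: ccont_Re].
under eq_fun do rewrite ImD; by apply: cvgD; [exact: ccont_Im|exact: ccont_Im].
Qed.

Lemma ccontN f : ccont f -> ccont (fun x => - f x).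
Proof.
move=> cf; apply: ccontP => x.
  by under eq_fun do rewrite ReN; apply: cvgN; exact: ccont_Re.
by under eq_fun do rewrite ImN; apply: cvgN; exact: ccont_Im.
Qed.

Lemma ccontM f g : ccont f -> ccont g -> ccont (fun x => f x * g x).
Proof.
move=> cf cg; apply: ccontP => x.
  under eq_fun do rewrite ReM.
  by apply: cvgB; apply: cvgM; try exact: ccont_Re; exact: ccont_Im.
under eq_fun do rewrite ImM.
by apply: cvgD; apply: cvgM; try exact: ccont_Re; exact: ccont_Im.
Qed.

Lemma is_C0B f g : is_C0 f -> is_C0 g -> is_C0 (fun x => f x - g x).
Proof.
move=> hf hg; apply: is_C0P.
  by apply: ccontD; [exact: is_C0_ccont|apply: ccontN; exact: is_C0_ccont].
move=> e e0; have e20 : 0 < e / 2 by rewrite divr_gt0.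
have [A A0 hA] := is_C0_tail hf e20; have [B B0 hB] := is_C0_tail hg e20.
exists (A + B) => x ABx; rewrite (le_trans (cabsB _ _))// [leRHS]splitr lerD//.
  by rewrite hA// (le_trans _ ABx)// lerDl ltW.
by rewrite hB// (le_trans _ ABx)// lerDr ltW.
Qed.

Lemma is_C00 : is_C0 (fun=> 0 : C).
Proof.
apply: is_C0P => [|e e0]; last by exists 0 => x _; rewrite cabs0 ltW.
by apply: ccontP => x; exact: cvg_cst.
Qed.

Lemma uniform_continuity f (A e : R) : ccont f -> (forall x, A <= `|x| -> f x = 0) -> 0 < e ->
  exists2 d, 0 < d & forall x w, `|w| < d -> cabs (f (x + w) - f x) <= e.
Proof.
move=> cf fA e0.
pose P (d x : R) := forall w, `|w| < d -> cabs (f (x + w) - f x) <= e.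
have /compact_near_coveringP cov := @segment_compact R (- (`|A| + 1)) (`|A| + 1).
have : \forall d \near 0^'+, `[- (`|A| + 1), `|A| + 1]%classic `<=` P d.
  apply: cov => x _.
  have e20 : 0 < e / 2 by rewrite divr_gt0.
  move/cvgrPdist_le : (cf x) => /(_ _ e20) [d /= d0 hd].
  exists (ball x (d / 2), [set r | 0 < r < d / 2]).
    split => /=; first by apply: nbhsx_ballx; rewrite divr_gt0.
    exists (d / 2) => /=; first by rewrite divr_gt0.
    by move=> r /=; rewrite sub0r normrN => rd r0; rewrite r0 (le_lt_trans (ler_norm _)).
  move=> [x' r] [/= xx' /andP[r0 rd]] w wr.
  have h y : `|x - y| < d -> cabs (f y - f x) <= e / 2.
    by move=> /hd; rewrite /= sub0r normrN ger0_norm ?cabs_ge0.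
  rewrite /ball /= in xx'.
  have -> : f (x' + w) - f x' = (f (x' + w) - f x) - (f x' - f x) by ring.
  rewrite (le_trans (cabsB _ _))// [leRHS]splitr lerD//; apply: h.
    rewrite opprD addrA (le_lt_trans (ler_normB _ _))// [ltRHS]splitr ltrD//.
    exact: lt_trans wr rd.
  by rewrite (lt_trans xx')// ltr_pdivrMr// ltr_pMr// ltr1n.
(* A shift by less than 1 that starts outside the enlarged interval stays where f vanishes, so
   compactness is needed only inside. *)
move=> [d /= d0 hd]; pose d' := Num.min (d / 2) 1.
have d'0 : 0 < d' by rewrite lt_min ltr01 divr_gt0.
exists d' => // x w wd.
have [xA|xA] := leP `|x| (`|A| + 1).
  apply: (hd d') => //=.
    rewrite sub0r normrN gtr0_norm// (le_lt_trans (_ : _ <= d / 2))//.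
      by rewrite ge_min lexx.
    by rewrite ltr_pdivrMr// ltr_pMr// ltr1n.
  by rewrite in_itv /= -ler_norml.
rewrite !fA ?subrr ?cabs0 ?ltW//.
  by rewrite (le_lt_trans (ler_norm _))// (lt_trans _ xA)// ltrDl.
have : `|w| < 1 by rewrite (lt_le_trans wd)// ge_min lexx orbT.
have := ler_norm A; have := lerB_normD x w; lra.
Qed.

End C0_functions.

(** * Approximation in C_0 by transforms of integrable functions *)

Section approximation.
Context {R : realType}.
Local Notation C := (complex R).
Local Notation mu := (@lebesgue_measure R).
Implicit Types f h : R -> C.

Lemma pi2_neq0 : rC (2 * pi) != 0 :> C.
Proof. by rewrite cabs_neq0// cabs_rC normr_eq0 mulf_neq0// gt_eqF// pi_gt0. Qed.

Lemma cmeas_fourier h : cmeas setT h -> cmeas setT (fourier h).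
Proof.
move=> mh; apply: cmeas_ext (cmeas_opp (cmeas_chk mh)) => u _.
by rewrite fourier_chk.
Qed.

Lemma cabs_fourier h u : cintegrable setT h -> cabs (fourier h u) <= L1norm h.
Proof. by move=> hi; rewrite fourier_chk cabs_chk. Qed.

Lemma cintegrable_compact f (A : R) : ccont f -> (forall u, A <= `|u| -> f u = 0) ->
  cintegrable setT f.
Proof.
move=> cf fA.
have [K hK] : exists K, forall x, cabs (f x) <= K.
  by apply: is_C0_bounded; apply: is_C0P => // e e0; exists A => x /fA ->; rewrite cabs0 ltW.
have K0 : 0 <= K by exact: le_trans (cabs_ge0 _) (hK 0).
(* On |u| < A the kernel [Pois 1] is at least 1 / (pi (A^2 + 1)), so c [Pois 1] is an integrable
   majorant. *)
pose c := K * (pi * (A ^+ 2 + 1)).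
have c0 : 0 <= c by rewrite !mulr_ge0 ?pi_ge0// addr_ge0 ?sqr_ge0.
apply: (@cintegrable_le _ _ _ (fun u => c * Pois 1 u)) => //.
- exact: cmeas_ccont.
- by apply: lintegrableZ => //; exact: integrable_Pois.
move=> u _; have [/fA ->|uA] := leP A `|u|.
  by rewrite cabs0 mulr_ge0 ?Pois_ge0.
rewrite (le_trans (hK u))// /c /Pois mul1r expr1n -mulrA ler_peMr// ler_pdivlMr; last first.
  by rewrite mulr_gt0 ?pi_gt0// ltr_wpDl ?sqr_ge0.
rewrite mul1r ler_wpM2l ?pi_ge0// lerD2r -(real_normK (num_real u)) ler_pXn2r ?nnegrE// ltW//.
by rewrite (le_lt_trans _ uA).
Qed.

(** The Abel-damped transform of [f0]: the damping makes it integrable, and [chk] returns the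
    Poisson mean of [f0] at height y. *)
Definition gab (f0 : R -> C) (y t : R) : C := rC (2 * pi)^-1 * (fourier f0 t * eabs y t).

Lemma cintegrable_gab f0 y : cintegrable setT f0 -> 0 < y -> cintegrable setT (gab f0 y).
Proof.
move=> fi y0; apply: cintegrableZ => //.
apply: (cintegrable_bmul (K := L1norm f0) _ (cintegrable_eabs y0)) => //.
  by apply: cmeas_fourier; exact: cintegrable_meas.
by move=> x _; exact: cabs_fourier.
Qed.

Lemma chk_gab f0 y x : cintegrable setT f0 -> 0 < y ->
  chk (gab f0 y) x = cint setT (fun w => rC (Pois y w) * f0 (x + w)).
Proof.
move=> fi y0; apply: (mulfI pi2_neq0); rewrite -chk_abel// /chk -cintZ//; last first.
  apply: (cintegrable_mulb _ (cintegrable_gab fi y0) (cmeas_ei_mul x)) => // t _.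
  by rewrite cabs_ei.
apply: eq_cint => t _; rewrite /gab -!mulrA mulrA -rCM divff ?rC1 ?mul1r ?fourier_chk ?mulrA//.
by rewrite mulf_neq0// gt_eqF// pi_gt0.
Qed.

Definition cut (A u : R) : R := Num.max 0 (Num.min 1 (A - `|u|)).

Lemma cut_ge0 A u : 0 <= cut A u. Proof. by rewrite le_max lexx. Qed.
Lemma cut_le1 A u : cut A u <= 1. Proof. by rewrite ge_max ler01 ge_min lexx. Qed.
Lemma cut_out A u : A <= `|u| -> cut A u = 0.
Proof. by move=> Au; rewrite /cut max_l// ge_min subr_le0 Au orbT. Qed.
Lemma cut_in A u : `|u| <= A - 1 -> cut A u = 1.
Proof.
by move=> Au; rewrite /cut min_l ?max_r//; have := Au; lra.
Qed.
Lemma continuous_cut A : continuous (cut A).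
Proof.
move=> u; apply: (@continuous_max _ _ (fun=> 0) (fun u => Num.min 1 (A - `|u|)) u); first exact: cvg_cst.
apply: (@continuous_min _ _ (fun=> 1) (fun u => A - `|u|) u); first exact: cvg_cst.
by apply: cvgB; [exact: cvg_cst|exact: norm_continuous].
Qed.

(* Truncating f and convolving with a Poisson kernel approximates f uniformly by inverse
   Fourier transforms of integrable functions. *)
Lemma C0_approx f (e : R) : is_C0 f -> 0 < e ->
  exists f0 A y, [/\ ccont f0, (forall u, A <= `|u| -> f0 u = 0),
    (forall u, cabs (f0 u) <= supnorm f), 0 < y & is_C0 (chk (gab f0 y)) /\
    forall x, cabs (f x - chk (gab f0 y) x) <= e].
Proof.
move=> hf e0; have e30 : 0 < e / 3 by rewrite divr_gt0.
have [A0 A00 hA0] := is_C0_tail hf e30.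
pose A := A0 + 1; pose f0 u := rC (cut A u) * f u.
have cf := is_C0_ccont hf.
have cf0 : ccont f0.
  by apply: ccontM => //; apply: ccontP => x /=; [exact: continuous_cut|exact: cvg_cst].
have f0A u : A <= `|u| -> f0 u = 0 by move=> uA; rewrite /f0 cut_out// rC0 mul0r.
have f0S u : cabs (f0 u) <= supnorm f.
  rewrite cabsM cabs_rC ger0_norm ?cut_ge0// (le_trans _ (cabs_C0 u hf))//.
  by rewrite ler_piMl ?cabs_ge0 ?cut_le1.
have f0f u : cabs (f u - f0 u) <= e / 3.
  have [uA|uA] := leP `|u| A0.
    have c1 : cut A u = 1 by apply: cut_in; rewrite /A addrK.
    by rewrite /f0 c1 rC1 mul1r subrr cabs0 ltW.
  rewrite /f0 -{1}(mul1r (f u)) -mulrBl cabsM (le_trans _ (hA0 _ (ltW uA)))//.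
  rewrite ler_piMl ?cabs_ge0// -rC1 -rCN -rCD cabs_rC.
  by rewrite ger0_norm ?subr_ge0 ?cut_le1// lerBlDr lerDl cut_ge0.
have i0 := cintegrable_compact cf0 f0A.
have [d d0 hd] := uniform_continuity cf0 f0A e30.
have S0 := supnorm_ge0 hf.
(* The error e is split into thirds for the truncation, the modulus of continuity and the Poisson
   tail; y = e / (3 c) brings the tail below its share. *)
pose c := 2 * supnorm f * (1 + d ^- 2) + 1.
have c0 : 0 < c by rewrite ltr_wpDl// !mulr_ge0// addr_ge0// invr_ge0 sqr_ge0.
pose y := e / 3 / c; have y0 : 0 < y by rewrite divr_gt0.
exists f0, A, y; split => //.
have E x : chk (gab f0 y) x = cint setT (fun w => rC (Pois y w) * f0 (x + w)) by exact: chk_gab.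
have m0 := cmeas_ccont cf0.
have msh x : cmeas setT (fun w => f0 (x + w)).
  by apply: cmeas_ext (cmeas_shift x m0) => w _; rewrite addrC.
have iP := cintegrable_Pois y0.
have ish x : cintegrable setT (fun w => rC (Pois y w) * f0 (x + w)).
  by apply: (cintegrable_mulb _ iP (msh x)) => // w _; exact: f0S.
split; last first.
  move=> x; rewrite E.
  have := @approx_identity _ f0 (supnorm f) (e / 3) d y x m0 f0S d0 y0 (ltW e30) (hd x).
  have h2 : 2 * supnorm f * (y * (1 + d ^- 2)) <= e / 3.
    have -> : e / 3 = y * c by rewrite /y divfK ?gt_eqF.
    by rewrite mulrCA ler_wpM2l ?(ltW y0)// lerDl.
  move=> h1; have := f0f x => h0.
  set I := cint _ _ in h1 *.
  have -> : f x - I = (f x - f0 x) - (I - f0 x) by ring.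
  by rewrite (le_trans (cabsB _ _))//; lra.
apply: is_C0P.
  move=> x; apply/cvgrPdist_le => t t0.
  have [d' d'0 hd'] := uniform_continuity cf0 f0A t0.
  near=> x'; rewrite sub0r normrN ger0_norm ?cabs_ge0// !E -cintB//.
  have -> : t = Rintegral mu setT (fun w => t * Pois y w).
    by rewrite (@RintegralZl _ _ _ mu setT (Pois y) t)// ?Rintegral_Pois ?mulr1//; exact: integrable_Pois.
  apply: cabs_cint_le => //.
  - by apply: cmeasB; exact: cintegrable_meas.
  - by apply: lintegrableZ => //; exact: integrable_Pois.
  move=> w _; rewrite -mulrBr cabsM cabs_rC ger0_norm ?Pois_ge0// mulrC ler_wpM2r ?Pois_ge0//.
  have -> : x' + w = (x + w) + (x' - x) by ring.
  apply: hd'; rewrite distrC; near: x'.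
  by exists d'.
move=> t t0.
(* Below, [D] bounds from below the distance from x to the support of [f0], where the kernel is at
   most y / (pi D^2). Then D >= 1 and D >= B / t make the mean at most t. *)
pose B := L1norm f0 * (y / pi) + 1.
have B0 : 0 < B by rewrite ltr_wpDl// mulr_ge0 ?L1norm_ge0// divr_ge0 ?pi_ge0// ltW.
exists (`|A| + 1 + B / t) => x hx; rewrite E.
pose D := `|x| - `|A|.
have Bt0 : 0 < B / t by rewrite divr_gt0.
have D1 : 1 <= D by rewrite /D; lra.
have DB : B / t <= D by rewrite /D; lra.
have D0 : 0 < D by lra.
have -> : cint setT (fun w => rC (Pois y w) * f0 (x + w)) = cint setT (fun s => f0 s * rC (Pois y (s - x))).
  have mg : cmeas setT (fun s => f0 s * rC (Pois y (s - x))).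
    by apply: cmeasM => //; have := cmeas_shift (- x) (cintegrable_meas iP).
  rewrite -(cint_shift x mg); apply: eq_cint => w _.
  by rewrite addrK mulrC addrC.
apply: (@le_trans _ _ (y / pi / D ^+ 2 * L1norm f0)).
  rewrite /L1norm -RintegralZl//; last exact: integrable_cabs.
  apply: cabs_cint_le => //.
  - by apply: cmeasM => //; have := cmeas_shift (- x) (cintegrable_meas iP).
  - exact: (lintegrableZ _ measurableT (integrable_cabs measurableT i0)).
  move=> s _; have [/f0A ->|sA] := leP A `|s|; first by rewrite mul0r !cabs0 mulr0.
  rewrite cabsM mulrC ler_wpM2r ?cabs_ge0// cabs_rC ger0_norm ?Pois_ge0//.
  have sx : D <= `|s - x|.
    have := ler_norm A; have := lerB_normD (s - x) (- s); rewrite addrAC subrr add0r !normrN /D.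
    have := lerB_dist x s; rewrite distrC; lra.
  have D2 : D ^+ 2 <= (s - x) ^+ 2.
    by rewrite -(real_normK (num_real (s - x))) ler_pXn2r ?nnegrE// ltW.
  have D20 : 0 < D ^+ 2 by rewrite exprn_gt0.
  have DD : D ^+ 2 <= (s - x) ^+ 2 + y ^+ 2 by rewrite (le_trans D2)// lerDl sqr_ge0.
  have -> : Pois y (s - x) = y / pi * ((s - x) ^+ 2 + y ^+ 2)^-1 by rewrite /Pois invfM mulrA.
  rewrite ler_wpM2l//; first by rewrite divr_ge0 ?pi_ge0// ltW.
  by rewrite lef_pV2 ?posrE// (lt_le_trans D20).
rewrite mulrC mulrA ler_pdivrMr ?exprn_gt0//.
apply: (@le_trans _ _ B); first by rewrite lerDl.
move: DB; rewrite ler_pdivrMr// mulrC => /le_trans; apply.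
by rewrite ler_wpM2l ?(ltW t0)// expr2 ler_peMr// ltW.
Unshelve. all: by end_near. Qed.

End approximation.

(** * The algebra A_0 *)

Section A0_algebra.
Context {R : realType}.
Local Notation C := (complex R).
Local Notation Re := complex.Re.
Local Notation Im := complex.Im.
Local Notation conv := Defs.conv.
Implicit Types f h F : R -> C.

Lemma convC f h x : conv f h x = cint setT (fun t => h t * f (x - t)).
Proof. by apply: eq_cint => t _; rewrite mulrC. Qed.

Lemma jmeas_sub f : cmeas setT f -> jmeas (fun z : R * R => f (z.1 - z.2)).
Proof. by move=> mf; apply: (jmeas_comp mf); exact: measurable_funB. Qed.

Lemma cmeas_conv f h : cmeas setT f -> cmeas setT h -> cmeas setT (conv f h).
Proof.
move=> mf mh; apply: cmeas_ext (cmeas_cint_kernel mh (jmeas_sub mf)) => x _.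
by rewrite convC.
Qed.

Lemma cmeas_reflect f x : cmeas setT f -> cmeas setT (fun t => f (x - t)).
Proof. by move=> mf; exact: (jmeas_section1 x (jmeas_sub mf)). Qed.

Lemma cabs_conv f h K x : cmeas setT f -> (forall t, cabs (f t) <= K) -> cintegrable setT h ->
  cabs (conv f h x) <= K * L1norm h.
Proof.
move=> mf fK hi; rewrite convC; apply: cabs_cint_mulb => //.
exact: cmeas_reflect.
Qed.

Lemma cabs_conv_C0 f h x : is_C0 f -> cintegrable setT h ->
  cabs (conv f h x) <= supnorm f * L1norm h.
Proof.
move=> hf hi; apply: cabs_conv => //; first exact/cmeas_ccont/is_C0_ccont.
by move=> t; exact: cabs_C0.
Qed.

Lemma convB f g h x : is_C0 f -> is_C0 g -> cintegrable setT h ->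
  conv (fun t => f t - g t) h x = conv f h x - conv g h x.
Proof.
move=> hf hg hi; rewrite !convC -cintB//.
- by apply: eq_cint => t _; rewrite mulrBr.
- apply: (cintegrable_mulb (K := supnorm f)) => //.
    by apply: cmeas_reflect; exact/cmeas_ccont/is_C0_ccont.
  by move=> t _; exact: cabs_C0.
- apply: (cintegrable_mulb (K := supnorm g)) => //.
    by apply: cmeas_reflect; exact/cmeas_ccont/is_C0_ccont.
  by move=> t _; exact: cabs_C0.
Qed.

Lemma conv0 h x : conv (fun=> 0) h x = 0.
Proof. by rewrite convC -[RHS](cint0 setT); apply: eq_cint => t _; rewrite mulr0. Qed.

(** For h in H^1 the weight on the right lives on the positive half-line, so such a convolution is
    the boundary function of a Laplace transform. *)
Lemma conv_chk (g h : R -> C) x : cintegrable setT g -> cintegrable setT h ->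
  conv (chk g) h x = chk (fun s => g s * fourier h s) x.
Proof.
move=> gi hi; rewrite convC.
have mk : jmeas (fun z : R * R => ei (z.2 * (x - z.1))).
  apply: jmeas_ei; apply: measurable_funM => //; apply: measurable_funB => //; exact: measurable_cst.
have bk (z : R * R) : cabs (ei (z.2 * (x - z.1))) <= 1 by rewrite cabs_ei.
rewrite (cint_fubini hi gi mk bk) /chk; apply: eq_cint => s _ /=.
rewrite -[RHS]mulrA; congr (_ * _); rewrite /fourier -cintZr//.
  apply: eq_cint => t _; rewrite -mulrA; congr (_ * _); rewrite -/(ei _) -eiD; congr ei; ring.
have := cmeas_ei_mul (- s) => m1.
have m2 : cmeas setT (fun t => ei (- (t * s))).
  by apply: cmeas_ext m1 => t _; rewrite mulrN.
by apply: (cintegrable_mulb _ hi m2) => // t _; rewrite cabs_ei.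
Qed.

Lemma cintegrable_mul_fourier (g h : R -> C) : cintegrable setT g -> cintegrable setT h ->
  cintegrable setT (fun s => g s * fourier h s).
Proof.
move=> gi hi; apply: (cintegrable_mulb _ gi (cmeas_fourier (cintegrable_meas hi))) => // s _.
exact: cabs_fourier.
Qed.

Lemma nneg_series_le (a : nat -> R) (S : R) n : (forall k, 0 <= a k) ->
  series a m @[m --> \oo] --> S -> series a n <= S.
Proof.
move=> a0 cS; have nd : {homo series a : m n / (m <= n)%N >-> m <= n}.
  by apply/nondecreasing_seqP => m; rewrite -subr_ge0 seriesSB.
rewrite -(cvg_lim _ cS)//; apply: nondecreasing_cvgn_le => //.
by apply/cvg_ex; exists S.
Qed.

Lemma A0_terms_ge0 f h : is_C0 f -> 0 <= supnorm f * L1norm h.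
Proof. by move=> hf; rewrite mulr_ge0 ?supnorm_ge0 ?L1norm_ge0. Qed.

Section rep.
Variables (F : R -> C) (f h : nat -> R -> C) (S : R).
Hypothesis rep : A0_rep F f h S.

Let hf k : is_C0 (f k). Proof. by case: rep => + _; apply. Qed.
Let hh k : is_H1 (h k). Proof. by case: rep => _ [+ _]; apply. Qed.
Let hi k : cintegrable setT (h k). Proof. by case: (hh k). Qed.
Let cS : series (fun k => supnorm (f k) * L1norm (h k)) n @[n --> \oo] --> S.
Proof. by case: rep => _ [_ [+ _]]; exact. Qed.
Let cF x : ccvg (fun n => \sum_(0 <= k < n) conv (f k) (h k) x) (F x).
Proof. by case: rep => _ [_ [_ +]]; apply. Qed.

Lemma A0_rep_partial n x : cabs (\sum_(0 <= k < n) conv (f k) (h k) x) <= S.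
Proof.
rewrite (le_trans (cabs_sum _ _ _))//.
apply: (@le_trans _ _ (series (fun k => supnorm (f k) * L1norm (h k)) n)).
  by apply: ler_sum => k _; exact: cabs_conv_C0.
by apply: nneg_series_le => // k; exact: A0_terms_ge0.
Qed.

Lemma A0_rep_ge0 : 0 <= S.
Proof. exact: le_trans (cabs_ge0 _) (A0_rep_partial 0 0). Qed.

Lemma A0_rep_bound x : cabs (F x) <= S.
Proof.
apply/ler_addgt0Pl => e e0; have /ccvg_epsP/(_ e e0)[N /(_ N (leqnn N)) hN] := cF x.
rewrite -(subrK (\sum_(0 <= k < N) conv (f k) (h k) x) (F x)) (le_trans (cabsD _ _))// lerD//.
  by rewrite cabs_distC.
exact: A0_rep_partial.
Qed.

Lemma cmeas_conv_rep k : cmeas setT (conv (f k) (h k)).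
Proof.
apply: cmeas_conv; first by apply: cmeas_ccont; exact: is_C0_ccont.
by apply: cintegrable_meas; exact: hi.
Qed.

Lemma A0_rep_meas : cmeas setT F.
Proof.
have mn n : cmeas setT (fun x => \sum_(0 <= k < n) conv (f k) (h k) x).
  by apply: cmeas_sum => k; exact: cmeas_conv_rep.
split.
- apply: (@measurable_fun_cvg _ _ R setT (fun n x => Re (\sum_(0 <= k < n) conv (f k) (h k) x))).
  + by move=> n; have [] := mn n.
  + by move=> x _; have /ccvgP[] := cF x.
- apply: (@measurable_fun_cvg _ _ R setT (fun n x => Im (\sum_(0 <= k < n) conv (f k) (h k) x))).
  + by move=> n; have [] := mn n.
  + by move=> x _; have /ccvgP[] := cF x.
Qed.

(** All partial sums are bounded by S, so S |M| dominates and the series may be integrated term by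
    term. *)
Lemma A0_rep_pairing (M : R -> C) : cintegrable setT M ->
  ccvg (fun n => \sum_(0 <= k < n) cint setT (fun u => M u * conv (f k) (h k) u))
    (cint setT (fun u => M u * F u)).
Proof.
move=> Mi; have mM := cintegrable_meas Mi.
have ik k : cintegrable setT (fun u => M u * conv (f k) (h k) u).
  apply: (cintegrable_mulb _ Mi (cmeas_conv_rep k)) => // u _.
  exact: cabs_conv_C0.
have E n : \sum_(0 <= k < n) cint setT (fun u => M u * conv (f k) (h k) u) =
    cint setT (fun u => M u * \sum_(0 <= k < n) conv (f k) (h k) u).
  by rewrite -cint_sum//; apply: eq_cint => u _; rewrite mulr_sumr.
rewrite (_ : (fun n => _) = (fun n => cint setT (fun u => M u * \sum_(0 <= k < n) conv (f k) (h k) u))); last first.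
  by apply/funext.
apply: (@cint_dominated _ _ _ _ (fun u => S * cabs (M u))) => //.
- by move=> n; apply: cmeasM => //; apply: cmeas_sum => k; exact: cmeas_conv_rep.
- by apply: cmeasM => //; exact: A0_rep_meas.
- exact: (lintegrableZ _ measurableT (integrable_cabs measurableT Mi)).
- by move=> n u _; rewrite cabsM mulrC ler_wpM2r ?cabs_ge0// A0_rep_partial.
- move=> u _; apply/ccvg_epsP => e e0; pose c := cabs (M u) + 1.
  have c0 : 0 < c by rewrite ltr_wpDl ?cabs_ge0.
  have /ccvg_epsP/(_ (e / c))[|N hN] := cF u; first by rewrite divr_gt0.
  exists N => n /hN {}hN; rewrite -mulrBr cabsM (le_trans (ler_wpM2l _ hN)) ?cabs_ge0//.
  by rewrite mulrA ler_pdivrMr// mulrC ler_wpM2l ?(ltW e0)// lerDl.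
Qed.

(** The series is cut at K, where the tail is at most e / 2, and each remaining f_k is replaced by
    an inverse transform. By [conv_chk] the finite sum is [chk b], with b vanishing on t < 0 because
    the h_k lie in H^1. The difference comes with its own representation, so closeness is in the
    norm of A_0. *)
Lemma A0_rep_density (e : R) : 0 < e -> exists b : R -> C,
  [/\ cintegrable setT b, (forall t, t < 0 -> b t = 0), in_A0R (chk b) &
  exists (f' h' : nat -> R -> C) (S' : R), A0_rep (fun x => F x - chk b x) f' h' S' /\ S' <= e].
Proof.
move=> e0; have e20 : 0 < e / 2 by rewrite divr_gt0.
pose a k := supnorm (f k) * L1norm (h k).
move/cvgrPdist_le : (cS) => /(_ _ e20) [K _ /(_ K (leqnn K))].
rewrite -/a => tailK.
have SK : S - series a K <= e / 2 by exact: le_trans (ler_norm _) tailK.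
(* Each of the K replaced terms then costs at most e / 2 / (K + 1); the summands 1 keep the
   denominator positive. *)
pose eta k : R := e / 2 / (K.+1%:R * (L1norm (h k) + 1)).
have L1p k : 0 < L1norm (h k) + 1 by rewrite ltr_wpDl ?L1norm_ge0.
have eta0 k : 0 < eta k by rewrite divr_gt0// mulr_gt0.
have /choice[gk hgk] k : exists g : R -> C, [/\ cintegrable setT g, is_C0 (chk g) &
    forall x, cabs (f k x - chk g x) <= eta k].
  have [f0 [A [y [cf0 f0A _ y0 [h1 h2]]]]] := C0_approx (hf k) (eta0 k).
  exists (gab f0 y); split => //; apply: cintegrable_gab => //.
  exact: cintegrable_compact cf0 f0A.
pose f1 k := if (k < K)%N then chk (gk k) else (fun=> 0).
pose b t := \sum_(0 <= k < K) gk k t * fourier (h k) t.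
have bk_i k : cintegrable setT (fun t => gk k t * fourier (h k) t).
  by apply: cintegrable_mul_fourier => //; case: (hgk k).
have hf1 k : is_C0 (f1 k) by rewrite /f1; case: ifP => _; [case: (hgk k)|exact: is_C00].
have chkb x : chk b x = \sum_(0 <= k < K) conv (f1 k) (h k) x.
  transitivity (\sum_(0 <= k < K) chk (fun t => gk k t * fourier (h k) t) x).
    rewrite /chk -cint_sum//; last first.
      move=> k; apply: (cintegrable_mulb _ (bk_i k) (cmeas_ei_mul x)) => // t _.
      by rewrite cabs_ei.
    by apply: eq_cint => t _; rewrite /b mulr_suml.
  apply: eq_big_nat => k /andP[_ kK]; rewrite /f1 kK conv_chk//.
  by case: (hgk k).
have chkb' n x : (K <= n)%N -> \sum_(0 <= k < n) conv (f1 k) (h k) x = chk b x.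
  move=> Kn; rewrite (big_cat_nat (leq0n K) Kn)//= -chkb big_nat big1 ?addr0// => k /andP[Kk _].
  by rewrite /f1 ltnNge Kk /= conv0.
exists b; split.
- exact: cintegrable_sum.
- move=> t t0; rewrite /b big1// => k _; have [_ ->] := hh k; rewrite ?mulr0//.
  exact: ltW.
- exists f1, h, (series (fun k => supnorm (f1 k) * L1norm (h k)) K); split => //; split => //; split.
    apply: cvg_near_cst; exists K => // n /= Kn.
    rewrite /series /= (big_cat_nat (leq0n K) Kn)//= [X in _ + X]big_nat [X in _ + X]big1 ?addr0// => k /andP[Kk _].
    rewrite /f1 ltnNge Kk /=.
    suff -> : supnorm (fun=> 0 : C) = 0 :> R by rewrite mul0r.
    apply/eqP; rewrite eq_le supnorm_ge0 ?andbT; last exact: is_C00.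
    by apply: supnorm_le => x; rewrite cabs0.
  move=> x; rewrite /ccvg; apply: cvg_near_cst; exists K => // n /= Kn.
  by rewrite chkb'// subrr cabs0.
pose f2 k x := f k x - f1 k x.
have f2K k : (K <= k)%N -> f2 k = f k.
  by move=> Kk; apply/funext => x; rewrite /f2 /f1 ltnNge Kk /= subr0.
pose a2 k := supnorm (f2 k) * L1norm (h k).
exists f2, h, (series a2 K + (S - series a K)); split; last first.
  rewrite [leRHS]splitr lerD// (@le_trans _ _ (\sum_(0 <= k < K) e / 2 / K.+1%:R))//.
    rewrite /series /= !big_nat; apply: ler_sum => k /andP[_ kK].
    have s2 : supnorm (f2 k) <= eta k.
      by apply: supnorm_le => x; rewrite /f2 /f1 kK; case: (hgk k).
    rewrite /a2 (le_trans (ler_wpM2r (L1norm_ge0 _) s2))//.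
    have -> : eta k * L1norm (h k) = (e / 2 / K.+1%:R) * (L1norm (h k) / (L1norm (h k) + 1)).
      by rewrite /eta invfM; move: (K.+1%:R^-1) => iK; ring.
    rewrite ler_piMr//; first by rewrite divr_ge0// ltW.
    by rewrite ler_pdivrMr// mul1r lerDl.
  rewrite sumr_const_nat subn0 -[_ *+ K]mulr_natr mulrAC -[leLHS]mulrA ler_piMr ?(ltW e20)//.
  by rewrite ler_pdivrMr// mul1r ler_nat.
split; first by move=> k; exact: is_C0B.
split => //; split.
  apply: (@cvg_trans _ (series a2 K + (series a n - series a K) @[n --> \oo])).
    apply: near_eq_cvg; exists K => // n /= Kn.
    rewrite /series /= (big_cat_nat (leq0n K) Kn)//= [in RHS](big_cat_nat (leq0n K) Kn)//=.
    rewrite [X in _ + (X - _)]addrC addrK; congr (_ + _).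
    by rewrite !big_nat; apply: eq_bigr => k /andP[Kk _]; rewrite /a2 f2K.
  by apply: cvgD; [exact: cvg_cst|apply: cvgB; [exact: cS|exact: cvg_cst]].
move=> x; apply/ccvg_epsP => t t0; have /ccvg_epsP/(_ t t0)[N hN] := cF x.
exists (maxn N K) => n; rewrite geq_max => /andP[Nn Kn].
have -> : \sum_(0 <= k < n) conv (f2 k) (h k) x =
    \sum_(0 <= k < n) conv (f k) (h k) x - \sum_(0 <= k < n) conv (f1 k) (h k) x.
  by rewrite -sumrB; apply: eq_bigr => k _; rewrite convB.
rewrite chkb'//.
set u := \sum_(_ <= _ < _) _; have -> : u - chk b x - (F x - chk b x) = u - F x by ring.
exact: hN.
Qed.

End rep.

End A0_algebra.

(** * Poisson extensions to the half-plane and Laplace transforms *)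

Section tilde_laplace.
Context {R : realType}.
Local Notation C := (complex R).
Local Notation Re := complex.Re.
Local Notation Im := complex.Im.
Implicit Types F b : R -> C.

(** The point i z has real part - Im z and imaginary part Re z, which are the centre and the height
    of the kernel. *)
Lemma tildeFE F (z : Cplus R) : tildeF F z =
  cint setT (fun t => F t * rC (Pois (Re (val z)) (- Im (val z) - t))).
Proof.
rewrite /tildeF /poisson_ext; apply: eq_cint => t _; congr (_ * rC _).
by rewrite ReM ImM /= !mul0r !mul1r sub0r add0r.
Qed.

Section fixed_point.
Variable z : Cplus R.
Let x := Re (val z).
Let v := - Im (val z).
Let x0 : 0 < x. Proof. exact: (valP z). Qed.

Let iK : cintegrable setT (fun t => rC (Pois x (v - t))).
Proof.
apply: (@cintegrable_ext _ _ (fun t => rC (Pois x (t + - v)))) => //.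
  by move=> t _; rewrite -PoisN opprB.
exact: (cintegrable_shift (- v) (cintegrable_Pois x0)).
Qed.

Let LK : L1norm (fun t => rC (Pois x (v - t))) = 1.
Proof.
have mP : measurable_fun setT (Pois x) by apply: continuous_measurable_fun; exact: continuous_Pois.
rewrite -(Rintegral_Pois x0) /L1norm -(Rintegral_shift (- v) mP).
apply: eq_Rintegral => t _; rewrite cabs_rC ger0_norm ?Pois_ge0//.
by rewrite -PoisN opprB.
Qed.

Let iF F K : cmeas setT F -> (forall t, cabs (F t) <= K) ->
  cintegrable setT (fun t => F t * rC (Pois x (v - t))).
Proof. by move=> mF FK; apply: (cintegrable_bmul _ iK mF) => // t _; exact: FK. Qed.

Lemma cabs_tildeF F K : cmeas setT F -> (forall t, cabs (F t) <= K) -> cabs (tildeF F z) <= K.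
Proof.
move=> mF FK; rewrite tildeFE (eq_cint (fun t _ => mulrC _ _)) -[leRHS]mulr1 -LK.
exact: cabs_cint_mulb.
Qed.

Lemma tildeFB F G K K' : cmeas setT F -> (forall t, cabs (F t) <= K) ->
  cmeas setT G -> (forall t, cabs (G t) <= K') ->
  tildeF (fun t => F t - G t) z = tildeF F z - tildeF G z.
Proof.
move=> mF FK mG GK; rewrite !tildeFE -cintB//; first by apply: eq_cint => t _; rewrite mulrBl.
  exact: iF FK.
exact: iF GK.
Qed.

Lemma laplaceE b : laplace b z = cint setT (fun t => pos b t * lexp (val z) t).
Proof.
rewrite /laplace cint_pos; apply: eq_cint => t _; rewrite /pos; case: ifP => _; last by rewrite mul0r.
by rewrite mulrC.
Qed.

(** By Fubini it suffices to extend the characters e^(ist). Their Poisson mean carries the factor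
    e^(-x|s|), which for s >= 0 combines with the character to e^(-sz); b vanishes at the other
    s. *)
Lemma tildeF_chk b : cintegrable setT b -> (forall t, t < 0 -> b t = 0) ->
  tildeF (chk b) z = laplace b z.
Proof.
move=> bi b0.
have mk : jmeas (fun p : R * R => ei (p.2 * p.1)).
  by apply: jmeas_ei; exact: measurable_funM.
have bk (p : R * R) : cabs (ei (p.2 * p.1)) <= 1 by rewrite cabs_ei.
rewrite tildeFE (eq_cint (fun t _ => mulrC _ _)) (cint_fubini iK bi mk bk) laplaceE.
apply: eq_cint => s _ /=; rewrite /pos; case: (leP 0 s) => [s0|/b0 ->]; last by rewrite !mul0r.
congr (_ * _).
have mg : cmeas setT (fun t => rC (Pois x (v - t)) * ei (s * t)).
  apply: cmeasM; first exact: cintegrable_meas.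
  by apply: cmeas_ext (cmeas_ei_mul s) => t _; rewrite mulrC.
rewrite -(cint_shift v mg).
transitivity (cint setT (fun w => ei (s * v) * (rC (Pois x w) * ei (w * s)))).
  apply: eq_cint => w _; have -> : v - (w + v) = - w by ring.
  by rewrite PoisN mulrCA -eiD; congr (_ * ei _); ring.
rewrite cintZ//; last first.
  by apply: (cintegrable_mulb _ (cintegrable_Pois x0) (cmeas_ei_mul s)) => // w _; rewrite cabs_ei.
rewrite chk_Pois// lexpE /eabs /ei /cexp /= expR0 !mul1r ger0_norm// /v mulrN [Im _ * s]mulrC.
by apply: complex_eqP; rewrite ?ReM ?ImM /= ?mulr0 ?subr0 ?add0r ?addr0 mulrC.
Qed.

End fixed_point.

(* The point y - iu, at which [tildeF F] is the Poisson integral of F at height y above u. *)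
Definition zpt (y : R) (y0 : 0 < y) (u : R) : Cplus R :=
  exist (fun z : C => 0 < Re z) (Complex y (- u)) y0.

Lemma cmeas_tildeF_zpt F (y : R) (y0 : 0 < y) : cmeas setT F ->
  cmeas setT (fun u => tildeF F (zpt y0 u)).
Proof.
move=> mF; apply: (@cmeas_ext _ _ (fun u => cint setT (fun t => F t * rC (Pois y (u - t))))).
  by move=> u _; rewrite tildeFE /= opprK.
apply: (cmeas_cint_kernel mF (k := fun p : R * R => rC (Pois y (p.1 - p.2)))).
apply: (@jmeas_comp _ (fun w => rC (Pois y w))); last exact: measurable_funB.
exact: cintegrable_meas (cintegrable_Pois y0).
Qed.

Lemma laplace_zpt b (y : R) (y0 : 0 < y) (u : R) :
  laplace b (zpt y0 u) = chk (fun t => pos b t * rC (expR (- (y * t)))) u.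
Proof.
rewrite laplaceE; apply: eq_cint => t _; rewrite -mulrA; congr (_ * _).
rewrite lexpE /ei /cexp /= expR0 !mul1r mulNr opprK [u * t]mulrC.
by apply: complex_eqP; rewrite ?ReM ?ImM /= !mul0r ?subr0 ?addr0.
Qed.

End tilde_laplace.

(** * Multipliers in H^1 *)

Section H1_grid.
Context {R : realType} {H : lmodType (complex R)}.
Variable ip : H -> H -> complex R.
Hypothesis Hip : is_inner_product ip.
Local Notation C := (complex R).
Local Notation nrm := (hnorm ip).
Local Notation mu := (@lebesgue_measure R).

(** The difference n = k - l occurs for N - n pairs. Divided by N these counts are the Fejer
    weights. *)
Lemma triangle_sum (G : nat -> C) N :
  \sum_(k < N) \sum_(l < N) (if (l <= k)%N then G (k - l)%N else 0) =
  \sum_(n < N) (N - n)%:R * G n.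
Proof.
have inner k : (k < N)%N -> \sum_(l < N) (if (l <= k)%N then G (k - l)%N else 0) = \sum_(n < k.+1) G n.
  move=> kN; rewrite -(big_mkord xpredT (fun l => if (l <= k)%N then G (k - l)%N else 0)).
  rewrite (big_cat_nat (leq0n k.+1) kN) /= [X in _ + X]big_nat [X in _ + X]big1 ?addr0; last first.
    by move=> l /andP[kl _]; rewrite leqNgt kl.
  rewrite big_mkord [RHS](reindex_inj rev_ord_inj) /=; apply: eq_bigr => l _.
  by rewrite -ltnS ltn_ord subSS.
under eq_bigr => k _ do rewrite inner//.
elim: N {inner} => [|N IH]; first by rewrite !big_ord0.
rewrite big_ord_recr /= IH big_ord_recr /= [in RHS]big_ord_recr /= subSnn mul1r addrA -big_split /=.
congr (_ + _); apply: eq_bigr => n _.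
by rewrite subSn ?(ltnW (ltn_ord n))// -natr1 mulrDl mul1r.
Qed.

Variables (h : R -> C) (delta r : R) (N : nat).
Hypothesis hH : is_H1 h.
Hypothesis r0 : 0 <= r.
Hypothesis rd : r < delta.
Hypothesis N0 : (0 < N)%N.

Let hi : cintegrable setT h. Proof. by case: hH. Qed.
Let ahi : cintegrable setT (fun t => rC (cabs (h t))).
Proof. by split; [exact: integrable_cabs|exact: integrable0]. Qed.
Let iN : R := N%:R^-1.
Let iN0 : 0 < iN. Proof. by rewrite invr_gt0 ltr0n. Qed.
Let NiN : N%:R * iN = 1. Proof. by rewrite divff// pnatr_eq0 -lt0n. Qed.

(** Samples of the transform of h on a shifted lattice with the Fejer weights 1 - n / N. *)
Definition fejer_poly : {poly C} :=
  \poly_(n < N) (rC ((N - n)%:R * N%:R^-1) * fourier h (n%:R * delta + r)).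

(** The analytic Dirichlet sum at the rotated point; its squared modulus over N is the Fejer
    kernel. *)
Let dir (z : C) (t : R) : C := \sum_(k < N) (z * ei (- (delta * t))) ^+ k.

Let dirE (z : C) (t : R) : dir z t * cconj (dir z t) =
  \sum_(k < N) \sum_(l < N) (z ^+ k * cconj (z ^+ l)) * ei (- (t * ((k%:R - l%:R) * delta))).
Proof.
rewrite /dir cconj_sum mulr_suml; apply: eq_bigr => k _; rewrite mulr_sumr; apply: eq_bigr => l _.
rewrite !exprMn cconjM mulrACA; congr (_ * _).
have E (n : nat) : ei (- (delta * t)) ^+ n = ei (- (n%:R * (delta * t))).
  elim: n => [|n IH]; first by rewrite expr0 mul0r oppr0 ei0.
  by rewrite exprS IH -eiD -natr1; congr ei; ring.
have cE (x : R) : cconj (ei x) = ei (- x).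
  by rewrite /ei cconj_cexp; congr cexp; rewrite /cconj /= .
by rewrite !E cE -eiD; congr ei; ring.
Qed.

Let cabs_dir z t : cabs z = 1 -> cabs (dir z t) <= N%:R.
Proof.
move=> z1; rewrite (le_trans (cabs_sum _ _ _))//.
under eq_bigr do rewrite cabsX cabsM z1 cabs_ei mulr1 expr1n.
by rewrite sumr_const card_ord.
Qed.

Let cmeas_ei_neg (x : R) : cmeas setT (fun t => ei (- (t * x))).
Proof. by apply: cmeas_ext (cmeas_ei_mul (- x)) => t _; rewrite mulrN. Qed.

Let cmeas_dir z : cmeas setT (dir z).
Proof.
apply: cmeas_sum => k.
elim: (nat_of_ord k) => [|n IH]; first by under eq_fun do rewrite expr0; exact: cmeas_cst.
under eq_fun do rewrite exprS; apply: cmeasM => //; apply: cmeasM; first exact: cmeas_cst.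
by apply: cmeas_ext (cmeas_ei_neg delta) => t _; rewrite mulrC.
Qed.

(** The Fejer average of |h|. It is a nonnegative trigonometric polynomial in z of degree N - 1, and
    dominates [fejer_poly], which is the same average of h times a unimodular factor. *)
Let pp (z : C) : R := iN * Rintegral mu setT (fun t => cabs (dir z t) ^+ 2 * cabs (h t)).

Let sum_fourier (g : R -> C) (z : C) : cintegrable setT g -> cabs z = 1 ->
  \sum_(k < N) \sum_(l < N) (z ^+ k * cconj (z ^+ l)) *
     cint setT (fun t => g t * ei (- (t * ((k%:R - l%:R) * delta)))) =
  cint setT (fun t => rC (cabs (dir z t) ^+ 2) * g t).
Proof.
move=> gi z1.
have ikl (k l : 'I_N) : cintegrable setT (fun t => g t * ei (- (t * ((k%:R - l%:R) * delta)))).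
  by apply: (cintegrable_mulb _ gi (cmeas_ei_neg _)) => // t _; rewrite cabs_ei.
have iklz (k l : 'I_N) : cintegrable setT (fun t => (z ^+ k * cconj (z ^+ l)) *
    (g t * ei (- (t * ((k%:R - l%:R) * delta))))) by exact: cintegrableZ.
under eq_bigr => k _ do under eq_bigr => l _ do rewrite -cintZ//.
under eq_bigr => k _ do rewrite -cint_sum//.
rewrite -cint_sum//; last by move=> k; exact: cintegrable_sum.
apply: eq_cint => t _; rewrite -mul_cconj dirE mulr_suml; apply: eq_bigr => k _.
by rewrite mulr_suml; apply: eq_bigr => l _; ring.
Qed.

Let Re_pp z : cabs z = 1 ->
  cint setT (fun t => rC (cabs (dir z t) ^+ 2) * rC (cabs (h t))) = rC (N%:R * pp z).
Proof.
move=> z1; rewrite /pp mulrA NiN mul1r; apply: complex_eqP => /=.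
  by apply: eq_Rintegral => t _; rewrite /= mul0r subr0.
rewrite /Rintegral; under eq_integral do rewrite /= mulr0 mul0r addr0.
by rewrite integral0.
Qed.

Let ipp z : cabs z = 1 -> mu.-integrable setT (EFin \o (fun t => cabs (dir z t) ^+ 2 * cabs (h t))).
Proof.
move=> z1.
have [+ _] : cintegrable setT (fun t => (dir z t * cconj (dir z t)) * rC (cabs (h t))).
  apply: (cintegrable_bmul (K := N%:R ^+ 2) _ ahi) => //.
    apply: cmeasM => //; have [m1 m2] := cmeas_dir z; split => //=.
    exact: measurable_funN.
  move=> t _; rewrite mul_cconj cabs_rC ger0_norm ?sqr_ge0// ler_pXn2r ?nnegrE ?cabs_ge0//.
  exact: cabs_dir.
by apply: eq_lintegrable => // t _; rewrite mul_cconj -rCM.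
Qed.

Let fejer_polyE z : cabs z = 1 -> cabs fejer_poly.[z] <= pp z.
Proof.
move=> z1.
pose hr t := h t * ei (- (t * r)).
have hri : cintegrable setT hr.
  by apply: (cintegrable_mulb _ hi (cmeas_ei_neg _)) => // t _; rewrite cabs_ei.
have E : N%:R * fejer_poly.[z] = cint setT (fun t => rC (cabs (dir z t) ^+ 2) * hr t).
  rewrite -sum_fourier//.
  have Fkl (k l : nat) : cint setT (fun t => hr t * ei (- (t * ((k%:R - l%:R) * delta)))) =
      fourier h ((k%:R - l%:R) * delta + r).
    apply: eq_cint => t _; rewrite /hr -mulrA -eiD; congr (_ * ei _); ring.
  under eq_bigr => k _ do under eq_bigr => l _ do rewrite Fkl.
  rewrite /fejer_poly horner_poly mulr_sumr.
  transitivity (\sum_(n < N) (N - n)%:R * (fourier h (n%:R * delta + r) * z ^+ n)).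
    have NC : N%:R * rC N%:R^-1 = 1 :> C by rewrite -rC_nat -rCM NiN.
    apply: eq_bigr => n _; rewrite rCM rC_nat.
    transitivity (N%:R * rC N%:R^-1 * ((N - n)%:R * (fourier h (n%:R * delta + r) * z ^+ n))); last by rewrite NC mul1r.
    move: (fourier _ _) (rC _) ((N - n)%:R : C) => a c d; ring.
  rewrite -(triangle_sum (fun n => fourier h (n%:R * delta + r) * z ^+ n)).
  apply: eq_bigr => k _; apply: eq_bigr => l _; case: ifPn => [lk|].
    rewrite natrB// mulrC; congr (_ * _).
    by rewrite -[in RHS](subnK lk) exprD -mulrA unit_mul_conj ?mulr1// cabsX z1 expr1n.
  (* For k < l the frequency is at most r - delta < 0, where the transform of h vanishes. Here h in
     H^1 and the restriction of r to one lattice step come in, and only the analytic half of the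
     double sum survives. *)
  rewrite -ltnNge => kl; have [_ ->] := hH; rewrite ?mulr0//.
  have kl1 : k%:R - l%:R <= -1 :> R.
    by rewrite lerBlDr addrC -lerBlDr opprK natr1 ler_nat.
  have d0 : 0 < delta by exact: le_lt_trans r0 rd.
  have := ler_wpM2r (ltW d0) kl1; have := rd; lra.
have -> : cabs fejer_poly.[z] = iN * cabs (N%:R * fejer_poly.[z]).
  by rewrite cabsM -rC_nat cabs_rC ger0_norm// mulrA [iN * _]mulrC NiN mul1r.
rewrite E /pp ler_wpM2l ?(ltW iN0)//; apply: cabs_cint_le => //.
- apply: cmeasM; last exact: cintegrable_meas.
  have m := cmeas_cabs (cmeas_dir z).
  by split => /=; [exact: measurable_funX|exact: measurable_cst].
- exact: ipp.
- move=> t _; rewrite cabsM cabs_rC ger0_norm ?sqr_ge0// ler_wpM2l ?sqr_ge0//.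
  by rewrite /hr cabsM cabs_ei mulr1.
Qed.

(** The trigonometric polynomial [pp] multiplied by z^(N-1), which clears the negative powers. *)
Let P : {poly C} := \sum_(k < N) \sum_(l < N)
  (rC iN * cint setT (fun t => rC (cabs (h t)) * ei (- (t * ((k%:R - l%:R) * delta)))))
   *: 'X^(k + (N.-1 - l)).

Let sP : (size P <= N.-1.*2.+1)%N.
Proof.
rewrite (leq_trans (size_sum _ _ _))//; apply/bigmax_leqP => k _.
rewrite (leq_trans (size_sum _ _ _))//; apply/bigmax_leqP => l _.
rewrite (leq_trans (size_scale_leq _ _))// size_polyXn ltnS -addnn leq_add ?leq_subr//.
by rewrite -ltnS prednK.
Qed.

Let PE z : cabs z = 1 -> P.[z] * cconj z ^+ N.-1 = rC (pp z).
Proof.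
move=> z1.
have NC : rC N%:R != 0 :> C by rewrite cabs_neq0// cabs_rC normr_eq0 pnatr_eq0 -lt0n.
apply: (mulfI NC); rewrite -rCM -Re_pp// -sum_fourier// /P horner_sum mulr_suml mulr_sumr.
apply: eq_bigr => k _; rewrite horner_sum mulr_suml mulr_sumr; apply: eq_bigr => l _.
have lN : (l <= N.-1)%N by rewrite -ltnS prednK.
have zl : z ^+ (N.-1 - l) * cconj z ^+ N.-1 = cconj (z ^+ l).
  by rewrite -{2}(subnK lN) exprD mulrA -exprMn unit_mul_conj// expr1n mul1r cconjX.
rewrite hornerZ hornerXn !mulrA -rCM NiN rC1 mul1r exprD -mulrA -[X in _ * X]mulrA zl mulrC.
by [].
Qed.

(** For each t the squares of [dir] have grid mean N by Parseval; the factor 1 / N in [pp] leaves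
    the integral of |h|. *)
Let meanP M z : (N.-1 < M)%N -> cabs z = 1 ->
  \sum_(j < M) pp (z * omega M ^+ j) <= M%:R * L1norm h.
Proof.
move=> NM z1; have {}NM : (N <= M)%N by rewrite -(prednK N0).
have z1j j : cabs (z * omega M ^+ j) = 1 by rewrite cabsM cabs_omegaX z1 mulr1.
have key t : \sum_(j < M) cabs (dir (z * omega M ^+ j) t) ^+ 2 = M%:R * N%:R.
  have zt : cabs (z * ei (- (delta * t))) = 1 by rewrite cabsM z1 cabs_ei mulr1.
  have := @grid_parseval R M N (z * ei (- (delta * t))) (fun=> 1) (fun _ _ => 1) zt NM.
  under [X in _ = M%:R * X -> _]eq_bigr do rewrite cconj1 !mulr1.
  rewrite sumr_const card_ord => h1.
  suff : rC (\sum_(j < M) cabs (dir (z * omega M ^+ j) t) ^+ 2) = rC (M%:R * N%:R).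
    by move=> /(congr1 (@complex.Re R)).
  rewrite rCM !rC_nat -h1 rC_sum; apply: eq_bigr => j _; rewrite -mul_cconj /dir cconj_sum mulr_suml.
  apply: eq_bigr => k _; rewrite mulr_sumr; apply: eq_bigr => l _.
  by rewrite mulr1 !mul1r [z * omega M ^+ j * _]mulrAC.
rewrite /pp -mulr_sumr.
have -> : \sum_(j < M) Rintegral mu setT (fun t => cabs (dir (z * omega M ^+ j) t) ^+ 2 * cabs (h t)) =
    Rintegral mu setT (fun t => (M%:R * N%:R) * cabs (h t)).
  transitivity (Rintegral mu setT (fun t => \sum_(j < M) cabs (dir (z * omega M ^+ j) t) ^+ 2 * cabs (h t))); last first.
    by apply: eq_Rintegral => t _; rewrite -mulr_suml key.
  have gen (s : seq 'I_M) : \sum_(j <- s) Rintegral mu setT (fun t => cabs (dir (z * omega M ^+ j) t) ^+ 2 * cabs (h t)) =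
     Rintegral mu setT (fun t => \sum_(j <- s) cabs (dir (z * omega M ^+ j) t) ^+ 2 * cabs (h t)) /\
     mu.-integrable setT (EFin \o (fun t => \sum_(j <- s) cabs (dir (z * omega M ^+ j) t) ^+ 2 * cabs (h t))).
    elim: s => [|j s [IH1 IH2]].
      split; first by rewrite big_nil /Rintegral; under eq_integral do rewrite big_nil; rewrite integral0.
      apply: (@eq_lintegrable _ _ (fun=> 0)) => //; last exact: integrable0.
      by move=> t _; rewrite big_nil.
    split.
      rewrite big_cons IH1 -RintegralD//; last exact: ipp.
      by apply: eq_Rintegral => t _; rewrite big_cons.
    by apply: eq_lintegrable (lintegrableD _ (ipp (z1j j)) IH2) => // t _; rewrite big_cons.
  by have [] := gen (index_enum 'I_M).
rewrite RintegralZl//; last exact: integrable_cabs.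
by rewrite -/(L1norm h) !mulrA [iN * _]mulrC -[M%:R * iN * _]mulrA [iN * _]mulrC NiN mulr1.
Qed.

Lemma H1_grid_bound (X Y : nat -> H) (psi : nat -> C) (A B e : R) : 0 < A -> 0 < B ->
  (forall k l, psi (k + l)%N = ip (X k) (Y l)) ->
  (forall k, nrm (X k) <= A) -> (forall k, nrm (Y k) <= B) -> 0 < e ->
  exists2 M, (0 < M)%N & forall z, cabs z = 1 ->
  \sum_(j < M) cabs (twist psi fejer_poly).[z * omega M ^+ j] <= M%:R * (A * B * L1norm h + e).
Proof.
move=> A0 B0 psiE XA YB e0.
exact: (hankel_grid_bound Hip A0 B0 psiE XA YB sP PE fejer_polyE meanP (L1norm_ge0 h) e0).
Qed.

End H1_grid.

(** * The half-line integral of a single term *)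

Section core_estimate.
Context {R : realType} {H : lmodType (complex R)}.
Variable ip : H -> H -> complex R.
Hypothesis Hip : is_inner_product ip.
Local Notation C := (complex R).
Local Notation nrm := (hnorm ip).
Local Notation mu := (@lebesgue_measure R).

Lemma lintegrable_mulb (g k : R -> R) (K : R) : mu.-integrable setT (EFin \o g) ->
  measurable_fun setT k -> (forall x, `|k x| <= K) ->
  mu.-integrable setT (EFin \o (fun x => g x * k x)).
Proof.
move=> gi mk kK.
have [+ _] : cintegrable setT (fun x => rC (g x) * rC (k x)).
  apply: (@cintegrable_mulb _ _ (fun x => rC (g x)) (fun x => rC (k x)) K) => //.
  - by split; [exact: gi|exact: integrable0].
  - by move=> x _; rewrite cabs_rC.
by apply: eq_lintegrable => // x _; rewrite -rCM.
Qed.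

Lemma exists_cell (M : nat) (x : R) : 0 < x -> x <= M%:R ->
  exists2 j : 'I_M, (j%:R < x) & x <= j.+1%:R.
Proof.
elim: M => [|M IH] x0 xM; first by have := lt_le_trans x0 xM; rewrite ltxx.
have [xM'|xM'] := leP x M%:R; last by exists ord_max.
have [j h1 h2] := IH x0 xM'.
by exists (widen_ord (leqnSn M) j).
Qed.

Section itv_ind.
Variables a b : R.
Hypothesis ab : a < b.
Definition itv_ind (s : R) : R := if (a <= s) && (s < b) then 1 else 0.

Lemma cintegrable_itv_ind : cintegrable setT (fun s => rC (itv_ind s)).
Proof.
have [|h _] := @cintegrable_mkcond R `[a, b[%classic (fun s => (a <= s) && (s < b)) (fun=> 1) (measurable_itv _).
  by move=> x; rewrite /= in_itv.
have : cintegrable setT (fun x : R => if (a <= x) && (x < b) then 1 else 0 : C).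
  apply: h; split; last exact: integrable0.
  apply: (@integrableS _ _ _ mu `[a, b]%classic) => //.
    by move=> x; rewrite /= !in_itv /= => /andP[-> /ltW].
  apply: continuous_compact_integrable; first exact: segment_compact.
  by apply: continuous_subspaceT => x; exact: cvg_cst.
by apply: cintegrable_ext => // x _; rewrite /itv_ind; case: ifP.
Qed.

Lemma integrable_itv_ind : mu.-integrable setT (EFin \o itv_ind).
Proof. by have [] := cintegrable_itv_ind. Qed.

Lemma Rintegral_itv_ind : Rintegral mu setT itv_ind = b - a.
Proof.
transitivity (Rintegral mu `[a, b[%classic (fun=> 1)).
  rewrite [RHS]Rintegral_mkcond; apply: eq_Rintegral => x _; rewrite patchE /itv_ind.
  by congr (if _ then _ else _); apply/idP/idP; [move=> h; apply/mem_set; rewrite /= in_itv|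
    move/set_mem; rewrite /= in_itv].
rewrite Rintegral_cst//= mul1r.
by have := @lebesgue_measure_itv R (Interval (BLeft a) (BLeft b)); rewrite /= lte_fin ab => ->.
Qed.

End itv_ind.

Variables (f h phi : R -> C) (A Kf a b : R) (X Y : R -> H).
Hypothesis cf : ccont f.
Hypothesis A0 : 0 < A.
Hypothesis fA : forall u, A <= `|u| -> f u = 0.
Hypothesis fK : forall u, cabs (f u) <= Kf.
Hypothesis hH : is_H1 h.
Hypothesis a0 : 0 < a.
Hypothesis b0 : 0 < b.
Hypothesis phiE : forall s t, 0 <= s -> 0 <= t -> phi (s + t) = ip (X s) (Y t).
Hypothesis Xa : forall s, 0 <= s -> nrm (X s) <= a.
Hypothesis Yb : forall s, 0 <= s -> nrm (Y s) <= b.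

(** With this step u -> e^(-i delta u) has period 2 A, so the interval [-A, A] carrying f winds
    exactly once around the unit circle. *)
Let delta : R := pi / A.
Let delta0 : 0 < delta. Proof. by rewrite divr_gt0 ?pi_gt0. Qed.
Let hi : cintegrable setT h. Proof. by case: hH. Qed.
Let fi : cintegrable setT f. Proof. exact: cintegrable_compact cf fA. Qed.
Let Kf0 : 0 <= Kf. Proof. exact: le_trans (cabs_ge0 _) (fK 0). Qed.
Let L := L1norm h.
Let q t := fourier f t * fourier h t * phi t.

Section fixed_offset.
Variables (r : R) (N : nat).
Hypothesis r0 : 0 <= r.
Hypothesis rd : r < delta.
Hypothesis N0 : (0 < N)%N.

Let psi (n : nat) : C := phi (n%:R * delta + r).
Let Xk (k : nat) := X (k%:R * delta + r).
Let Yl (l : nat) := Y (l%:R * delta).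
Let p := twist psi (fejer_poly h delta r N).
Let c (n : nat) : C := rC ((N - n)%:R * N%:R^-1) * fourier h (n%:R * delta + r) * psi n.

Let nd0 (n : nat) : 0 <= n%:R * delta. Proof. by rewrite mulr_ge0// ltW. Qed.

Let psiE k l : psi (k + l)%N = ip (Xk k) (Yl l).
Proof.
rewrite -phiE ?addr_ge0//; congr phi; rewrite natrD; ring.
Qed.

Let D (u : R) : C := p.[ei (- (delta * u))].

Let ei_pow (x : R) (n : nat) : ei x ^+ n = ei (n%:R * x).
Proof.
elim: n => [|n IH]; first by rewrite expr0 mul0r ei0.
by rewrite exprS IH -eiD -natr1; congr ei; ring.
Qed.

Let DE u : D u = \sum_(n < N) c n * ei (- (u * (n%:R * delta))).
Proof.
have sp : (size p <= N)%N.
  by rewrite /p (leq_trans (size_poly _ _))// size_poly.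
rewrite /D (horner_coef_wide _ sp); apply: eq_bigr => n _.
rewrite /p coef_twist coef_poly ltn_ord ei_pow; congr (_ * ei _); ring.
Qed.

Let cmeas_ei_neg (x : R) : cmeas setT (fun t => ei (- (t * x))).
Proof. by apply: cmeas_ext (cmeas_ei_mul (- x)) => t _; rewrite mulrN. Qed.

Let mD : cmeas setT D.
Proof.
apply: (@cmeas_ext _ _ (fun u => \sum_(n < N) c n * ei (- (u * (n%:R * delta))))).
  by move=> u _; rewrite DE.
by apply: cmeas_sum => n; apply: cmeasM; [exact: cmeas_cst|exact: cmeas_ei_neg].
Qed.

Let XkA k : nrm (Xk k) <= a. Proof. by rewrite Xa// addr_ge0. Qed.
Let YlB k : nrm (Yl k) <= b. Proof. by rewrite Yb. Qed.

Let D_bounded u : cabs (D u) <= a * b * l1 (fejer_poly h delta r N).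
Proof. exact: (cabs_twist_le Hip psiE XkA YlB _ (cabs_ei _)). Qed.

(** Writing the samples of the transform of f as integrals leaves f paired with the twisted
    polynomial on the circle. *)
Let sumE : \sum_(n < N) rC ((N - n)%:R * N%:R^-1) * q (n%:R * delta + r) =
  cint setT (fun u => f u * (ei (- (u * r)) * D u)).
Proof.
have ik (n : 'I_N) : cintegrable setT (fun u => f u * ei (- (u * (n%:R * delta + r)))).
  by apply: (cintegrable_mulb _ fi (cmeas_ei_neg _)) => // u _; rewrite cabs_ei.
transitivity (\sum_(n < N) cint setT (fun u => c n * (f u * ei (- (u * (n%:R * delta + r)))))).
  apply: eq_bigr => n _; rewrite cintZ// -/(fourier f _) /c /q -/(psi n).
  ring.
rewrite -cint_sum//; last by move=> n; exact: cintegrableZ.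
apply: eq_cint => u _; rewrite DE !mulr_sumr; apply: eq_bigr => n _.
have -> : ei (- (u * (n%:R * delta + r))) = ei (- (u * r)) * ei (- (u * (n%:R * delta))).
  by rewrite -eiD; congr ei; ring.
ring.
Qed.

(** As |f| <= [Kf] and f vanishes off [-A, A], it remains to bound the integral of |D| over one
    period. The period is cut into M cells of length w, and translating them all onto the last cell
    produces the grid sums of [H1_grid_bound]. *)
Lemma fejer_sum_bound :
  cabs (\sum_(n < N) rC ((N - n)%:R * N%:R^-1) * q (n%:R * delta + r)) <=
  2 * A * (Kf * (a * b * L)).
Proof.
apply/ler_addgt0Pl => e e0; rewrite sumE.
pose e' := e / (2 * A * (Kf + 1)).
have KA0 : 0 < 2 * A * (Kf + 1) by rewrite !mulr_gt0// ltr_wpDl.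
have e'0 : 0 < e' by rewrite divr_gt0.
have [M M0 hM] := H1_grid_bound Hip hH r0 rd N0 a0 b0 psiE XkA YlB e'0.
pose w := 2 * A / M%:R.
have MR0 : 0 < M%:R :> R by rewrite ltr0n.
have w0 : 0 < w by rewrite !divr_gt0// mulr_gt0.
have wM : w * M%:R = 2 * A by rewrite divfK// gt_eqF.
have wA : A - w < A by rewrite ltrBlDr ltrDl.
pose chi := itv_ind (A - w) A.
have chi0 s : 0 <= chi s by rewrite /chi /itv_ind; case: ifP.
have ichi := integrable_itv_ind (A - w) A.
have mDc := cmeas_cabs mD.
have mDs (x : R) : measurable_fun setT (fun s : R => cabs (D (s - x))).
  exact: cmeas_cabs (cmeas_shift (- x) mD).
have bDs x : `|cabs (D x)| <= a * b * l1 (fejer_poly h delta r N).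
  by rewrite ger0_norm ?cabs_ge0.
have ij (j : 'I_M) : mu.-integrable setT (EFin \o (fun s => chi s * cabs (D (s - j%:R * w)))).
  by apply: lintegrable_mulb => // x; exact: bDs.
have ij' (j : 'I_M) : mu.-integrable setT (EFin \o (fun u => chi (u + j%:R * w) * cabs (D u))).
  by apply: eq_lintegrable (integrable_shift (j%:R * w) (ij j)) => // u _; rewrite addrK.
have sumI (I : Type) (s : seq I) (F : I -> R -> R) : (forall i, mu.-integrable setT (EFin \o F i)) ->
   mu.-integrable setT (EFin \o (fun t => \sum_(i <- s) F i t)) /\
   Rintegral mu setT (fun t => \sum_(i <- s) F i t) = \sum_(i <- s) Rintegral mu setT (F i).
  move=> iF; elim: s => [|i s [IH1 IH2]].
    split; last by rewrite big_nil /Rintegral; under eq_integral do rewrite big_nil; rewrite integral0.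
    apply: (@eq_lintegrable _ _ (fun=> 0)) => //; last exact: integrable0.
    by move=> t _; rewrite big_nil.
  split; first by apply: eq_lintegrable (lintegrableD _ (iF i) IH1) => // t _; rewrite big_cons.
  rewrite big_cons -IH2 -RintegralD//.
  by apply: eq_Rintegral => t _; rewrite big_cons.
have [iS ES] := sumI _ (index_enum 'I_M) (fun j u => chi (u + j%:R * w) * cabs (D u)) ij'.
have [iS2 ES2] := sumI _ (index_enum 'I_M) (fun j s => chi s * cabs (D (s - j%:R * w))) ij.
apply: (@le_trans _ _ (Rintegral mu setT (fun u => Kf * \sum_(j < M) chi (u + j%:R * w) * cabs (D u)))).
  apply: cabs_cint_le => //.
  - by apply: cmeasM; [exact: cmeas_ccont|apply: cmeasM].
  - exact: (lintegrableZ Kf measurableT iS).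
  move=> u _; rewrite !cabsM cabs_ei mul1r -mulr_suml mulrA.
  have [/fA ->|uA] := leP A `|u|.
    rewrite cabs0 mul0r !mulr_ge0 ?cabs_ge0// sumr_ge0// => j _; exact: chi0.
  rewrite ler_wpM2r ?cabs_ge0// (le_trans (fK u))// ler_peMr//.
  have [uA1 uA2] : - A < u /\ u < A by move: uA; rewrite ltr_norml => /andP[].
  have x0 : 0 < (A - u) / w by rewrite divr_gt0// subr_gt0.
  have xM : (A - u) / w <= M%:R by rewrite ler_pdivrMr// mulrC wM; lra.
  have [j h1 h2] := exists_cell x0 xM.
  rewrite (bigD1 j)//= -[leLHS]addr0 lerD//; last by apply: sumr_ge0 => i _; exact: chi0.
  move: h1 h2; rewrite ltr_pdivlMr// ler_pdivrMr// -natr1 mulrDl mul1r => h1 h2.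
  rewrite /chi /itv_ind ifT//; apply/andP; split; lra.
rewrite RintegralZl// ES.
have -> : \sum_(j < M) Rintegral mu setT (fun u => chi (u + j%:R * w) * cabs (D u)) =
   \sum_(j < M) Rintegral mu setT (fun s => chi s * cabs (D (s - j%:R * w))).
  apply: eq_bigr => j _.
  have mG : measurable_fun setT (fun s : R => chi s * cabs (D (s - j%:R * w))).
    by have /measurable_int/measurable_EFinP := ij j.
  by rewrite -(Rintegral_shift (j%:R * w) mG); apply: eq_Rintegral => u _; rewrite addrK.
rewrite -ES2.
(* Since delta w = 2 pi / M, a translation by - w multiplies e^(-i delta s) by the root of unity
   [omega M]. *)
have hD s : \sum_(j < M) cabs (D (s - j%:R * w)) <= M%:R * (a * b * L + e').
  apply: le_trans (hM (ei (- (delta * s))) (cabs_ei _)).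
  apply: ler_sum => j _; rewrite le_eqVlt; apply/orP; left; apply/eqP; congr (cabs _.[_]).
  rewrite omegaX -/(ei _) -eiD; congr ei; rewrite /delta /w.
  by move: (@pi R) => pi'; field; rewrite !gt_eqF.
apply: (@le_trans _ _ (Kf * (w * (M%:R * (a * b * L + e'))))).
  rewrite ler_wpM2l//.
  have -> : w * (M%:R * (a * b * L + e')) =
      Rintegral mu setT (fun s => M%:R * (a * b * L + e') * chi s).
    rewrite RintegralZl// Rintegral_itv_ind// mulrC; congr (_ * _); ring.
  apply: le_Rintegral => //; first exact: (lintegrableZ _ measurableT ichi).
  by move=> s _; rewrite -mulr_sumr mulrC ler_wpM2r.
rewrite [w * (_ * _)]mulrA wM.
have -> : Kf * (2 * A * (a * b * L + e')) = 2 * A * Kf * e' + 2 * A * (Kf * (a * b * L)) by ring.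
rewrite lerD2r /e' mulrA ler_pdivrMr// mulrC ler_wpM2l ?(ltW e0)//.
by rewrite ler_wpM2l ?mulr_ge0 ?(ltW A0)// lerDl.
Qed.

End fixed_offset.

Hypothesis phii : cintegrable setT (pos phi).

Let cell (n : nat) : R -> R := itv_ind (n%:R * delta) (n.+1%:R * delta).
(** The step function with the Fejer weight 1 - n / N on the n-th cell; it tends to 1 pointwise on
    the half-line. *)
Let kap (N : nat) (t : R) : R := \sum_(n < N) ((N - n)%:R * N%:R^-1) * cell n t.

Let cell_eq (t : R) (n m : nat) : cell n t = 1 -> cell m t = 1 -> n = m.
Proof.
rewrite /cell /itv_ind; case: ifP => [/andP[n1 n2] _|_ /eqP]; last by rewrite eq_sym oner_eq0.
case: ifP => [/andP[m1 m2] _|_ /eqP]; last by rewrite eq_sym oner_eq0.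
have key (x y : nat) : x%:R * delta <= t -> t < y.+1%:R * delta -> (x <= y)%N.
  move=> hx hy; have := le_lt_trans hx hy.
  by rewrite (ltr_pM2r delta0) ltr_nat ltnS.
by apply/eqP; rewrite eqn_leq (key _ _ n1 m2) (key _ _ m1 n2).
Qed.

Let cell01 n t : cell n t = 0 \/ cell n t = 1.
Proof. by rewrite /cell /itv_ind; case: ifP; [right|left]. Qed.

Let kapE (t : R) : 0 <= t -> exists n0 : nat, forall N,
  kap N t = if (n0 < N)%N then (N - n0)%:R * N%:R^-1 else 0.
Proof.
move=> t0; have td : 0 <= t / delta by rewrite divr_ge0// ltW.
have /andP[h1 h2] := truncn_itv td.
set n0 := Num.truncn _ in h1 h2; exists n0 => N.
have c1 : cell n0 t = 1.
  by rewrite /cell /itv_ind -ler_pdivlMr// h1 -ltr_pdivrMr// h2.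
have c0 n : n != n0 -> cell n t = 0.
  by move=> nn0; case: (cell01 n t) => // hc; rewrite (cell_eq hc c1) eqxx in nn0.
rewrite /kap; case: ifPn => [n0N|].
  rewrite (bigD1 (Ordinal n0N))//= c1 mulr1 big1 ?addr0// => n nn0.
  by rewrite c0 ?mulr0//; apply: contra nn0 => /eqP h; apply/eqP/val_inj.
rewrite -leqNgt => Nn0; rewrite big1// => n _; rewrite c0 ?mulr0//.
by rewrite ltn_eqF// (leq_trans (ltn_ord n)).
Qed.

Let Q (t : R) : C := fourier f t * fourier h t * pos phi t.

Let Qi : cintegrable setT Q.
Proof.
apply: (cintegrable_bmul (K := L1norm f * L1norm h) _ phii) => //.
  by apply: cmeasM; apply: cmeas_fourier; exact: cintegrable_meas.
by move=> t _; rewrite cabsM ler_pM ?cabs_ge0// cabs_fourier.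
Qed.

Let Q_neg t : t < 0 -> Q t = 0.
Proof. by move=> t0; rewrite /Q /pos leNgt t0 mulr0. Qed.

Let kap_bound N t : 0 <= t -> 0 <= kap N t <= 1.
Proof.
move=> /kapE[n0 ->]; case: ifP => [n0N|_]; last by rewrite lexx ler01.
rewrite mulr_ge0 ?invr_ge0//=; have N0 : (0 < N)%N by exact: leq_ltn_trans n0N.
by rewrite ler_pdivrMr ?ltr0n// mul1r ler_nat leq_subr.
Qed.

Let mcell n : cmeas setT (fun t => rC (cell n t)).
Proof. exact: cintegrable_meas (cintegrable_itv_ind _ _). Qed.

Let bcell n t : cabs (rC (cell n t)) <= 1.
Proof. by rewrite cabs_rC; case: (cell01 n t) => ->; rewrite ?normr0 ?normr1. Qed.

(** Translating every cell to [0, delta) gives the integral over the offset of the sums in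
    [fejer_sum_bound]. The length pi / A of this interval turns the factor 2 A into 2 pi. *)
Let kap_int N : (0 < N)%N ->
  cabs (cint setT (fun t => rC (kap N t) * Q t)) <= 2 * pi * (Kf * (a * b * L)).
Proof.
move=> N0.
have icell n : cintegrable setT (fun t => rC (cell n t) * Q t).
  by apply: (cintegrable_bmul (K := 1) _ Qi (mcell n)) => // t _; exact: bcell.
pose ind := itv_ind 0 delta.
have iind : cintegrable setT (fun t => rC (ind t)) by exact: cintegrable_itv_ind.
have ind01 t : `|ind t| <= 1 by rewrite /ind /itv_ind; case: ifP => _; rewrite ?normr1 ?normr0.
have iind2 n : cintegrable setT (fun t => rC (ind t) * Q (t + n%:R * delta)).
  apply: (cintegrable_bmul (K := 1) _ (cintegrable_shift (n%:R * delta) Qi)) => //.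
    exact: cintegrable_meas.
  by move=> t _; rewrite cabs_rC.
have cell_shift n : cint setT (fun t => rC (cell n t) * Q t) =
    cint setT (fun t => rC (ind t) * Q (t + n%:R * delta)).
  rewrite -(cint_shift (n%:R * delta) (cintegrable_meas (icell n))); apply: eq_cint => t _.
  congr (rC _ * _); rewrite /cell /ind /itv_ind lerDr -natr1 mulrDl mul1r [_ + delta]addrC.
  by rewrite ltrD2r.
have -> : cint setT (fun t => rC (kap N t) * Q t) =
    cint setT (fun t => rC (ind t) * \sum_(n < N) rC ((N - n)%:R * N%:R^-1) * Q (t + n%:R * delta)).
  transitivity (\sum_(n < N) rC ((N - n)%:R * N%:R^-1) * cint setT (fun t => rC (cell n t) * Q t)).
    transitivity (\sum_(n < N) cint setT (fun t => rC ((N - n)%:R * N%:R^-1) * (rC (cell n t) * Q t))); last first.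
      by apply: eq_bigr => n _; rewrite cintZ.
    rewrite -cint_sum//; last by move=> n; exact: cintegrableZ.
    apply: eq_cint => t _; rewrite /kap rC_sum mulr_suml; apply: eq_bigr => n _.
    by rewrite rCM mulrA.
  transitivity (\sum_(n < N) cint setT (fun t => rC ((N - n)%:R * N%:R^-1) * (rC (ind t) * Q (t + n%:R * delta)))).
    by apply: eq_bigr => n _; rewrite cell_shift cintZ.
  rewrite -cint_sum//; last by move=> n; exact: cintegrableZ.
  by apply: eq_cint => t _; rewrite mulr_sumr; apply: eq_bigr => n _; rewrite mulrCA.
pose B := 2 * A * (Kf * (a * b * L)).
have -> : 2 * pi * (Kf * (a * b * L)) = Rintegral mu setT (fun t => B * ind t).
  rewrite RintegralZl//; last exact: integrable_itv_ind.
  rewrite Rintegral_itv_ind// subr0 /B /delta.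
  by move: (@pi R) => pi'; field; rewrite gt_eqF.
apply: cabs_cint_le => //.
- apply: cmeasM; first exact: cintegrable_meas.
  apply: cmeas_sum => n; apply: cmeasM; first exact: cmeas_cst.
  by apply: cmeas_shift; exact: cintegrable_meas.
- by apply: lintegrableZ => //; exact: integrable_itv_ind.
move=> t _; rewrite cabsM cabs_rC /ind /itv_ind; case: ifP => [/andP[t0 td]|_]; last first.
  by rewrite normr0 mul0r mulr0.
rewrite normr1 mul1r mulr1 (le_trans _ (fejer_sum_bound t0 td N0))//.
rewrite le_eqVlt; apply/orP; left; apply/eqP; congr cabs; apply: eq_bigr => n _; congr (_ * _).
have nt : 0 <= t + n%:R * delta by rewrite addr_ge0// mulr_ge0// ltW.
by rewrite /Q /pos nt /q addrC.
Qed.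

(* Slicing the half-line along the lattices delta N + r turns the integral into an average over r
   of sums controlled by [H1_grid_bound]. *)
Lemma core_estimate : cabs (cint setT Q) <= 2 * pi * (Kf * (a * b * L)).
Proof.
have cv : ccvg (fun N => cint setT (fun t => rC (kap N.+1 t) * Q t)) (cint setT Q).
  apply: (@cint_dominated _ _ _ _ (fun t => cabs (Q t))) => //.
  - move=> N; apply: cmeasM; last exact: cintegrable_meas.
    apply: (@cmeas_ext _ _ (fun t => \sum_(n < N.+1) rC ((N.+1 - n)%:R * N.+1%:R^-1) * rC (cell n t))).
      by move=> t _; rewrite /kap rC_sum; apply: eq_bigr => n _; rewrite [RHS]rCM.
    by apply: cmeas_sum => n; apply: cmeasM; [exact: cmeas_cst|exact: mcell].
  - exact: cintegrable_meas.
  - exact: integrable_cabs.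
  - move=> N t _; have [t0|t0] := leP 0 t; last by rewrite Q_neg// mulr0 cabs0.
    have /andP[k0 k1] := kap_bound N.+1 t0.
    by rewrite cabsM cabs_rC ger0_norm// ler_piMl ?cabs_ge0.
  - move=> t _; have [t0|t0] := leP 0 t; last first.
      apply: (@ccvg_harm _ _ _ 0) => n; rewrite Q_neg// mulr0 subrr cabs0 mul0r//.
    have [n0 kE] := kapE t0.
    apply: (@ccvg_harm _ _ _ (n0%:R * cabs (Q t))) => N.
    rewrite -{2}(mul1r (Q t)) -mulrBl cabsM mulrAC ler_wpM2r ?cabs_ge0//.
    rewrite -rC1 -rCN -rCD cabs_rC distrC kE; case: ifPn => [n0N|].
      have -> : 1 - (N.+1 - n0)%:R * N.+1%:R^-1 = n0%:R / N.+1%:R :> R.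
        rewrite natrB ?(ltnW n0N)// mulrBl divff ?pnatr_eq0// opprB addrC subrK//.
      by rewrite ger0_norm ?divr_ge0.
    by rewrite -leqNgt => n0N; rewrite subr0 normr1 ler_pdivlMr// mul1r ler_nat.
apply/ler_addgt0Pl => e e0; have /ccvg_epsP/(_ e e0)[N /(_ N (leqnn N)) hN] := cv.
rewrite -(subrK (cint setT (fun t => rC (kap N.+1 t) * Q t)) (cint setT Q)).
by rewrite (le_trans (cabsD _ _))// lerD ?kap_int// cabs_distC.
Qed.

End core_estimate.

(** * Orbits of bounded semigroups *)

Section eta.
Context {R : realType}.
Local Notation C := (complex R).
Local Notation Re := complex.Re.
Local Notation mu := (@lebesgue_measure R).

Lemma maxr0_lip (s t : R) : `|Num.max 0 s - Num.max 0 t| <= `|s - t|.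
Proof.
have [s0|/ltW s0] := leP 0 s; have [t0|/ltW t0] := leP 0 t => //.
- by rewrite subr0 !ger0_norm ?subr_ge0 ?(le_trans t0)// lerDl oppr_ge0.
- by rewrite sub0r normrN ger0_norm// distrC ger0_norm ?subr_ge0 ?(le_trans s0)// lerDl oppr_ge0.
- by rewrite subrr normr0 normr_ge0.
Qed.

Lemma continuous_maxr0 : continuous (Num.max 0 : R -> R).
Proof.
move=> x; apply/cvgrPdist_le => e e0; near=> y.
apply: le_trans (maxr0_lip x y) _; near: y.
exact: cvgr_dist_le (@cvg_id _ (nbhs x)) _ e0.
Unshelve. all: by end_near. Qed.

Lemma max0_ge0 (s : R) : 0 <= Num.max 0 s. Proof. by rewrite le_max lexx. Qed.

Variable N : R.
Hypothesis N0 : 0 < N.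

(* The density of the sum of two independent exponential variables with parameters N and 2N:
   an approximate identity on the positive half-line whose transform is integrable. *)
Definition eta (s : R) : R :=
  2 * N * (expR (- (N * Num.max 0 s)) - expR (- (2 * N * Num.max 0 s))).

Let NN0 : 0 < 2 * N. Proof. by rewrite mulr_gt0. Qed.

Lemma eta_ge0 s : 0 <= eta s.
Proof.
rewrite mulr_ge0 ?(ltW NN0)// subr_ge0 ler_expR lerN2 ler_wpM2r ?max0_ge0//.
by rewrite ler_peMl ?(ltW N0)// ler1n.
Qed.

Lemma eta_le s : eta s <= 2 * N * expR (- (N * Num.max 0 s)).
Proof. by rewrite ler_wpM2l ?(ltW NN0)// gerBl expR_ge0. Qed.

Lemma eta_bound s : cabs (rC (eta s)) <= 2 * N.
Proof.
rewrite cabs_rC ger0_norm ?eta_ge0//; apply: le_trans (eta_le s) _.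
by rewrite ler_piMr ?(ltW NN0)// -expR0 ler_expR oppr_le0 mulr_ge0 ?max0_ge0 ?(ltW N0).
Qed.

Lemma eta_neg s : s <= 0 -> eta s = 0.
Proof. by move=> s0; rewrite /eta max_l// !mulr0 oppr0 subrr mulr0. Qed.

Lemma ccont_eta : ccont (fun s => rC (eta s)).
Proof.
apply: ccontP => x /=; last exact: cvg_cst.
apply: cvgM; first exact: cvg_cst.
by apply: cvgB; apply: (@continuous_comp _ _ _ (Num.max 0 : R -> R) (fun t => expR (- (_ * t))));
  [exact: continuous_maxr0|exact: continuous_expR_lin|exact: continuous_maxr0|exact: continuous_expR_lin].
Qed.

Lemma cmeas_eta : cmeas setT (fun s => rC (eta s)). Proof. exact: cmeas_ccont ccont_eta. Qed.

Lemma eta_ei s u : rC (eta s) * ei (s * u) =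
  rC (2 * N) * (pos (lexp (Complex N (- u))) s - pos (lexp (Complex (2 * N) (- u))) s).
Proof.
rewrite /pos; have [s0|s0] := leP 0 s; last by rewrite eta_neg ?ltW// mul0r subr0 mulr0.
rewrite !lexpE /eta max_r//= !mulNr !opprK [u * s]mulrC /ei /cexp /= expR0 !mul1r.
by apply: complex_eqP; rewrite !(ReM, ImM, ReB, ImB) /=; ring.
Qed.

Lemma cintegrable_eta : cintegrable setT (fun s => rC (eta s)).
Proof.
apply: (@cintegrable_ext _ _ (fun s => rC (2 * N) * (pos (lexp (Complex N (- 0))) s - pos (lexp (Complex (2 * N) (- 0))) s))) => //.
  by move=> s _; rewrite -eta_ei mulr0 ei0 mulr1.
by apply: cintegrableZ => //; apply: cintegrableB => //; apply: cintegrable_lexp.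
Qed.

Lemma chk_eta u : chk (fun s => rC (eta s)) u =
  rC (2 * N) * ((Complex N (- u))^-1 - (Complex (2 * N) (- u))^-1).
Proof.
rewrite /chk; under eq_cint do rewrite eta_ei.
have i1 : cintegrable setT (pos (lexp (Complex N (- u)))) by exact: cintegrable_lexp.
have i2 : cintegrable setT (pos (lexp (Complex (2 * N) (- u)))) by exact: cintegrable_lexp.
by rewrite cintZ ?cintB ?cint_lexp//; exact: cintegrableB.
Qed.

Lemma cint_eta : cint setT (fun s => rC (eta s)) = 1.
Proof.
transitivity (chk (fun s => rC (eta s)) 0).
  by apply: eq_cint => s _; rewrite mulr0 ei0 mulr1.
rewrite chk_eta oppr0 -!/(rC _) !rCM.
have Nn : rC N != 0 by apply/eqP => -[] /eqP; rewrite gt_eqF.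
have n2 : rC (2 : R) != 0 by apply/eqP => -[] /eqP; rewrite gt_eqF.
have -> : rC (2 : R) = 2%:R by rewrite rC_nat.
by field.
Qed.

Lemma Rintegral_eta : Rintegral mu setT eta = 1.
Proof. by have := congr1 (@complex.Re R) cint_eta. Qed.

Lemma L1norm_eta : L1norm (fun s => rC (eta s)) = 1.
Proof.
by rewrite -Rintegral_eta; apply: eq_Rintegral => s _; rewrite cabs_rC ger0_norm ?eta_ge0.
Qed.

(** The difference of the two reciprocals equals N times their product, so the transform decays like
    u^-2; replacing |2N - iu| by the smaller |N - iu| yields a Poisson kernel. *)
Lemma cabs_chk_eta u : cabs (chk (fun s => rC (eta s)) u) <= 2 * pi * N * Pois N u.
Proof.
rewrite chk_eta.
have n1 : Complex N (- u) != 0 by apply/eqP => -[] /eqP; rewrite gt_eqF.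
have n2 : Complex (2 * N) (- u) != 0 by apply/eqP => -[] /eqP; rewrite gt_eqF.
have -> : (Complex N (- u))^-1 - (Complex (2 * N) (- u))^-1 =
    rC N * ((Complex N (- u))^-1 * (Complex (2 * N) (- u))^-1).
  have -> : rC N = Complex (2 * N) (- u) - Complex N (- u).
    by apply: complex_eqP; rewrite ?ReB ?ImB /=; ring.
  by field; rewrite n1 n2.
rewrite !cabsM !cabs_rC !gtr0_norm// !cabsV.
have c1 : 0 < cabs (Complex N (- u)) by rewrite lt_neqAle cabs_ge0 andbT eq_sym; apply/eqP => /cabs_eq0/eqP; exact/negP.
have s1 := sqr_cabs (Complex N (- u)); rewrite /= sqrrN in s1.
have c12 : cabs (Complex N (- u)) <= cabs (Complex (2 * N) (- u)).
  by rewrite /cabs ler_wsqrtr//= lerD2r ler_sqr ?nnegrE ?(ltW NN0) ?(ltW N0)// ler_peMl ?(ltW N0)// ler1n.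
have -> : 2 * pi * N * Pois N u = 2 * N * (N * ((cabs (Complex N (- u)))^-1 * (cabs (Complex N (- u)))^-1)).
  have p0 := pi_gt0 R; rewrite -invfM -expr2 s1 /Pois addrC.
  move: (@pi R) p0 => p p0; field; rewrite (gt_eqF p0) /= -s1 gt_eqF// exprn_gt0//.
rewrite !ler_wpM2l ?(ltW NN0) ?(ltW N0) ?invr_ge0 ?cabs_ge0// lef_pV2// posrE//.
exact: lt_le_trans c12.
Qed.

Lemma cintegrable_chk_eta : cintegrable setT (chk (fun s => rC (eta s))).
Proof.
apply: (@cintegrable_le _ _ _ (fun u => 2 * pi * N * Pois N u)) => //.
- exact: cmeas_chk cmeas_eta.
- exact: (lintegrableZ _ measurableT (integrable_Pois N0)).
- by move=> u _; exact: cabs_chk_eta.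
Qed.

Lemma eta_inversion v :
  cint setT (fun u => chk (fun s => rC (eta s)) (- u) * ei (u * v)) = rC (2 * pi) * rC (eta v).
Proof.
apply: (fourier_inversion cintegrable_eta eta_bound); first exact: ccont_eta.
exact: cintegrable_opp cintegrable_chk_eta.
Qed.

(** Half of the exponential decay pays for the factor s, by x e^(-x) <= 1 at x = N s / 2. *)
Lemma mul_eta_le s : 0 <= s -> s * eta s <= 4 * expR (- (N / 2 * s)).
Proof.
move=> s0; apply: le_trans (ler_wpM2l s0 (eta_le s)) _; rewrite max_r//.
have E : expR (- (N * s)) = expR (- (N / 2 * s)) * expR (- (N / 2 * s)).
  by rewrite -expRD; congr expR; field.
rewrite E !mulrA ler_wpM2r ?expR_ge0//.
have -> : s * 2 * N * expR (- (N / 2 * s)) = 4 * (N / 2 * s * expR (- (N / 2 * s))) by field.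
rewrite ler_piMr// expRN ler_pdivrMr ?expR_gt0// mul1r.
by apply: le_trans (expR_ge1Dx _); rewrite lerDr.
Qed.

Lemma Rintegral_pos_expR (a : R) : 0 < a ->
  Rintegral mu setT (fun t => if 0 <= t then expR (- (a * t)) else 0) = a^-1.
Proof.
move=> a0; have ra0 : 0 < Re (rC a) by [].
have := congr1 (@complex.Re R) (cint_lexp ra0).
have -> : Re (rC a)^-1 = a^-1.
  by rewrite invc_conj cabs_rC gtr0_norm// ReM /= mulr0 subr0; field; rewrite gt_eqF.
move=> <- /=; apply: eq_Rintegral => t _; rewrite /pos; case: ifP => // _.
by rewrite lexpE /= mul0r oppr0 cos0 mulr1.
Qed.

(** The number 8 / N bounds the first moment of [eta]: it is the integral of the majorant in
    [mul_eta_le], namely 4 times 2 / N. *)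
Lemma eta_average (G : R -> C) (g0 : C) (K c k : R) : cmeas setT G ->
  (forall s, cabs (G s) <= K) -> 0 <= k ->
  (forall s, 0 <= s -> cabs (G s - g0) <= c + k * s) ->
  cabs (cint setT (fun s => rC (eta s) * G s) - g0) <= c + k * (8 / N).
Proof.
move=> mG GK k0 Gc.
have iG : cintegrable setT (fun s => rC (eta s) * G s).
  by apply: (cintegrable_mulb _ cintegrable_eta mG) => // s _; exact: GK.
have ig : cintegrable setT (fun s => g0 * rC (eta s)) by apply: cintegrableZ => //; exact: cintegrable_eta.
have N20 : 0 < N / 2 by rewrite divr_gt0.
rewrite -[g0 in X in X <= _]mulr1 -cint_eta -cintZ//; last exact: cintegrable_eta.
rewrite -cintB//.
have ie : mu.-integrable setT (EFin \o eta) by have [] := cintegrable_eta.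
have iE := integrable_pos_expR N20.
pose g s := c * eta s + 4 * k * (if 0 <= s then expR (- (N / 2 * s)) else 0).
have i1 := lintegrableZ c measurableT ie.
have i2 := lintegrableZ (4 * k) measurableT iE.
have -> : c + k * (8 / N) = Rintegral mu setT g.
  rewrite /g RintegralD// (@RintegralZl _ _ _ mu setT eta c)// (@RintegralZl _ _ _ mu setT (fun t : R => if 0 <= t then expR (- (N / 2 * t)) else 0))// Rintegral_eta Rintegral_pos_expR//.
  by field; rewrite gt_eqF.
apply: cabs_cint_le => //.
- by apply: cmeasB; apply: cintegrable_meas.
- exact: lintegrableD.
- move=> s _; rewrite [g0 * _]mulrC -mulrBr cabsM cabs_rC ger0_norm ?eta_ge0// /g.
  have [s0|s0] := leP 0 s; last by rewrite (eta_neg (ltW s0)) mul0r !mulr0 addr0.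
  apply: le_trans (ler_wpM2l (eta_ge0 s) (Gc s s0)) _.
  rewrite mulrDr [eta s * c]mulrC lerD2l.
  have -> : eta s * (k * s) = k * (s * eta s) by ring.
  have -> : 4 * k * expR (- (N / 2 * s)) = k * (4 * expR (- (N / 2 * s))) by ring.
  by rewrite ler_wpM2l// mul_eta_le.
Qed.

End eta.

(** * Bounded semigroups and weak integrals against integrable weights *)

Section semigroup.
Context {R : realType} {H : lmodType (complex R)}.
Variable ip : H -> H -> complex R.
Local Notation C := (complex R).
Local Notation nrm := (hnorm ip).
Implicit Type T : R -> H -> H.

(** The bound is an explicit parameter rather than a supremum, so that the damped semigroups can be
    used with the same [Cb]. *)
Definition bdd_sg T (Cb : R) := [/\
  forall t, 0 <= t -> forall a x y, T t (a *: x + y) = a *: T t x + T t y,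
  forall x, T 0 x = x,
  forall s t, 0 <= s -> 0 <= t -> forall x, T (s + t) x = T s (T t x),
  forall t, 0 <= t -> forall x, nrm (T t x) <= Cb * nrm x &
  forall x e, 0 < e -> exists2 d : R, 0 < d & forall t, 0 <= t -> t <= d -> nrm (T t x - x) <= e].

(* Weak orbits, frozen at their initial value for negative times so that they are continuous. *)
Definition orb T x y (t : R) : C := ip (T (Num.max 0 t) x) y.

Definition is_sop T (b : R -> C) (S : H -> H) :=
  is_bounded_op ip S /\ forall x y, ip (S x) y = cint setT (fun t => b t * orb T x y t).

(** The weak integral of b(t) T_t over the half-line, for b vanishing on t < 0. The value [id] is a
    default for weights without such an operator. *)
Definition sop T (b : R -> C) : H -> H :=
  if pselect (exists S, is_sop T b S) is left p then sval (cid p) else id.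

Definition damp (e : R) T (t : R) (x : H) : H := rC (expR (- (e * t))) *: T t x.

Lemma orb_damp e T x y t : is_inner_product ip ->
  orb (damp e T) x y t = rC (expR (- (e * Num.max 0 t))) * orb T x y t.
Proof. by move=> Hip; rewrite /orb /damp ipZl. Qed.

Lemma expRN_le1 (x : R) : 0 <= x -> expR (- x) <= 1.
Proof. by move=> x0; rewrite -expR0 ler_expR oppr_le0. Qed.

Lemma expRN_dist1 (x : R) : 0 <= x -> `|expR (- x) - 1| <= x.
Proof.
move=> x0; rewrite distrC ger0_norm ?subr_ge0 ?expRN_le1//.
by rewrite lerBlDl -lerBlDr; exact: expR_ge1Dx.
Qed.

Lemma bdd_sg_damp e T Cb : is_inner_product ip -> 0 <= e -> bdd_sg T Cb -> bdd_sg (damp e T) Cb.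
Proof.
move=> Hip e0 [TL T0 TD TB TC]; split.
- by move=> t t0 a x y; rewrite /damp TL// scalerDr !scalerA mulrC.
- by move=> x; rewrite /damp mulr0 oppr0 expR0 T0 scale1r.
- move=> s t s0 t0 x; rewrite /damp TD//.
  have -> (c : C) v : T s (c *: v) = c *: T s v.
    have TZ0 : T s 0 = 0.
      by have := TL s s0 (-1) (0 : H) 0; rewrite scaler0 addr0 scaleN1r addNr.
    by have := TL s s0 c v 0; rewrite TZ0 !addr0.
  by rewrite scalerA -rCM -expRD; congr (rC (expR _) *: _); ring.
- move=> t t0 x; rewrite /damp nrmZ// cabs_rC ger0_norm ?expR_ge0//.
  apply: le_trans (TB t t0 x); rewrite ler_piMl ?nrm_ge0//.
  by rewrite expRN_le1// mulr_ge0.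
- move=> x e1 e10; have e20 : 0 < e1 / 2 by rewrite divr_gt0.
  have [d d0 Hd] := TC x _ e20.
  have w0 : 0 < e * nrm x + 1 by rewrite ltr_wpDl// mulr_ge0 ?nrm_ge0.
  exists (Num.min d (e1 / 2 / (e * nrm x + 1))).
    by rewrite lt_min d0 divr_gt0.
  move=> t t0; rewrite le_min => /andP[td]; rewrite ler_pdivlMr// => te.
  have -> : damp e T t x - x =
     rC (expR (- (e * t))) *: (T t x - x) + rC (expR (- (e * t)) - 1) *: x.
    by rewrite /damp rCD rCN rC1 scalerBr scalerBl scale1r addrA subrK.
  apply: le_trans (nrmD Hip _ _) _; rewrite !nrmZ// !cabs_rC [e1]splitr lerD//.
    apply: le_trans (Hd t t0 td); rewrite ler_piMl ?nrm_ge0// ger0_norm ?expR_ge0//.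
    by rewrite expRN_le1// mulr_ge0.
  apply: le_trans te; apply: (@le_trans _ _ (e * t * nrm x)).
    by rewrite ler_wpM2r ?nrm_ge0// expRN_dist1// mulr_ge0.
  by rewrite mulrDr mulr1 mulrCA mulrA lerDl.
Qed.

Variables (T : R -> H -> H) (Cb : R).
Hypotheses (HH : is_hilbert ip) (Cb0 : 0 < Cb) (SG : bdd_sg T Cb).
Let Hip : is_inner_product ip. Proof. by have [] := HH. Qed.

(** T_t x - T_s x = T_s (T_(t-s) x - x) for s <= t, so continuity at 0 and the uniform bound make
    the orbit uniformly continuous. *)
Lemma sg_unif x e : 0 < e -> exists2 d : R, 0 < d &
  forall s t, 0 <= s -> 0 <= t -> `|s - t| <= d -> nrm (T s x - T t x) <= e.
Proof.
move=> e0; have [TL T0 TD TB TC] := SG.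
have [d d0 Hd] := TC x _ (divr_gt0 e0 Cb0); exists d => //.
have aux s t : 0 <= s -> s <= t -> t - s <= d -> nrm (T t x - T s x) <= e.
  move=> s0 st td; have ts0 : 0 <= t - s by rewrite subr_ge0.
  have -> : T t x - T s x = T s (T (t - s) x - x).
    have -> : T t x = T s (T (t - s) x) by rewrite -TD// subrKC.
    by rewrite [LHS]addrC -scaleN1r -TL// scaleN1r; congr (T s _); exact: addrC.
  apply: le_trans (TB s s0 _) _; rewrite -ler_pdivlMl// mulrC.
  exact: Hd.
move=> s t s0 t0; have [st|/ltW st] := leP t s.
  by rewrite ger0_norm ?subr_ge0// => h; exact: aux.
by rewrite distrC ger0_norm ?subr_ge0// => h; rewrite nrm_distC//; exact: aux.
Qed.

Lemma cabs_orb x y t : cabs (orb T x y t) <= Cb * nrm x * nrm y.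
Proof.
apply: le_trans (cauchy_schwarz Hip _ _) _; rewrite ler_wpM2r ?nrm_ge0//.
by have [_ _ _ TB _] := SG; exact: TB (max0_ge0 _) _.
Qed.

Lemma orb_bound_ge0 x y : 0 <= Cb * nrm x * nrm y.
Proof. by rewrite !mulr_ge0 ?nrm_ge0// ltW. Qed.

Lemma orb_unif x y e : 0 < e -> exists2 d : R, 0 < d &
  forall s t, `|s - t| <= d -> cabs (orb T x y s - orb T x y t) <= e.
Proof.
move=> e0; have w0 : 0 < nrm y + 1 by rewrite ltr_wpDl// nrm_ge0.
have [d d0 Hd] := sg_unif x (divr_gt0 e0 w0); exists d => // s t st.
rewrite /orb -ipBl//; apply: le_trans (cauchy_schwarz Hip _ _) _.
have h : nrm (T (Num.max 0 s) x - T (Num.max 0 t) x) <= e / (nrm y + 1).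
  by apply: Hd; rewrite ?max0_ge0// (le_trans (maxr0_lip _ _)).
apply: le_trans (ler_wpM2r (nrm_ge0 ip y) h) _.
by rewrite mulrAC ler_pdivrMr// ler_wpM2l ?(ltW e0)// lerDl.
Qed.

Lemma ccont_orb x y : ccont (orb T x y).
Proof.
move=> t; apply/cvgrPdist_le => e e0; have [d d0 Hd] := orb_unif x y e0.
near=> s; rewrite sub0r normrN ger0_norm ?cabs_ge0//; apply: Hd; rewrite distrC.
by near: s; exact: cvgr_dist_le (@cvg_id _ (nbhs t)) _ d0.
Unshelve. all: by end_near. Qed.

Lemma cmeas_orb x y : cmeas setT (orb T x y). Proof. exact: cmeas_ccont (@ccont_orb x y). Qed.

Lemma orb_linl c x y z t : orb T (c *: x + y) z t = c * orb T x z t + orb T y z t.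
Proof.
by have [TL _ _ _ _] := SG; rewrite /orb TL ?max0_ge0// ip_lin.
Qed.

Lemma orb_linr c x y z t : orb T z (c *: x + y) t = cconj c * orb T z x t + orb T z y t.
Proof. by rewrite /orb ipDr// ipZr. Qed.

Lemma orb_add x y s t : 0 <= s -> 0 <= t -> orb T x y (s + t) = ip (T s (T t x)) y.
Proof. by move=> s0 t0; have [_ _ TD _ _] := SG; rewrite /orb max_r ?addr_ge0// TD. Qed.

Lemma cintegrable_orb b x y : cintegrable setT b -> cintegrable setT (fun t => b t * orb T x y t).
Proof.
by move=> bi; apply: (cintegrable_mulb _ bi (cmeas_orb x y)) => // t _; exact: cabs_orb.
Qed.

Lemma sop_form b : cintegrable setT b -> exists S : H -> H,
  [/\ is_bounded_op ip S, forall x y, ip (S x) y = cint setT (fun t => b t * orb T x y t) &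
   forall x, nrm (S x) <= Cb * L1norm b * nrm x].
Proof.
move=> bi; apply: (bounded_op_of_form HH).
- by rewrite mulr_ge0 ?L1norm_ge0// ltW.
- move=> c x y z; rewrite -cintZ//; last exact: cintegrable_orb.
  rewrite -cintD//; [|by apply: cintegrableZ => //; exact: cintegrable_orb|exact: cintegrable_orb].
  by apply: eq_cint => t _; rewrite orb_linl mulrDr mulrCA.
- move=> c x y z; rewrite -cintZ//; last exact: cintegrable_orb.
  rewrite -cintD//; [|by apply: cintegrableZ => //; exact: cintegrable_orb|exact: cintegrable_orb].
  by apply: eq_cint => t _; rewrite orb_linr mulrDr mulrCA.
- move=> x y; apply: le_trans (cabs_cint_mulb bi (cmeas_orb x y) (cabs_orb x y)) _.
  by rewrite le_eqVlt; apply/orP; left; apply/eqP; ring.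
Qed.

Lemma sopP b : cintegrable setT b -> is_sop T b (sop T b).
Proof.
move=> /sop_form [S [S1 S2 _]]; rewrite /sop; case: pselect => [p|[]]; first exact: (svalP (cid p)).
by exists S.
Qed.

Lemma ip_sop b x y : cintegrable setT b -> ip (sop T b x) y = cint setT (fun t => b t * orb T x y t).
Proof. by move=> /sopP[_]. Qed.

Lemma sop_op b : cintegrable setT b -> is_bounded_op ip (sop T b).
Proof. by move=> /sopP[]. Qed.

Lemma nrm_sop b x : cintegrable setT b -> nrm (sop T b x) <= Cb * L1norm b * nrm x.
Proof.
move=> bi; have [S [_ S2 S3]] := sop_form bi.
have -> : sop T b x = S x by apply: (ip_inj Hip) => z; rewrite ip_sop// S2.
exact: S3.
Qed.

Lemma adj_exists t : 0 <= t -> exists S', (forall x y, ip (T t x) y = ip x (S' y)) /\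
  forall y, nrm (S' y) <= Cb * nrm y.
Proof.
by move=> t0; have [TL _ _ TB _] := SG; apply: (adjoint_exists HH (ltW Cb0)); [exact: TL|exact: TB].
Qed.

(** The integral is defined weakly, so T_t is moved into it by passing its adjoint to y and back. *)
Lemma ip_sg_sop b x y t : cintegrable setT b -> (forall s, s < 0 -> b s = 0) -> 0 <= t ->
  ip (T t (sop T b x)) y = cint setT (fun s => b s * orb T x y (s + t)).
Proof.
move=> bi b0 t0; have [T' [hT' _]] := adj_exists t0.
rewrite hT' ip_sop//; apply: eq_cint => s _.
have [s0|/b0 ->] := leP 0 s; last by rewrite !mul0r.
by congr (_ * _); rewrite addrC orb_add// hT' /orb max_r.
Qed.

(** Only one factor [Cb] appears, because T_t is absorbed into T_(s+t) instead of being estimated on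
    its own. This keeps the final constant at C^2 in spite of the smoothing of x. *)
Lemma nrm_sg_sop b x t : cintegrable setT b -> (forall s, s < 0 -> b s = 0) -> 0 <= t ->
  nrm (T t (sop T b x)) <= Cb * L1norm b * nrm x.
Proof.
move=> bi b0 t0; apply: (nrm_le_ip Hip).
  by rewrite !mulr_ge0 ?L1norm_ge0 ?nrm_ge0// ltW.
move=> y; rewrite ip_sg_sop//.
apply: le_trans (cabs_cint_mulb bi (cmeas_shift t (cmeas_orb x y)) (fun s => cabs_orb x y (s + t))) _.
by rewrite le_eqVlt; apply/orP; left; apply/eqP; ring.
Qed.

End semigroup.

(** * The test kernels and their pairing with A_0 *)

Section multiplier.
Context {R : realType} {H : lmodType (complex R)}.
Variable ip : H -> H -> complex R.
Local Notation C := (complex R).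
Local Notation nrm := (hnorm ip).

Lemma ccvg_le (u : nat -> C) l (K : R) : ccvg u l -> (forall n, cabs (u n) <= K) -> cabs l <= K.
Proof.
move=> /ccvg_epsP ul uK; apply/ler_addgt0Pr => e /ul[n /(_ n (leqnn n)) un].
have -> : l = u n - (u n - l) by rewrite opprB subrKC.
by apply: le_trans (cabsB _ _) _; rewrite lerD.
Qed.

Lemma pos_lt0 (f : R -> C) t : t < 0 -> pos f t = 0.
Proof. by rewrite /pos leNgt => ->. Qed.

Lemma ccvg_eps_harm (u : nat -> C) l :
  (forall e, 0 < e -> exists K : R, forall n, cabs (u n - l) <= e + K * n.+1%:R^-1) -> ccvg u l.
Proof.
move=> h; apply/ccvg_epsP => e e0; have e20 : 0 < e / 2 by rewrite divr_gt0.
have [K HK] := h _ e20.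
have [m Hm] : exists m : nat, `|K| / (e / 2) <= m%:R.
  exists (Num.truncn (`|K| / (e / 2))).+1; apply: ltW; apply: truncnS_gt.
exists m => n mn; apply: le_trans (HK n) _; rewrite [leRHS]splitr lerD2l.
rewrite ler_pdivrMr//; apply: le_trans (ler_norm _) _; rewrite mulrC -ler_pdivrMr//.
by apply: le_trans Hm _; rewrite ler_nat (leq_trans mn).
Qed.

Variables (T : R -> H -> H) (Cb : R).
Hypotheses (HH : is_hilbert ip) (Cb0 : 0 < Cb) (SG : bdd_sg ip T Cb).
Let Hip : is_inner_product ip. Proof. by have [] := HH. Qed.

Section fixed_parameters.
Variables (N y : R).
Hypotheses (N0 : 0 < N) (y0 : 0 < y).
Local Notation etaC := (fun s => rC (eta N s)).

(** The weight that smooths the vector x; its L1 norm is at most 1, so the smoothing costs nothing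
    in the bounds. *)
Definition smooth_weight (s : R) : C := rC (eta N s * expR (- (y * s))).

Lemma smooth_weight_neg s : s < 0 -> smooth_weight s = 0.
Proof. by move=> s0; rewrite /smooth_weight eta_neg ?mul0r// ltW. Qed.

Lemma cabs_smooth_weight s : cabs (smooth_weight s) <= eta N s.
Proof.
have [s0|s0] := leP 0 s; last by rewrite smooth_weight_neg// cabs0 eta_ge0.
have e0 : 0 <= eta N s by exact: eta_ge0.
rewrite /smooth_weight cabs_rC normrM !ger0_norm ?expR_ge0//; apply: ler_piMr => //.
by rewrite expRN_le1// mulr_ge0// ltW.
Qed.

Lemma cmeas_rC_expR (a : R) : cmeas setT (fun s => rC (expR (- (a * s)))).
Proof.
by apply: cmeas_ccont; apply: ccontP => x; [exact: continuous_expR_lin|exact: cvg_cst].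
Qed.

Lemma cintegrable_smooth_weight : cintegrable setT smooth_weight.
Proof.
apply: (@cintegrable_le _ _ _ (eta N)) => //.
- apply: (@cmeas_ext _ _ (fun s => etaC s * rC (expR (- (y * s))))).
    by move=> s _; rewrite -rCM.
  by apply: cmeasM; [exact: cmeas_eta|exact: cmeas_rC_expR].
- by have [] := cintegrable_eta N0.
- by move=> s _; exact: cabs_smooth_weight.
Qed.

Lemma L1norm_smooth_weight : L1norm smooth_weight <= 1.
Proof.
rewrite -(Rintegral_eta N0); apply: le_Rintegral => //.
- exact: integrable_cabs cintegrable_smooth_weight.
- by have [] := cintegrable_eta N0.
- by move=> s _; exact: cabs_smooth_weight.
Qed.

Variables x z : H.
Let K := Cb * nrm x * nrm z.
Let K0 : 0 <= K. Proof. exact: orb_bound_ge0. Qed.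

(** Damping makes the bounded orbit integrable, so that it has a transform. *)
Definition dorb : R -> C := pos (fun r => rC (expR (- (y * r))) * orb ip T x z r).

(* The inverse transform of the smoothed damped orbit, see [chk_multE]. *)
Definition mult (u : R) : C := rC (2 * pi)^-1 * (chk etaC u * chk dorb (- u)).

Lemma cabs_dorb_le r : 0 <= r -> cabs (dorb r) <= expR (- (y * r)) * K.
Proof.
move=> r0; rewrite /dorb /pos r0 cabsM cabs_rC ger0_norm ?expR_ge0//.
by rewrite ler_wpM2l ?expR_ge0// cabs_orb.
Qed.

Lemma cabs_dorb r : cabs (dorb r) <= K.
Proof.
have [r0|r0] := leP 0 r; last by rewrite /dorb pos_lt0// cabs0.
apply: le_trans (cabs_dorb_le r0) _; rewrite ler_piMl//.
by rewrite expRN_le1// mulr_ge0// ltW.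
Qed.

Lemma cmeas_dorb : cmeas setT dorb.
Proof.
apply: cmeas_pos; apply: cmeasM; first exact: cmeas_rC_expR.
exact: (cmeas_orb HH Cb0 SG).
Qed.

Lemma cintegrable_dorb : cintegrable setT dorb.
Proof.
apply: (@cintegrable_le _ _ _ (fun r => K * (if 0 <= r then expR (- (y * r)) else 0))) => //.
- exact: cmeas_dorb.
- exact: (lintegrableZ _ measurableT (integrable_pos_expR y0)).
- move=> r _; case: (leP 0 r) => r0; first by rewrite mulrC; exact: cabs_dorb_le.
  by rewrite /dorb pos_lt0// cabs0 mulr0.
Qed.

Lemma cintegrable_mult : cintegrable setT mult.
Proof.
apply: cintegrableZ => //; apply: (cintegrable_mulb _ (cintegrable_chk_eta N0)) => //.
  by apply: cmeas_opp; apply: cmeas_chk; exact: cmeas_dorb.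
by move=> u _; apply: cabs_chk; exact: cintegrable_dorb.
Qed.

(** [mult] is a product of two transforms, so [chk] returns a correlation; the step back to [eta] is
    [eta_inversion], which rests on the integrability of its transform. *)
Lemma chk_mult t : chk mult t = cint setT (fun r => dorb r * rC (eta N (r - t))).
Proof.
have ie := cintegrable_chk_eta N0.
have mk : jmeas (fun p : R * R => ei (p.1 * (t - p.2))).
  by apply: jmeas_ei; apply: measurable_funM => //; exact: measurable_funB.
have bk (p : R * R) : cabs (ei (p.1 * (t - p.2))) <= 1 by rewrite cabs_ei.
have id_ := cintegrable_dorb.
have -> : chk mult t = rC (2 * pi)^-1 *
    cint setT (fun u => chk etaC u * cint setT (fun r => dorb r * ei (u * (t - r)))).
  rewrite -cintZ//; last first.
    apply: (@cintegrable_mulb _ _ _ _ (L1norm dorb)) => //.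
      exact: (cmeas_cint_kernel (cintegrable_meas id_) mk).
    move=> u _; rewrite -[leRHS]mul1r; apply: (cabs_cint_mulb id_).
      by apply: (cmeas_comp cmeas_ei); apply: measurable_funM => //; exact: measurable_funB.
    by move=> r; rewrite cabs_ei.
  apply: eq_cint => u _; rewrite /mult -!mulrA; congr (_ * (_ * _)).
  rewrite -cintZr//; last first.
    apply: (cintegrable_mulb _ id_ (cmeas_ei_mul (- u))) => // r _; by rewrite cabs_ei.
  by apply: eq_cint => r _; rewrite -mulrA -eiD; congr (_ * ei _); ring.
rewrite (cint_fubini ie id_ mk bk) -cintZ//; last first.
  apply: (@cintegrable_mulb _ _ _ _ (L1norm (chk etaC))) => //.
    apply: (cmeas_cint_kernel (k := fun p : R * R => ei (p.2 * (t - p.1))) (cintegrable_meas ie)).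
    by apply: jmeas_ei; apply: measurable_funM => //; exact: measurable_funB.
  move=> r _; rewrite -[leRHS]mul1r; apply: (cabs_cint_mulb ie).
    exact: (cmeas_ei_mul (t - r)).
  by move=> u; rewrite cabs_ei.
apply: eq_cint => r _ /=; rewrite mulrCA; congr (_ * _).
have me : cmeas setT (fun u => chk etaC u * ei (u * (t - r))).
  by apply: cmeasM; [exact: cintegrable_meas|exact: cmeas_ei_mul].
rewrite -(cint_opp me).
rewrite (@eq_cint _ _ _ (fun u => chk etaC (- u) * ei (u * (r - t)))); last first.
  by move=> u _; congr (_ * ei _); ring.
by rewrite eta_inversion// mulrA -rCM mulVf ?mul1r// mulf_neq0 ?gt_eqF ?pi_gt0.
Qed.

Lemma chk_mult_shift t : chk mult t = cint setT (fun s => etaC s * dorb (s + t)).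
Proof.
rewrite chk_mult.
have me : cmeas setT (fun r => dorb r * rC (eta N (r - t))).
  by apply: cmeasM; [exact: cmeas_dorb|apply: (cmeas_shift (- t) (cmeas_eta _))].
by rewrite -(cint_shift t me); apply: eq_cint => s _; rewrite addrK mulrC.
Qed.

Lemma cabs_chk_mult t : cabs (chk mult t) <= K.
Proof.
rewrite chk_mult_shift -[leRHS]mulr1 -(L1norm_eta N0).
apply: (cabs_cint_mulb (cintegrable_eta N0)); first exact: (cmeas_shift t cmeas_dorb).
by move=> s; exact: cabs_dorb.
Qed.

(** As [eta] lives on s >= 0, the damping at s + t splits and the average over s is absorbed into
    the vector. On t >= 0 the transform of the kernel is thus an exact orbit of a damped semigroup,
    which has the Hankel structure that [core_estimate] requires. *)
Lemma chk_multE t : 0 <= t ->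
  chk mult t = rC (expR (- (y * t))) * orb ip T (sop ip T smooth_weight x) z t.
Proof.
move=> t0; rewrite chk_mult_shift /orb max_r//.
rewrite (ip_sg_sop HH Cb0 SG _ _ cintegrable_smooth_weight smooth_weight_neg t0).
rewrite -cintZ//; last first.
  apply: (cintegrable_mulb _ cintegrable_smooth_weight (cmeas_shift t (cmeas_orb HH Cb0 SG x z))) => // s _.
  exact: cabs_orb SG _ _ _.
apply: eq_cint => s _; have [s0|s0] := leP 0 s; last first.
  by rewrite smooth_weight_neg// eta_neg ?(ltW s0)// !mul0r mulr0.
rewrite /dorb /pos addr_ge0// /smooth_weight !mulrA -!rCM; congr (rC _ * _).
by rewrite mulrDr opprD expRD; ring.
Qed.

(** The terms come from the modulus of continuity (e), from the damping (y K t), and from a slope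
    times the first moment of [eta]. For s > d the trivial bound 2 K is at most 2 K s / d and so
    joins the slope. *)
Lemma mult_near t d e : 0 <= t -> 0 < d -> 0 <= e ->
  (forall s, 0 <= s -> s <= d -> cabs (orb ip T x z (s + t) - orb ip T x z t) <= e) ->
  cabs (chk mult t - orb ip T x z t) <= e + y * K * t + (2 * K / d + y * K) * (8 / N).
Proof.
move=> t0 d0 e0 h; rewrite chk_mult_shift.
have Kd0 : 0 <= 2 * K / d by apply: divr_ge0; [exact: mulr_ge0|exact: ltW].
have yK0 : 0 <= y * K by apply: mulr_ge0 => //; exact: ltW.
apply: (eta_average N0 (cmeas_shift t cmeas_dorb) (fun s => cabs_dorb (s + t))).
  exact: addr_ge0.
move=> s s0; rewrite /dorb /pos addr_ge0//.
have -> : rC (expR (- (y * (s + t)))) * orb ip T x z (s + t) - orb ip T x z t =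
    (orb ip T x z (s + t) - orb ip T x z t) + rC (expR (- (y * (s + t))) - 1) * orb ip T x z (s + t).
  by rewrite rCD rCN rC1; ring.
apply: le_trans (cabsD _ _) _.
have h1 : cabs (orb ip T x z (s + t) - orb ip T x z t) <= e + 2 * K / d * s.
  have [sd|/ltW sd] := leP s d; first by rewrite (le_trans (h s s0 sd))// lerDl mulr_ge0.
  apply: le_trans (cabsB _ _) _; apply: (@le_trans _ _ (2 * K)).
    by rewrite mulr_natl mulr2n lerD// cabs_orb.
  by rewrite ler_wpDl// mulrAC ler_pdivlMr// ler_wpM2l// mulr_ge0.
have h2 : cabs (rC (expR (- (y * (s + t))) - 1) * orb ip T x z (s + t)) <= y * (s + t) * K.
  rewrite cabsM cabs_rC ler_pM ?cabs_ge0//; last exact: cabs_orb.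
  by rewrite expRN_dist1// mulr_ge0 ?addr_ge0// ltW.
apply: le_trans (lerD h1 h2) _; rewrite le_eqVlt; apply/orP; left; apply/eqP; ring.
Qed.

Section pairing.

Lemma mult_eq0 u : nrm x * nrm z = 0 -> mult u = 0.
Proof.
move=> e0; have d0 r : dorb r = 0.
  apply: cabs_eq0; apply/eqP; rewrite eq_le cabs_ge0 andbT.
  by apply: le_trans (cabs_dorb r) _; rewrite /K -mulrA e0 mulr0.
rewrite /mult (_ : chk dorb _ = 0) ?mulr0// /chk.
by rewrite (@eq_cint _ _ _ (fun=> 0)) ?cint0// => t _; rewrite d0 mul0r.
Qed.

(** For an inverse transform in place of f the pairing is 1 / (2 pi) times the integral treated by
    [core_estimate]. There the orbits of the smoothed x and of z under the adjoints are bounded by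
    [Cb] |x| and [Cb] |z|, which gives [Cb]^2; the factors 2 pi cancel. *)
Lemma mult_conv_chk f0 (A d Kf : R) h : ccont f0 -> (forall u, A <= `|u| -> f0 u = 0) ->
  (forall u, cabs (f0 u) <= Kf) -> 0 < d -> is_H1 h -> 0 < nrm x -> 0 < nrm z ->
  cabs (cint setT (fun u => mult u * Defs.conv (chk (gab f0 d)) h u)) <=
    Cb ^+ 2 * nrm x * nrm z * (Kf * L1norm h).
Proof.
move=> cf fA fK d0 hH x0 z0; have [hi h0] := hH.
pose A' := Num.max A 1.
have A'0 : 0 < A' by rewrite lt_max ltr01 orbT.
have fA' u : A' <= `|u| -> f0 u = 0.
  by rewrite ge_max => /andP[+ _]; exact: fA.
have fi : cintegrable setT f0 := cintegrable_compact cf fA'.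
have gi := cintegrable_gab fi d0.
have ghi := cintegrable_mul_fourier gi hi.
under eq_cint do rewrite conv_chk//.
rewrite (chk_exchange cintegrable_mult ghi).
pose phi t := rC (expR (- (d * t))) * chk mult t.
rewrite (@eq_cint _ _ _ (fun t => rC (2 * pi)^-1 * (fourier f0 t * fourier h t * pos phi t))); last first.
  move=> t _; have [t0|t0] := leP t 0; first by rewrite h0// !(mulr0, mul0r).
  rewrite /gab /eabs /pos (ltW t0) ger0_norm ?(ltW t0)// /phi.
  by ring.
(* The decay of rate d + y is shared between the two vectors. An adjoint of T_t is chosen for each t
   >= 0, and 0 is a default for negative t. *)
have phiE : forall s t, 0 <= s -> 0 <= t -> phi (s + t) =
    ip (rC (expR (- ((d + y) * s))) *: T s (sop ip T smooth_weight x))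
       (rC (expR (- ((d + y) * t))) *: (if pselect (0 <= t) is left p then sval (cid (adj_exists HH Cb0 SG p)) z else 0)).
  move=> s t s0 t0; case: pselect => // p; case: cid => T' /= [T'E _].
  rewrite /phi chk_multE ?addr_ge0// mulrA -rCM [s + t]addrC (orb_add SG)// T'E ipZl// ipZr// cconj_rC mulrA.
  rewrite -rCM -!expRD; congr (rC (expR _) * _); ring.
have ed t : 0 <= t -> cabs (rC (expR (- ((d + y) * t)))) <= 1.
  move=> t0; rewrite cabs_rC ger0_norm ?expR_ge0// expRN_le1// mulr_ge0//.
  by rewrite addr_ge0// ltW.
have phii : cintegrable setT (pos phi).
  apply: (@cintegrable_le _ _ _ (fun r => K * (if 0 <= r then expR (- (d * r)) else 0))) => //.
  - apply: cmeas_pos; apply: cmeasM; first exact: cmeas_rC_expR.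
    exact: cmeas_chk (cintegrable_meas cintegrable_mult).
  - exact: (lintegrableZ _ measurableT (integrable_pos_expR d0)).
  - move=> r _; rewrite /pos; case: ifP => r0; last by rewrite cabs0 mulr0.
    rewrite cabsM cabs_rC ger0_norm ?expR_ge0// mulrC ler_wpM2r ?expR_ge0//.
    exact: cabs_chk_mult.
rewrite cintZ//; last first.
  apply: (@cintegrable_bmul _ _ (pos phi) _ (L1norm f0 * L1norm h)) => //.
    by apply: cmeasM; apply: cmeas_fourier; exact: cintegrable_meas.
  by move=> t _; rewrite cabsM ler_pM ?cabs_ge0 ?cabs_fourier.
have p0 : 0 < 2 * @pi R by rewrite mulr_gt0 ?pi_gt0.
rewrite cabsM cabs_rC gtr0_norm ?invr_gt0// ler_pdivrMl//.
have -> : Cb ^+ 2 * nrm x * nrm z * (Kf * L1norm h) = Kf * (Cb * nrm x * (Cb * nrm z) * L1norm h) by ring.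
apply: (core_estimate Hip cf A'0 fA' fK hH _ _ phiE) => //; rewrite ?mulr_gt0//.
- move=> s s0; rewrite nrmZ//; apply: le_trans (ler_wpM2r _ (ed s s0)) _; first exact: nrm_ge0.
  rewrite mul1r; apply: le_trans (nrm_sg_sop HH Cb0 SG x cintegrable_smooth_weight smooth_weight_neg s0) _.
  rewrite mulrAC ler_piMr ?L1norm_smooth_weight// mulr_ge0// ltW//.
- move=> t t0; case: pselect => // p; case: cid => T' /= [_ T'B].
  by rewrite nrmZ//; apply: le_trans (ler_wpM2r _ (ed t t0)) _; rewrite ?mul1r ?nrm_ge0.
Qed.

(** [C0_approx] changes f uniformly by an arbitrarily small amount without raising the bound
    [supnorm f] on its truncation; the remainder is paired crudely through the L1 norms of h and
    [mult]. *)
Lemma mult_conv f h : is_C0 f -> is_H1 h ->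
  cabs (cint setT (fun u => mult u * Defs.conv f h u)) <=
    Cb ^+ 2 * nrm x * nrm z * (supnorm f * L1norm h).
Proof.
move=> hf hH; have [hi _] := hH.
(* [core_estimate] takes positive bounds for both orbits, so the case of a vanishing vector is
   settled first. *)
have [e0|e0] := eqVneq (nrm x * nrm z) 0.
  rewrite (@eq_cint _ _ _ (fun=> 0)) ?cint0 ?cabs0; last by move=> u _; rewrite mult_eq0// mul0r.
  by rewrite !mulr_ge0 ?nrm_ge0 ?supnorm_ge0 ?L1norm_ge0 ?exprn_ge0// ltW.
have [x0 z0] : 0 < nrm x /\ 0 < nrm z.
  by move: e0; rewrite mulf_eq0 negb_or => /andP[a b]; rewrite !lt_neqAle ![0 == _]eq_sym a b !nrm_ge0.
have im := cintegrable_mult.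
apply/ler_addgt0Pr => e epos.
pose W := L1norm h * L1norm mult + 1.
have W0 : 0 < W by rewrite ltr_wpDl// mulr_ge0 ?L1norm_ge0.
have [f0 [A [d [cf fA fK d0 [gC0 gf]]]]] := C0_approx hf (divr_gt0 epos W0).
have mC g : is_C0 g -> cmeas setT g by move=> /is_C0_ccont/cmeas_ccont.
have mhm : cmeas setT h := cintegrable_meas hi.
have iconv g : is_C0 g -> cintegrable setT (fun u => mult u * Defs.conv g h u).
  move=> hg; apply: (@cintegrable_mulb _ _ mult (Defs.conv g h) (supnorm g * L1norm h)) => //.
    by apply: cmeas_conv => //; exact: mC.
  by move=> u _; exact: cabs_conv_C0.
rewrite (@eq_cint _ _ _ (fun u => mult u * Defs.conv (chk (gab f0 d)) h u +
    mult u * Defs.conv (fun t => f t - chk (gab f0 d) t) h u)); last first.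
  by move=> u _; rewrite convB// -mulrDr addrC subrK.
rewrite cintD//; [|exact: iconv|by apply: iconv; exact: is_C0B].
apply: le_trans (cabsD _ _) _; apply: lerD; first exact: (mult_conv_chk cf fA fK d0 hH x0 z0).
apply: (@le_trans _ _ (e / W * L1norm h * L1norm mult)).
  apply: (cabs_cint_mulb im); first by apply: cmeas_conv => //; apply: mC; exact: is_C0B.
  by move=> u; apply: cabs_conv => //; apply: mC; exact: is_C0B.
rewrite -mulrA mulrAC ler_pdivrMr// ler_wpM2l ?(ltW epos)// /W lerDl//.
Qed.

Lemma mult_A0 F f h S : A0_rep F f h S ->
  cabs (cint setT (fun u => mult u * F u)) <= Cb ^+ 2 * nrm x * nrm z * S.
Proof.
move=> rep; have [fC [hH [cS _]]] := rep.
have c0 : 0 <= Cb ^+ 2 * nrm x * nrm z by rewrite !mulr_ge0 ?nrm_ge0 ?exprn_ge0// ltW.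
apply: (ccvg_le (A0_rep_pairing rep cintegrable_mult)) => n.
apply: le_trans (cabs_sum _ _ _) _.
apply: (@le_trans _ _ (\sum_(0 <= k < n) Cb ^+ 2 * nrm x * nrm z * (supnorm (f k) * L1norm (h k)))).
  by apply: ler_sum => k _; exact: mult_conv.
rewrite -mulr_sumr ler_wpM2l//.
by apply: (nneg_series_le n _ cS) => k; exact: A0_terms_ge0.
Qed.

End pairing.
End fixed_parameters.

(** Concentration n + 1 and damping rate 1 / (n + 1); the rate is also the height of the line used
    in [Lam]. *)
Definition Mn n (x z : H) : R -> C := mult n.+1%:R n.+1%:R^-1 x z.

Lemma cintegrable_Mn n x z : cintegrable setT (Mn n x z).
Proof. exact: cintegrable_mult. Qed.

Lemma cabs_chk_Mn n x z t : cabs (chk (Mn n x z) t) <= Cb * nrm x * nrm z.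
Proof. exact: cabs_chk_mult. Qed.

Lemma chk_Mn_cvg x z t : 0 <= t -> ccvg (fun n => chk (Mn n x z) t) (orb ip T x z t).
Proof.
move=> t0; apply: ccvg_eps_harm => e e0.
have [d d0 Hd] := orb_unif HH Cb0 SG x z e0.
have K0 := orb_bound_ge0 ip Cb0 x z; set K := (Cb * nrm x * nrm z) in K0.
exists (K * t + (2 * K / d + K) * 8) => n.
have n0 : 0 < n.+1%:R :> R by [].
apply: le_trans (mult_near n0 (harm_gt0 n) t0 d0 (ltW e0) _) _.
  by move=> s s0 sd; apply: Hd; rewrite addrK ger0_norm.
have n1 : n.+1%:R^-1 <= 1 :> R by rewrite invf_le1// ler1n.
rewrite -/K; set q := n.+1%:R^-1 in n1 *; have q0 : 0 <= q by rewrite invr_ge0.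
have h : (2 * K / d + q * K) * (8 * q) <= (2 * K / d + K) * (8 * q).
  by rewrite ler_wpM2r ?mulr_ge0// lerD2l ler_piMl.
by rewrite -addrA lerD2l (le_trans (lerD (lexx _) h))// le_eqVlt; apply/orP; left; apply/eqP; ring.
Qed.

(* Testing [chk b] against the kernels [Mn n x z] and letting n tend to infinity. *)
Lemma sop_estimate b F1 f1 h1 S1 F2 f2 h2 S2 x z : cintegrable setT b ->
  (forall t, t < 0 -> b t = 0) -> A0_rep F1 f1 h1 S1 -> A0_rep F2 f2 h2 S2 ->
  (forall u, chk b u = F1 u - F2 u) ->
  cabs (cint setT (fun t => b t * orb ip T x z t)) <= Cb ^+ 2 * nrm x * nrm z * (S1 + S2).
Proof.
move=> bi b0 rep1 rep2 bE.
have iF F f h S n : A0_rep F f h S -> cintegrable setT (fun u => Mn n x z u * F u).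
  move=> rep; apply: (cintegrable_mulb _ (cintegrable_Mn n x z) (A0_rep_meas rep)) => // u _.
  exact: A0_rep_bound rep u.
apply: (@ccvg_le (fun n => cint setT (fun t => b t * chk (Mn n x z) t))).
  apply: (@cint_dominated _ _ _ _ (fun t => Cb * nrm x * nrm z * cabs (b t))) => //.
  - by move=> n; apply: cmeasM; [exact: cintegrable_meas|exact: cmeas_chk (cintegrable_meas (cintegrable_Mn n x z))].
  - by apply: cmeasM; [exact: cintegrable_meas|exact: (cmeas_orb HH Cb0 SG)].
  - exact: (lintegrableZ _ measurableT (integrable_cabs measurableT bi)).
  - by move=> n t _; rewrite cabsM mulrC ler_wpM2r ?cabs_ge0// cabs_chk_Mn.
  - move=> t _; have [t0|/b0 ->] := leP 0 t; last first.
      by apply/ccvg_epsP => e e0; exists 0%N => n _; rewrite !mul0r subrr cabs0 ltW.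
    have /ccvg_epsP h := chk_Mn_cvg x z t0.
    apply/ccvg_epsP => e e0; have w0 : 0 < cabs (b t) + 1 by rewrite ltr_wpDl ?cabs_ge0.
    have [n Hn] := h _ (divr_gt0 e0 w0); exists n => m nm; rewrite -mulrBr cabsM.
    apply: le_trans (ler_wpM2l (cabs_ge0 _) (Hn m nm)) _.
    by rewrite mulrC mulrAC ler_pdivrMr// ler_wpM2l ?(ltW e0)// lerDl.
move=> n; rewrite -(chk_exchange (cintegrable_Mn n x z) bi).
rewrite (@eq_cint _ _ _ (fun u => Mn n x z u * F1 u - Mn n x z u * F2 u)); last first.
  by move=> u _; rewrite bE mulrBr.
rewrite cintB//; [|exact: iF rep1|exact: iF rep2].
apply: le_trans (cabsB _ _) _; rewrite mulrDr; apply: lerD.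
  exact: (mult_A0 (ltr0Sn R n) (harm_gt0 n) x z rep1).
exact: (mult_A0 (ltr0Sn R n) (harm_gt0 n) x z rep2).
Qed.

End multiplier.

(** * Limits of complex sequences and of damped integrals *)

Section complex_limits.
Context {R : realType}.
Local Notation C := (complex R).

Lemma ccvg_cst (c : C) : ccvg (fun=> c) c.
Proof. by apply/ccvg_epsP => e e0; exists 0%N => n _; rewrite subrr cabs0 ltW. Qed.

Lemma ccvgD (u v : nat -> C) l m : ccvg u l -> ccvg v m -> ccvg (fun n => u n + v n) (l + m).
Proof.
move=> /ccvgP[ur ui] /ccvgP[vr vi]; apply/ccvgP; rewrite ReD ImD; split.
  rewrite (_ : (fun n => _) = (fun n => complex.Re (u n) + complex.Re (v n))); first exact: cvgD.
  by apply/funext => n; rewrite ReD.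
rewrite (_ : (fun n => _) = (fun n => complex.Im (u n) + complex.Im (v n))); first exact: cvgD.
by apply/funext => n; rewrite ImD.
Qed.

Lemma ccvgM (u v : nat -> C) l m : ccvg u l -> ccvg v m -> ccvg (fun n => u n * v n) (l * m).
Proof.
move=> /ccvgP[ur ui] /ccvgP[vr vi]; apply/ccvgP; rewrite ReM ImM; split.
  rewrite (_ : (fun n => _) = (fun n => complex.Re (u n) * complex.Re (v n) -
      complex.Im (u n) * complex.Im (v n))); first by apply: cvgB; exact: cvgM.
  by apply/funext => n; rewrite ReM.
rewrite (_ : (fun n => _) = (fun n => complex.Re (u n) * complex.Im (v n) +
    complex.Im (u n) * complex.Re (v n))); first by apply: cvgD; exact: cvgM.
by apply/funext => n; rewrite ImM.
Qed.

Lemma le_harm (a b K : R) : (forall j : nat, a <= b + K * j.+1%:R^-1) -> a <= b.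
Proof.
move=> h; apply/ler_addgt0Pr => e e0.
have [m Hm] : exists m : nat, `|K| / e <= m%:R.
  by exists (Num.truncn (`|K| / e)).+1; apply: ltW; exact: truncnS_gt.
apply: le_trans (h m) _; rewrite lerD2l ler_pdivrMr//; apply: le_trans (ler_norm _) _.
rewrite mulrC -ler_pdivrMr//; apply: le_trans Hm _; by rewrite ler_nat.
Qed.

(* The approximation of [L n] by [Q j n] becomes uniform in [n] by letting [i] tend to infinity in
   the Cauchy estimate. *)
Lemma ccvg_interchange (L : nat -> C) (Q : nat -> nat -> C) (q : nat -> C) l (A : nat -> R) (K K' : R) :
  (forall j n, cabs (Q j n - L n) <= A n * j.+1%:R^-1) ->
  (forall i j n, cabs (Q i n - Q j n) <= K * (i.+1%:R^-1 + j.+1%:R^-1)) ->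
  (forall j, ccvg (Q j) (q j)) -> (forall j, cabs (q j - l) <= K' * j.+1%:R^-1) -> ccvg L l.
Proof.
move=> QL QQ Qq ql.
have QL' j n : cabs (Q j n - L n) <= K * j.+1%:R^-1.
  apply: (@le_harm _ _ (K + A n)) => i.
  have -> : Q j n - L n = (Q j n - Q i n) + (Q i n - L n) by rewrite addrA subrK.
  apply: le_trans (cabsD _ _) _; apply: le_trans (lerD (QQ _ _ _) (QL _ _)) _.
  by rewrite le_eqVlt; apply/orP; left; apply/eqP; ring.
apply/ccvg_epsP => e e0; have e20 : 0 < e / 2 by rewrite divr_gt0.
have [m Hm] : exists m : nat, (`|K| + `|K'|) / (e / 2) <= m%:R.
  by exists (Num.truncn ((`|K| + `|K'|) / (e / 2))).+1; apply: ltW; exact: truncnS_gt.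
have [n Hn] := (ccvg_epsP _ _).1 (Qq m) _ e20; exists n => k nk.
have -> : L k - l = (q m - l) + (Q m k - q m) - (Q m k - L k) by ring.
apply: le_trans (cabsB _ _) _; apply: le_trans (lerD (cabsD _ _) (QL' _ _)) _.
apply: le_trans (lerD (lerD (ql m) (Hn k nk)) (lexx _)) _.
have h : (`|K| + `|K'|) * m.+1%:R^-1 <= e / 2.
  rewrite ler_pdivrMr// mulrC -ler_pdivrMr//; apply: le_trans Hm _; by rewrite ler_nat.
rewrite addrAC [leRHS]splitr lerD2r -mulrDl; apply: le_trans h.
by rewrite ler_wpM2r ?invr_ge0// addrC lerD// ler_norm.
Qed.

(** For b on the half-line, [chk] of this weight is the Laplace transform of b on the line Re w =
    h. *)
Definition bexp (h : R) (b : R -> C) (t : R) : C := b t * rC (expR (- (h * t))).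

Lemma cabs_bexp h b t : 0 <= h -> (forall s, s < 0 -> b s = 0) -> cabs (bexp h b t) <= cabs (b t).
Proof.
move=> h0 b0; rewrite cabsM; have [t0|/b0 ->] := leP 0 t; last by rewrite cabs0 mul0r.
by rewrite ler_piMr ?cabs_ge0// cabs_rC ger0_norm ?expR_ge0// expRN_le1// mulr_ge0.
Qed.

Lemma cintegrable_bexp h b : 0 <= h -> (forall s, s < 0 -> b s = 0) -> cintegrable setT b ->
  cintegrable setT (bexp h b).
Proof.
move=> h0 b0 bi; apply: (@cintegrable_le _ _ _ (fun t => cabs (b t))) => //.
- by apply: cmeasM; [exact: cintegrable_meas|exact: cmeas_rC_expR].
- exact: integrable_cabs.
- by move=> t _; exact: cabs_bexp.
Qed.

Lemma bexp_dominated b (G : nat -> R -> C) Gl (K : R) : cintegrable setT b ->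
  (forall t, t < 0 -> b t = 0) -> (forall n, cmeas setT (G n)) -> cmeas setT Gl ->
  (forall n t, cabs (G n t) <= K) -> (forall t, 0 <= t -> ccvg (G^~ t) (Gl t)) ->
  ccvg (fun n => cint setT (fun t => bexp n.+1%:R^-1 b t * G n t)) (cint setT (fun t => b t * Gl t)).
Proof.
move=> bi b0 mG mGl GK Gcvg.
have h0 n : 0 <= n.+1%:R^-1 :> R by rewrite invr_ge0.
apply: (@cint_dominated _ _ _ _ (fun t => K * cabs (b t))) => //.
- by move=> n; apply: cmeasM => //; apply: cintegrable_meas; exact: cintegrable_bexp.
- by apply: cmeasM => //; exact: cintegrable_meas.
- exact: (lintegrableZ _ measurableT (integrable_cabs measurableT bi)).
- move=> n t _; rewrite cabsM mulrC ler_pM ?cabs_ge0//.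
  exact: cabs_bexp.
- move=> t _; have [t0|/b0 bt] := leP 0 t; last first.
    rewrite /bexp bt mul0r; have -> : (fun n => 0 * rC (expR (- (n.+1%:R^-1 * t))) * G n t) = fun=> 0.
      by apply/funext => n; rewrite !mul0r.
    exact: ccvg_cst.
  rewrite /bexp -[b t in X in ccvg _ X]mulr1; apply: ccvgM; last exact: Gcvg.
  apply: ccvgM; first exact: ccvg_cst.
  apply: (@ccvg_harm _ _ _ t) => n; rewrite -rC1 -rCN -rCD cabs_rC mulrC.
  by apply: expRN_dist1; rewrite mulr_ge0.
Qed.

End complex_limits.

(** * Limits of operators along Laplace transforms *)

Section approximation.
Context {R : realType} {H : lmodType (complex R)}.
Variable ip : H -> H -> complex R.
Local Notation C := (complex R).
Local Notation nrm := (hnorm ip).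

Lemma chkB (b c : R -> C) u : cintegrable setT b -> cintegrable setT c ->
  chk (fun t => b t - c t) u = chk b u - chk c u.
Proof.
have ei1 (f : R -> C) : cintegrable setT f -> cintegrable setT (fun t => f t * ei (t * u)).
  by move=> fi; apply: (cintegrable_mulb _ fi (cmeas_ei_mul u)) => // t _; rewrite cabs_ei.
move=> bi ci; rewrite /chk -cintB//; [|exact: ei1|exact: ei1].
by apply: eq_cint => t _; rewrite mulrBl.
Qed.

(** Convergence in the norm of A_0 with representations kept as witnesses; the explicit rate lets
    limits be taken with [le_harm]. *)
Definition approx_by (F : R -> C) (b : nat -> R -> C) := forall j : nat,
  [/\ cintegrable setT (b j), forall t, t < 0 -> b j t = 0 &
    exists f h S, A0_rep (fun x => F x - chk (b j) x) f h S /\ S <= j.+1%:R^-1].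

Lemma approx_exists F f h S : A0_rep F f h S -> exists b, approx_by F b.
Proof.
move=> rep.
have ex (j : nat) : exists b : R -> C, [/\ cintegrable setT b, forall t, t < 0 -> b t = 0 &
    exists f h S, A0_rep (fun x => F x - chk b x) f h S /\ S <= j.+1%:R^-1].
  by have [b [b1 b2 _ b3]] := A0_rep_density rep (harm_gt0 j); exists b; split.
by have [b Hb] := choice ex; exists b.
Qed.

(** The sum of a representation bounds the function uniformly on the line, and Poisson means
    preserve this bound. *)
Lemma approx_tilde F b j (z : Cplus R) f h S : A0_rep F f h S -> approx_by F b ->
  cabs (laplace (b j) z - tildeF F z) <= j.+1%:R^-1.
Proof.
move=> rep /(_ j)[bi b0 [f' [h' [S' [rep' S'le]]]]].
rewrite -tildeF_chk// cabs_distC -(tildeFB z (A0_rep_meas rep) (A0_rep_bound rep)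
  (cmeas_chk (cintegrable_meas bi)) (fun u => cabs_chk u bi)).
by apply: cabs_tildeF (A0_rep_meas rep') _ => t; apply: le_trans (A0_rep_bound rep' t) _.
Qed.

Section operators.
Variables (T : R -> H -> H) (Cb : R).
Hypotheses (HH : is_hilbert ip) (Cb0 : 0 < Cb) (SG : bdd_sg ip T Cb).
Let Hip : is_inner_product ip. Proof. by have [] := HH. Qed.

(** Stated for a difference because both uses have that form: [chk (b j)] is F minus the remainder,
    and [chk (b i) - chk (b j)] is a difference of two remainders. This avoids merging two series
    into one. *)
Lemma nrm_sop_A0 b F1 f1 h1 S1 F2 f2 h2 S2 v : cintegrable setT b ->
  (forall t, t < 0 -> b t = 0) -> A0_rep F1 f1 h1 S1 -> A0_rep F2 f2 h2 S2 ->
  (forall u, chk b u = F1 u - F2 u) -> nrm (sop ip T b v) <= Cb ^+ 2 * (S1 + S2) * nrm v.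
Proof.
move=> bi b0 rep1 rep2 bE.
apply: (nrm_le_ip Hip).
  by rewrite mulr_ge0 ?nrm_ge0// mulr_ge0 ?exprn_ge0 ?(ltW Cb0)// addr_ge0 ?(A0_rep_ge0 rep1) ?(A0_rep_ge0 rep2).
move=> z; rewrite (ip_sop HH Cb0 SG)//.
apply: le_trans (sop_estimate HH Cb0 SG v z bi b0 rep1 rep2 bE) _.
by rewrite le_eqVlt; apply/orP; left; apply/eqP; ring.
Qed.

Lemma sopB b c v : cintegrable setT b -> cintegrable setT c ->
  sop ip T b v - sop ip T c v = sop ip T (fun t => b t - c t) v.
Proof.
move=> bi ci; apply: (ip_inj Hip) => z; rewrite ipBl// !(ip_sop HH Cb0 SG)//; last exact: cintegrableB.
rewrite -cintB//; [|exact: (cintegrable_orb HH Cb0 SG)|exact: (cintegrable_orb HH Cb0 SG)].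
by apply: eq_cint => t _; rewrite mulrBl.
Qed.

Variables (F : R -> C) (f h : nat -> R -> C) (S0 : R) (b : nat -> R -> C).
Hypotheses (rep : A0_rep F f h S0) (Fb : approx_by F b).

Lemma nrm_sop_approx j v : nrm (sop ip T (b j) v) <= Cb ^+ 2 * (S0 + j.+1%:R^-1) * nrm v.
Proof.
have [bi b0 [f' [h' [S' [rep' S'le]]]]] := Fb j.
apply: le_trans (nrm_sop_A0 v bi b0 rep rep' _) _; first by move=> u; rewrite opprB subrKC.
by rewrite ler_wpM2r ?nrm_ge0// ler_wpM2l ?exprn_ge0 ?(ltW Cb0)// lerD2l.
Qed.

Lemma nrm_sop_approxB i j v :
  nrm (sop ip T (b i) v - sop ip T (b j) v) <= Cb ^+ 2 * (i.+1%:R^-1 + j.+1%:R^-1) * nrm v.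
Proof.
have [bi b0 [f' [h' [S' [rep' S'le]]]]] := Fb i.
have [ci c0 [f'' [h'' [S'' [rep'' S''le]]]]] := Fb j.
rewrite sopB//.
apply: le_trans (nrm_sop_A0 v _ _ rep'' rep' _) _.
- exact: cintegrableB.
- by move=> t t0; rewrite b0// c0// subrr.
- by move=> u; rewrite chkB//; ring.
by rewrite ler_wpM2r ?nrm_ge0// ler_wpM2l ?exprn_ge0 ?(ltW Cb0)// addrC lerD.
Qed.

(** The operators of [b j] are Cauchy with an explicit modulus, so completeness gives a pointwise
    limit. Linearity and the bound with [S0] alone follow by letting j grow. *)
Lemma op_limit : exists S : H -> H, [/\ is_bounded_op ip S,
  forall j x, nrm (sop ip T (b j) x - S x) <= Cb ^+ 2 * j.+1%:R^-1 * nrm x &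
  forall x, nrm (S x) <= Cb ^+ 2 * S0 * nrm x].
Proof.
have [_ comp] := HH.
have c20 : 0 <= Cb ^+ 2 by rewrite exprn_ge0 ?(ltW Cb0).
have bi j : cintegrable setT (b j) by have [] := Fb j.
have ex x : exists l, nrm (sop ip T (b n) x - l) @[n --> \oo] --> 0.
  apply: comp => e e0.
  have [m Hm] : exists m : nat, 2 * (Cb ^+ 2 * nrm x) / e < m%:R.
    by exists (Num.truncn (2 * (Cb ^+ 2 * nrm x) / e)).+1; exact: truncnS_gt.
  exists m => i j mi mj; apply: le_lt_trans (nrm_sop_approxB i j x) _.
  have q (k : nat) : (m <= k)%N -> k.+1%:R^-1 <= m.+1%:R^-1 :> R.
    by move=> mk; rewrite lef_pV2 ?posrE// ler_nat.
  apply: (@le_lt_trans _ _ (2 * (Cb ^+ 2 * nrm x) * m.+1%:R^-1)).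
    have -> : 2 * (Cb ^+ 2 * nrm x) * m.+1%:R^-1 = Cb ^+ 2 * (m.+1%:R^-1 + m.+1%:R^-1) * nrm x by ring.
    by rewrite ler_wpM2r ?nrm_ge0// ler_wpM2l// lerD ?q.
  rewrite ltr_pdivrMr// [ltRHS]mulrC -ltr_pdivrMr//; apply: lt_trans Hm _; by rewrite ltr_nat.
have [S HS] := choice ex.
have SE j x : nrm (sop ip T (b j) x - S x) <= Cb ^+ 2 * j.+1%:R^-1 * nrm x.
  apply: (@le_harm _ _ _ (Cb ^+ 2 * nrm x)) => i; apply/ler_addgt0Pr => e e0.
  have /cvgrPdist_le/(_ e e0)[m _ Hm] := HS x.
  have := Hm (maxn i m) (leq_maxr _ _); rewrite /= sub0r normrN ger0_norm ?nrm_ge0// => Hm'.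
  have -> : sop ip T (b j) x - S x =
      (sop ip T (b j) x - sop ip T (b (maxn i m)) x) + (sop ip T (b (maxn i m)) x - S x).
    by rewrite addrA subrK.
  apply: le_trans (nrmD Hip _ _) _; apply: lerD Hm'.
  apply: le_trans (nrm_sop_approxB _ _ _) _.
  have -> : Cb ^+ 2 * j.+1%:R^-1 * nrm x + Cb ^+ 2 * nrm x * i.+1%:R^-1 =
      Cb ^+ 2 * (j.+1%:R^-1 + i.+1%:R^-1) * nrm x by ring.
  rewrite ler_wpM2r ?nrm_ge0// ler_wpM2l// lerD2l lef_pV2 ?posrE// ler_nat ltnS.
  exact: leq_maxl.
have SB x : nrm (S x) <= Cb ^+ 2 * S0 * nrm x.
  apply: (@le_harm _ _ _ (2 * (Cb ^+ 2 * nrm x))) => j.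
  have -> : S x = sop ip T (b j) x - (sop ip T (b j) x - S x) by rewrite opprB subrKC.
  apply: le_trans (nrmB Hip _ _) _; apply: le_trans (lerD (nrm_sop_approx j x) (SE j x)) _.
  by rewrite le_eqVlt; apply/orP; left; apply/eqP; ring.
exists S; split => //; split; last by exists (Cb ^+ 2 * S0).
move=> a x y; apply/eqP; rewrite -subr_eq0; apply/eqP; apply: (nrm_eq0 Hip).
apply/eqP; rewrite eq_le nrm_ge0 andbT.
apply: (@le_harm _ _ _ (Cb ^+ 2 * nrm (a *: x + y) + cabs a * (Cb ^+ 2 * nrm x) + Cb ^+ 2 * nrm y)) => j.
have [lin _] := sop_op HH Cb0 SG (bi j).
have -> : S (a *: x + y) - (a *: S x + S y) =
    (a *: (sop ip T (b j) x - S x) + (sop ip T (b j) y - S y)) - (sop ip T (b j) (a *: x + y) - S (a *: x + y)).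
  rewrite lin scalerBr; set p := a *: _; set q := a *: _; set r := sop _ _ _ y.
  by rewrite [in RHS]addrACA -opprD opprB [RHS]addrC addrA subrK.
apply: le_trans (nrmB Hip _ _) _; apply: le_trans (lerD (nrmD Hip _ _) (SE j _)) _; rewrite nrmZ//.
have h1 := ler_wpM2l (cabs_ge0 a) (SE j x).
apply: le_trans (lerD (lerD h1 (SE j y)) (lexx _)) _.
by rewrite le_eqVlt; apply/orP; left; apply/eqP; ring.
Qed.

End operators.
End approximation.

(** * The functional calculus *)

Section calculus.
Context {R : realType} {H : lmodType (complex R)}.
Variable ip : H -> H -> complex R.
Variables (T : R -> H -> H) (Cb : R).
Hypotheses (HH : is_hilbert ip) (Cb0 : 0 < Cb) (SG : bdd_sg ip T Cb).
Local Notation C := (complex R).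
Local Notation nrm := (hnorm ip).
Let Hip : is_inner_product ip. Proof. by have [] := HH. Qed.

(** Depends only on the values of Phi on the line Re w = 1 / (n + 1), hence applies to sums and
    products as they stand. *)
Definition Lam n (x z : H) (Phi : Cplus R -> C) : C :=
  cint setT (fun u => Mn ip T n x z u * Phi (zpt (harm_gt0 n) u)).

Definition line_bdd (Phi : Cplus R -> C) (K : R) :=
  (forall w, cabs (Phi w) <= K) /\ forall n, cmeas setT (fun u => Phi (zpt (harm_gt0 n) u)).

Lemma line_bddM Phi Psi K K' : line_bdd Phi K -> line_bdd Psi K' ->
  line_bdd (fun w => Phi w * Psi w) (K * K').
Proof.
move=> [a b] [c d]; split; first by move=> w; rewrite cabsM ler_pM ?cabs_ge0.
by move=> n; apply: cmeasM.
Qed.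

Lemma line_bdd_tilde F f h S : A0_rep F f h S -> line_bdd (tildeF F) S.
Proof.
move=> rep; split; first by move=> w; apply: cabs_tildeF (A0_rep_meas rep) (A0_rep_bound rep).
by move=> n; apply: cmeas_tildeF_zpt; exact: A0_rep_meas rep.
Qed.

Lemma cintegrable_Lam n x z Phi K : line_bdd Phi K ->
  cintegrable setT (fun u => Mn ip T n x z u * Phi (zpt (harm_gt0 n) u)).
Proof.
by move=> [a b]; apply: (cintegrable_mulb _ (cintegrable_Mn HH Cb0 SG n x z) (b n)) => // u _; exact: a.
Qed.

Lemma LamD n x z Phi Psi K K' : line_bdd Phi K -> line_bdd Psi K' ->
  Lam n x z (fun w => Phi w + Psi w) = Lam n x z Phi + Lam n x z Psi.
Proof.
move=> P1 P2; rewrite /Lam -cintD//; [|exact: cintegrable_Lam P1|exact: cintegrable_Lam P2].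
by apply: eq_cint => u _; rewrite mulrDr.
Qed.

Lemma LamZ n x z a Phi K : line_bdd Phi K -> Lam n x z (fun w => a * Phi w) = a * Lam n x z Phi.
Proof.
move=> P1; rewrite /Lam -cintZ//; last exact: cintegrable_Lam P1.
by apply: eq_cint => u _; rewrite mulrCA.
Qed.

Lemma LamB_le n x z Phi Psi K K' e : line_bdd Phi K -> line_bdd Psi K' ->
  (forall w, cabs (Phi w - Psi w) <= e) ->
  cabs (Lam n x z Phi - Lam n x z Psi) <= e * L1norm (Mn ip T n x z).
Proof.
move=> P1 P2 le; rewrite /Lam -cintB//; [|exact: cintegrable_Lam P1|exact: cintegrable_Lam P2].
rewrite (@eq_cint _ _ _ (fun u => Mn ip T n x z u *
    (Phi (zpt (harm_gt0 n) u) - Psi (zpt (harm_gt0 n) u)))); last by move=> u _; rewrite mulrBr.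
apply: cabs_cint_mulb (cintegrable_Mn HH Cb0 SG n x z) _ _; last by move=> u; exact: le.
by apply: cmeasB; [case: P1|case: P2].
Qed.

Section laplace.
Variables (b c : R -> C).
Hypotheses (bi : cintegrable setT b) (b0 : forall t, t < 0 -> b t = 0).
Hypotheses (ci : cintegrable setT c) (c0 : forall t, t < 0 -> c t = 0).
Implicit Types (n : nat) (x z : H).

Let h n : R := n.+1%:R^-1.
Let h_ge0 n : 0 <= h n. Proof. by rewrite invr_ge0. Qed.

Lemma laplace_zptE (a : R -> C) n u : (forall t, t < 0 -> a t = 0) ->
  laplace a (zpt (harm_gt0 n) u) = chk (bexp (h n) a) u.
Proof.
move=> a0; rewrite laplace_zpt; apply: eq_cint => t _; rewrite /bexp /pos.
by case: (leP 0 t) => // /a0 ->.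
Qed.

Lemma line_bdd_laplace : line_bdd (laplace b) (L1norm b).
Proof.
split.
  move=> w; rewrite -tildeF_chk//; apply: cabs_tildeF; first exact: cmeas_chk (cintegrable_meas bi).
  by move=> u; exact: cabs_chk.
move=> n; apply: (@cmeas_ext _ _ (chk (bexp (h n) b))).
  by move=> u _; rewrite laplace_zptE.
by apply: cmeas_chk; apply: cintegrable_meas; exact: cintegrable_bexp.
Qed.

Lemma Lam_laplace_chk n x z :
  Lam n x z (laplace b) = cint setT (fun t => bexp (h n) b t * chk (Mn ip T n x z) t).
Proof.
rewrite -chk_exchange; [|exact: (cintegrable_Mn HH Cb0 SG)|exact: cintegrable_bexp].
by apply: eq_cint => u _; rewrite laplace_zptE.
Qed.

Lemma Lam_laplace2_chk n x z : Lam n x z (fun w => laplace b w * laplace c w) =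
  cint setT (fun t => bexp (h n) b t *
    cint setT (fun s => bexp (h n) c s * chk (Mn ip T n x z) (s + t))).
Proof.
have iM := cintegrable_Mn HH Cb0 SG n x z.
have ib := cintegrable_bexp (h_ge0 n) b0 bi.
have ic := cintegrable_bexp (h_ge0 n) c0 ci.
have iMc : cintegrable setT (fun u => Mn ip T n x z u * chk (bexp (h n) c) u).
  apply: (cintegrable_mulb _ iM (cmeas_chk (cintegrable_meas ic))) => // u _; exact: cabs_chk.
transitivity (cint setT (fun u => Mn ip T n x z u * chk (bexp (h n) c) u * chk (bexp (h n) b) u)).
  by apply: eq_cint => u _; rewrite !laplace_zptE// mulrA mulrAC.
rewrite (chk_exchange iMc ib); apply: eq_cint => t _; congr (_ * _).
have iMe : cintegrable setT (fun u => Mn ip T n x z u * ei (u * t)).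
  by apply: (cintegrable_mulb _ iM (cmeas_ei_mul t)) => // u _; rewrite cabs_ei.
transitivity (cint setT (fun u => Mn ip T n x z u * ei (u * t) * chk (bexp (h n) c) u)).
  by apply: eq_cint => u _; rewrite mulrAC.
rewrite (chk_exchange iMe ic); apply: eq_cint => s _; congr (_ * _).
by apply: eq_cint => u _; rewrite -mulrA -eiD; congr (_ * ei _); ring.
Qed.

Let D n := damp (2 * h n) T.
Let SD n : bdd_sg ip (D n) Cb.
Proof. by apply: bdd_sg_damp => //; rewrite mulr_ge0. Qed.
Let r n x := sop ip T (smooth_weight n.+1%:R (h n)) x.

Lemma chk_Mn_damp n x z t : 0 <= t ->
  rC (expR (- (h n * t))) * chk (Mn ip T n x z) t = orb ip (D n) (r n x) z t.
Proof.
move=> t0; rewrite /Mn (chk_multE HH Cb0 SG (ltr0Sn R n) (harm_gt0 n))// /D orb_damp//.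
rewrite max_r// mulrA -rCM -expRD; congr (rC (expR _) * _); rewrite /h; ring.
Qed.

(** An exact formula at finite n. The height of the line and the damping in the kernel contribute 1
    / (n + 1) each, hence the factor 2 in [D]; as [D n] keeps the bound [Cb], norm estimates for
    [sop] become uniform in n. *)
Lemma Lam_laplace n x z : Lam n x z (laplace b) = ip (sop ip (D n) b (r n x)) z.
Proof.
rewrite Lam_laplace_chk (ip_sop HH Cb0 (SD n))//; apply: eq_cint => t _.
have [t0|/b0 bt] := leP 0 t; last by rewrite /bexp bt !mul0r.
by rewrite -chk_Mn_damp// mulrA.
Qed.

(** Already at finite n the product becomes a composition, by the semigroup law inside the orbit. So
    products of approximants also obey estimates uniform in n. *)
Lemma Lam_laplace2 n x z : Lam n x z (fun w => laplace b w * laplace c w) =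
  ip (sop ip (D n) b (sop ip (D n) c (r n x))) z.
Proof.
rewrite Lam_laplace2_chk (ip_sop HH Cb0 (SD n))//; apply: eq_cint => t _.
have [t0|/b0 bt] := leP 0 t; last by rewrite /bexp bt !mul0r.
rewrite /bexp -mulrA; congr (_ * _).
rewrite /orb max_r// (ip_sg_sop HH Cb0 (SD n))// -cintZ//; last first.
  apply: (@cintegrable_mulb _ _ (bexp (h n) c) _ (Cb * nrm x * nrm z)) => //.
  - exact: cintegrable_bexp.
  - exact: (cmeas_shift t (cmeas_chk (cintegrable_meas (cintegrable_Mn HH Cb0 SG n x z)))).
  - by move=> s _; exact: (cabs_chk_Mn HH Cb0 SG).
apply: eq_cint => s _; have [s0|/c0 cs] := leP 0 s; last by rewrite /bexp cs !(mul0r, mulr0).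
rewrite -chk_Mn_damp ?addr_ge0// /bexp mulrCA -!mulrA; congr (_ * _).
by rewrite !mulrA -!rCM -!expRD; congr (rC (expR _) * _); ring.
Qed.

Lemma Lam_laplace_cvg x z : ccvg (fun n => Lam n x z (laplace b)) (ip (sop ip T b x) z).
Proof.
rewrite (_ : (fun n => _) = (fun n => cint setT (fun t => bexp (h n) b t * chk (Mn ip T n x z) t))).
  rewrite (ip_sop HH Cb0 SG)//.
  apply: (bexp_dominated bi b0 _ _ (fun n t => cabs_chk_Mn HH Cb0 SG n x z t)).
  - by move=> n; exact: cmeas_chk (cintegrable_meas (cintegrable_Mn HH Cb0 SG n x z)).
  - exact: (cmeas_orb HH Cb0 SG).
  - by move=> t t0; exact: (chk_Mn_cvg HH Cb0 SG).
by apply/funext => n; rewrite Lam_laplace_chk.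
Qed.

(** Dominated convergence twice: in s for each fixed t, then in t. *)
Lemma Lam_laplace2_cvg x z :
  ccvg (fun n => Lam n x z (fun w => laplace b w * laplace c w)) (ip (sop ip T b (sop ip T c x)) z).
Proof.
pose G n t := cint setT (fun s => bexp (h n) c s * chk (Mn ip T n x z) (s + t)).
rewrite (_ : (fun n => _) = (fun n => cint setT (fun t => bexp (h n) b t * G n t))); last first.
  by apply/funext => n; rewrite Lam_laplace2_chk.
have mM n := cmeas_chk (cintegrable_meas (cintegrable_Mn HH Cb0 SG n x z)).
rewrite (ip_sop HH Cb0 SG)//; apply: (@bexp_dominated _ _ _ _ (Cb * nrm x * nrm z * L1norm c)) => //.
- move=> n; apply: (cmeas_cint_kernel (k := fun p : R * R => chk (Mn ip T n x z) (p.2 + p.1))).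
    exact: cintegrable_meas (cintegrable_bexp (h_ge0 n) c0 ci).
  by apply: (jmeas_comp (mM n)); exact: measurable_funD.
- exact: (cmeas_orb HH Cb0 SG).
- move=> n t; apply: (@le_trans _ _ (Cb * nrm x * nrm z * L1norm (bexp (h n) c))).
    apply: cabs_cint_mulb; first exact: cintegrable_bexp.
      exact: (cmeas_shift t (mM n)).
    by move=> s; exact: (cabs_chk_Mn HH Cb0 SG).
  rewrite ler_wpM2l ?orb_bound_ge0//; apply: le_Rintegral => //.
  + by apply: integrable_cabs => //; exact: cintegrable_bexp.
  + exact: integrable_cabs.
  + by move=> s _; exact: cabs_bexp.
- move=> t t0; rewrite /orb max_r// (ip_sg_sop HH Cb0 SG)//.
  apply: (bexp_dominated ci c0 _ _ (fun n s => cabs_chk_Mn HH Cb0 SG n x z (s + t))).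
  + by move=> n; exact: (cmeas_shift t (mM n)).
  + exact: (cmeas_shift t (cmeas_orb HH Cb0 SG x z)).
  + by move=> s s0; apply: (chk_Mn_cvg HH Cb0 SG); exact: addr_ge0.
Qed.

Lemma nrm_smooth n x : nrm (r n x) <= Cb * nrm x.
Proof.
have n0 := ltr0Sn R n; have hn := @harm_gt0 R n.
apply: le_trans (nrm_sop HH Cb0 SG x (cintegrable_smooth_weight n0 hn)) _.
by rewrite mulrAC ler_piMr ?(L1norm_smooth_weight n0 hn)// mulr_ge0 ?nrm_ge0// ltW.
Qed.

End laplace.

(** An instance of [ccvg_interchange]: for fixed n the approximants converge at a rate that involves
    the L1 norm of the kernel, while [Lam_laplace] makes them Cauchy uniformly in n. The third power
    of [Cb] is the operator bound times the norm of the smoothed vector. *)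
Lemma Lam_tilde_cvg F f h S0 b S x z : A0_rep F f h S0 -> approx_by F b ->
  (forall j x, nrm (sop ip T (b j) x - S x) <= Cb ^+ 2 * j.+1%:R^-1 * nrm x) ->
  ccvg (fun n => Lam n x z (tildeF F)) (ip (S x) z).
Proof.
move=> rep Fb SE; have c20 : 0 <= Cb ^+ 2 by rewrite exprn_ge0 ?(ltW Cb0).
have bi j : cintegrable setT (b j) by have [] := Fb j.
have b0 j t : t < 0 -> b j t = 0 by have [_ + _] := Fb j; apply.
have dg n : 0 <= 2 * n.+1%:R^-1 :> R by rewrite mulr_ge0// invr_ge0.
apply: (@ccvg_interchange _ _ (fun j n => Lam n x z (laplace (b j))) (fun j => ip (sop ip T (b j) x) z) _
    (fun n => L1norm (Mn ip T n x z)) (Cb ^+ 3 * nrm x * nrm z) (Cb ^+ 2 * nrm x * nrm z)).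
- move=> j n; rewrite mulrC.
  apply: (LamB_le n x z (line_bdd_laplace (bi j) (b0 j)) (line_bdd_tilde rep)) => w.
  exact: approx_tilde rep Fb.
- move=> i j n; rewrite (Lam_laplace (bi i) (b0 i)) (Lam_laplace (bi j) (b0 j)) -(ipBl Hip); apply: le_trans (cauchy_schwarz Hip _ _) _.
  apply: le_trans (ler_wpM2r _ (nrm_sop_approxB HH Cb0 (bdd_sg_damp Hip (dg n) SG) Fb i j _)) _; first exact: nrm_ge0.
  have := nrm_smooth n x; set v := nrm (sop _ _ _ _) => vx.
  have hh : 0 <= i.+1%:R^-1 + j.+1%:R^-1 :> R by rewrite addr_ge0// invr_ge0.
  have -> : Cb ^+ 3 * nrm x * nrm z * (i.+1%:R^-1 + j.+1%:R^-1) =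
     Cb ^+ 2 * (i.+1%:R^-1 + j.+1%:R^-1) * (Cb * nrm x) * nrm z by ring.
  by rewrite ler_wpM2r ?nrm_ge0// ler_wpM2l// mulr_ge0.
- by move=> j; exact: (Lam_laplace_cvg (bi j) (b0 j)).
- move=> j; rewrite -(ipBl Hip); apply: le_trans (cauchy_schwarz Hip _ _) _.
  apply: le_trans (ler_wpM2r (nrm_ge0 ip z) (SE j x)) _.
  by rewrite le_eqVlt; apply/orP; left; apply/eqP; ring.
Qed.

(** The same interchange for products: multiplicativity, exact for Laplace transforms by
    [Lam_laplace2_cvg], passes to the limit. *)
Lemma Lam_tilde2_cvg F f h S0 b S G f' h' S0' c S' x z :
  A0_rep F f h S0 -> approx_by F b ->
  (forall j x, nrm (sop ip T (b j) x - S x) <= Cb ^+ 2 * j.+1%:R^-1 * nrm x) ->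
  A0_rep G f' h' S0' -> approx_by G c ->
  (forall j x, nrm (sop ip T (c j) x - S' x) <= Cb ^+ 2 * j.+1%:R^-1 * nrm x) ->
  ccvg (fun n => Lam n x z (fun w => tildeF F w * tildeF G w)) (ip (S (S' x)) z).
Proof.
move=> repF Fb SE repG Gc SE'; have c20 : 0 <= Cb ^+ 2 by rewrite exprn_ge0 ?(ltW Cb0).
have bi j : cintegrable setT (b j) by have [] := Fb j.
have b0 j t : t < 0 -> b j t = 0 by have [_ + _] := Fb j; apply.
have ci j : cintegrable setT (c j) by have [] := Gc j.
have c0 j t : t < 0 -> c j t = 0 by have [_ + _] := Gc j; apply.
have dg n : 0 <= 2 * n.+1%:R^-1 :> R by rewrite mulr_ge0// invr_ge0.
have S00 := A0_rep_ge0 repF; have S00' := A0_rep_ge0 repG.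
have h1 (j : nat) : j.+1%:R^-1 <= 1 :> R by rewrite invf_le1// ler1n.
have hp (j : nat) : 0 <= j.+1%:R^-1 :> R by rewrite invr_ge0.
have lin D j v v' : bdd_sg ip D Cb -> sop ip D (b j) (v - v') = sop ip D (b j) v - sop ip D (b j) v'.
  move=> SD; have [lin _] := sop_op HH Cb0 SD (bi j).
  by rewrite addrC -scaleN1r lin scaleN1r addrC.
(* From b_i c_i - b_j c_j = b_i (c_i - c_j) + (b_i - b_j) c_j at the level of operators; the
   summands 1 bound the rates 1 / (j + 1). *)
pose K := Cb ^+ 2 * (S0 + 1) * Cb ^+ 2 + Cb ^+ 2 * (Cb ^+ 2 * (S0' + 1)).
have key D i j v : bdd_sg ip D Cb -> nrm (sop ip D (b i) (sop ip D (c i) v) - sop ip D (b j) (sop ip D (c j) v))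
    <= K * (i.+1%:R^-1 + j.+1%:R^-1) * nrm v.
  move=> SD; set q := _ + j.+1%:R^-1.
  have q0 : 0 <= q by rewrite addr_ge0.
  have -> : sop ip D (b i) (sop ip D (c i) v) - sop ip D (b j) (sop ip D (c j) v) =
      sop ip D (b i) (sop ip D (c i) v - sop ip D (c j) v) +
      (sop ip D (b i) (sop ip D (c j) v) - sop ip D (b j) (sop ip D (c j) v)).
    by rewrite lin// addrA subrK.
  apply: le_trans (nrmD Hip _ _) _.
  have e1 : nrm (sop ip D (b i) (sop ip D (c i) v - sop ip D (c j) v)) <=
      Cb ^+ 2 * (S0 + 1) * (Cb ^+ 2 * q * nrm v).
    apply: le_trans (nrm_sop_approx HH Cb0 SD repF Fb i _) _.
    apply: ler_pM; [by rewrite mulr_ge0// addr_ge0|exact: nrm_ge0| |].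
      by rewrite ler_wpM2l// lerD2l.
    exact: (nrm_sop_approxB HH Cb0 SD Gc i j v).
  have e2 : nrm (sop ip D (b i) (sop ip D (c j) v) - sop ip D (b j) (sop ip D (c j) v)) <=
      Cb ^+ 2 * q * (Cb ^+ 2 * (S0' + 1) * nrm v).
    apply: le_trans (nrm_sop_approxB HH Cb0 SD Fb i j _) _.
    apply: ler_wpM2l; first by rewrite mulr_ge0.
    apply: le_trans (nrm_sop_approx HH Cb0 SD repG Gc j _) _.
    by rewrite ler_wpM2r ?nrm_ge0// ler_wpM2l// lerD2l.
  apply: le_trans (lerD e1 e2) _; rewrite /K le_eqVlt; apply/orP; left; apply/eqP; ring.
have K0 : 0 <= K.
  have CbW : 0 <= Cb := ltW Cb0.
  by apply: addr_ge0; rewrite !mulr_ge0 ?addr_ge0.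
apply: (@ccvg_interchange _ _ (fun j n => Lam n x z (fun w => laplace (b j) w * laplace (c j) w))
    (fun j => ip (sop ip T (b j) (sop ip T (c j) x)) z) _
    (fun n => (S0' + 1 + S0) * L1norm (Mn ip T n x z)) (K * Cb * nrm x * nrm z) (K * nrm x * nrm z)).
- move=> j n; rewrite mulrAC.
  apply: (LamB_le n x z (line_bddM (line_bdd_laplace (bi j) (b0 j)) (line_bdd_laplace (ci j) (c0 j)))
    (line_bddM (line_bdd_tilde repF) (line_bdd_tilde repG))) => w.
  have aF := approx_tilde j w repF Fb; have aG := approx_tilde j w repG Gc.
  have [bF _] := line_bdd_tilde repF; have [bG _] := line_bdd_tilde repG.
  have bc : cabs (laplace (c j) w) <= S0' + 1.
    have -> : laplace (c j) w = tildeF G w + (laplace (c j) w - tildeF G w) by rewrite subrKC.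
    by apply: le_trans (cabsD _ _) _; apply: lerD; [exact: bG|exact: le_trans aG (h1 j)].
  have -> : laplace (b j) w * laplace (c j) w - tildeF F w * tildeF G w =
     (laplace (b j) w - tildeF F w) * laplace (c j) w + tildeF F w * (laplace (c j) w - tildeF G w) by ring.
  apply: le_trans (cabsD _ _) _; rewrite !cabsM.
  have e1 := ler_pM (cabs_ge0 _) (cabs_ge0 _) aF bc.
  have e2 := ler_pM (cabs_ge0 _) (cabs_ge0 _) (bF w) aG.
  by apply: le_trans (lerD e1 e2) _; rewrite mulrC -mulrDl.
- move=> i j n; rewrite (Lam_laplace2 (bi i) (b0 i) (ci i) (c0 i)) (Lam_laplace2 (bi j) (b0 j) (ci j) (c0 j)) -(ipBl Hip); apply: le_trans (cauchy_schwarz Hip _ _) _.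
  apply: le_trans (ler_wpM2r _ (key _ i j _ (bdd_sg_damp Hip (dg n) SG))) _; first exact: nrm_ge0.
  have := nrm_smooth n x; set v := nrm (sop _ _ _ _) => vx.
  have -> : K * Cb * nrm x * nrm z * (i.+1%:R^-1 + j.+1%:R^-1) =
     K * (i.+1%:R^-1 + j.+1%:R^-1) * (Cb * nrm x) * nrm z by ring.
  by rewrite ler_wpM2r ?nrm_ge0// ler_wpM2l// mulr_ge0// addr_ge0.
- by move=> j; exact: (Lam_laplace2_cvg (bi j) (b0 j) (ci j) (c0 j)).
- move=> j; rewrite -(ipBl Hip); apply: le_trans (cauchy_schwarz Hip _ _) _.
  rewrite mulrAC ler_wpM2r ?nrm_ge0// mulrAC.
  have -> : sop ip T (b j) (sop ip T (c j) x) - S (S' x) =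
      sop ip T (b j) (sop ip T (c j) x - S' x) + (sop ip T (b j) (S' x) - S (S' x)).
    by rewrite lin// addrA subrK.
  apply: le_trans (nrmD Hip _ _) _.
  have S'B : nrm (S' x) <= Cb ^+ 2 * (S0' + 1) * nrm x.
    apply: (@le_harm _ _ _ (2 * (Cb ^+ 2 * nrm x))) => k.
    have -> : S' x = sop ip T (c k) x - (sop ip T (c k) x - S' x) by rewrite opprB subrKC.
    apply: le_trans (nrmB Hip _ _) _.
    apply: le_trans (lerD (nrm_sop_approx HH Cb0 SG repG Gc k x) (SE' k x)) _.
    rewrite -subr_ge0; have -> : Cb ^+ 2 * (S0' + 1) * nrm x + 2 * (Cb ^+ 2 * nrm x) * k.+1%:R^-1 -
      (Cb ^+ 2 * (S0' + k.+1%:R^-1) * nrm x + Cb ^+ 2 * k.+1%:R^-1 * nrm x) = Cb ^+ 2 * nrm x by ring.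
    by rewrite mulr_ge0 ?nrm_ge0.
  have e1 : nrm (sop ip T (b j) (sop ip T (c j) x - S' x)) <=
      Cb ^+ 2 * (S0 + 1) * (Cb ^+ 2 * j.+1%:R^-1 * nrm x).
    apply: le_trans (nrm_sop_approx HH Cb0 SG repF Fb j _) _.
    apply: ler_pM; rewrite ?nrm_ge0//; first by rewrite mulr_ge0// addr_ge0.
    by rewrite ler_wpM2l// lerD2l.
  have e2 : nrm (sop ip T (b j) (S' x) - S (S' x)) <= Cb ^+ 2 * j.+1%:R^-1 * (Cb ^+ 2 * (S0' + 1) * nrm x).
    by apply: le_trans (SE j _) _; rewrite ler_wpM2l// mulr_ge0.
  apply: le_trans (lerD e1 e2) _; rewrite /K le_eqVlt; apply/orP; left; apply/eqP; ring.
Qed.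

End calculus.

(** * The operator norm and the norm of A_0 *)

Section operator_norm.
Context {R : realType} {H : lmodType (complex R)}.
Variable ip : H -> H -> complex R.
Hypothesis Hip : is_inner_product ip.
Local Notation nrm := (hnorm ip).

Lemma opnorm_le S (K : R) : 0 <= K -> (forall x, nrm (S x) <= K * nrm x) -> opnorm ip S <= K.
Proof.
move=> K0 SK; apply: ge_sup.
  by exists (nrm (S 0)), 0 => //=; rewrite nrm0.
by move=> _ [x /= x1 <-]; apply: le_trans (SK x) _; rewrite ler_piMr.
Qed.

Lemma nrm_opnorm S x : is_bounded_op ip S -> nrm (S x) <= opnorm ip S * nrm x.
Proof.
move=> [lin [M SM]].
have SZ a v : S (a *: v) = a *: S v.
  have S0 : S 0 = 0 by have := lin (-1) 0 0; rewrite scaler0 addr0 scaleN1r addNr.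
  by have := lin a v 0; rewrite S0 !addr0.
have [x0|x0] := eqVneq (nrm x) 0.
  by apply: le_trans (SM x) _; rewrite x0 !mulr0.
have xp : 0 < nrm x by rewrite lt_neqAle eq_sym x0 nrm_ge0.
have inv0 : 0 <= (nrm x)^-1 by rewrite invr_ge0 nrm_ge0.
have h : nrm (S (rC (nrm x)^-1 *: x)) <= opnorm ip S.
  apply: ub_le_sup; last first.
    by exists (rC (nrm x)^-1 *: x) => //=; rewrite nrmZ// cabs_rC ger0_norm// mulVf.
  exists `|M| => _ [v /= v1 <-]; apply: le_trans (SM v) _.
  apply: (@le_trans _ _ (`|M| * nrm v)); first by rewrite ler_wpM2r ?nrm_ge0 ?ler_norm.
  by rewrite ler_piMr.
by move: h; rewrite SZ nrmZ// cabs_rC ger0_norm// ler_pdivrMl// mulrC.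
Qed.

End operator_norm.

Section A0_norm.
Context {R : realType}.
Local Notation C := (complex R).

Lemma normA0R_le (F : R -> C) f h S : A0_rep F f h S -> normA0R F <= S.
Proof.
move=> rep; apply: ge_inf; last by exists f, h.
by exists 0 => S' [f' [h' rep']]; exact: A0_rep_ge0 rep'.
Qed.

Lemma normA0R_ge (F : R -> C) (K : R) : in_A0R F -> (forall f h S, A0_rep F f h S -> K <= S) ->
  K <= normA0R F.
Proof.
move=> [f [h [S rep]]] KS; apply: lb_le_inf; first by exists S, f, h.
by move=> S' [f' [h' rep']]; exact: KS rep'.
Qed.

Lemma normA0R_ge0 (F : R -> C) : in_A0R F -> 0 <= normA0R F.
Proof. by move=> inF; apply: normA0R_ge => // f h S; exact: A0_rep_ge0. Qed.

Lemma normA0C_le (F : R -> C) : in_A0R F -> normA0C (tildeF F) <= normA0R F.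
Proof.
move=> inF; apply: ge_inf; last by exists F.
by exists 0 => _ [G [inG _] <-]; exact: normA0R_ge0.
Qed.

(** The norm is an infimum over F of infima over representations, so a lower bound for all the sums
    S suffices. *)
Lemma normA0C_ge (Phi : Cplus R -> C) (K : R) : in_A0C Phi ->
  (forall F f h S, A0_rep F f h S -> Phi = tildeF F -> K <= S) -> K <= normA0C Phi.
Proof.
move=> [F [inF PhiF]] KS; apply: lb_le_inf; first by exists (normA0R F), F.
move=> _ [G [inG PhiG] <-]; apply: normA0R_ge => // f h S rep.
exact: KS rep PhiG.
Qed.

Lemma normA0C_ge0 (Phi : Cplus R -> C) : in_A0C Phi -> 0 <= normA0C Phi.
Proof. by move=> inP; apply: normA0C_ge => // F f h S rep _; exact: A0_rep_ge0 rep. Qed.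

End A0_norm.

Section rho.
Context {R : realType} {H : lmodType (complex R)}.
Variable ip : H -> H -> complex R.
Variables (T : R -> H -> H) (Cb : R).
Hypotheses (HH : is_hilbert ip) (Cb0 : 0 < Cb) (SG : bdd_sg ip T Cb).
Local Notation C := (complex R).
Local Notation nrm := (hnorm ip).
Let Hip : is_inner_product ip. Proof. by have [] := HH. Qed.
Implicit Types (Phi Psi : Cplus R -> C) (S : H -> H).

(** Refers to Phi alone, so two boundary functions with the same extension give the same operator.
    It can be verified for a sum or product directly from the limits of [Lam]. *)
Definition is_rho Phi S :=
  is_bounded_op ip S /\ forall x z, ccvg (fun n => Lam ip T n x z Phi) (ip (S x) z).

(* [id] is a junk value for the Phi without a limit operator. *)
Definition rho Phi : H -> H :=
  if pselect (exists S, is_rho Phi S) is left p then sval (cid p) else id.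

(** Weak limits determine an operator, so the choice made in [rho] is immaterial. *)
Lemma rhoE Phi S : is_rho Phi S -> rho Phi = S.
Proof.
move=> PS; have [_ P'] : is_rho Phi (rho Phi).
  by rewrite /rho; case: pselect => [p|[]]; [exact: svalP (cid p)|exists S].
apply/funext => x; apply: (ip_inj Hip) => z; apply: ccvg_unique (P' x z) _.
exact: PS.2.
Qed.

Lemma tilde_op F f h (S0 : R) : A0_rep F f h S0 -> exists S b,
  [/\ is_rho (tildeF F) S, approx_by F b,
      forall j x, nrm (sop ip T (b j) x - S x) <= Cb ^+ 2 * j.+1%:R^-1 * nrm x &
      forall x, nrm (S x) <= Cb ^+ 2 * S0 * nrm x].
Proof.
move=> rep; have [b Fb] := approx_exists rep.
have [S [Sop SE SB]] := op_limit HH Cb0 SG rep Fb.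
exists S, b; split => //; split => // x z.
exact: (Lam_tilde_cvg HH Cb0 SG _ _ rep Fb SE).
Qed.

Lemma rho_spec Phi : in_A0C Phi -> is_rho Phi (rho Phi).
Proof.
move=> [F [[f [h [S0 rep]]] ->]]; have [S [_ [PS _ _ _]]] := tilde_op rep.
by rewrite (rhoE PS).
Qed.

Lemma line_bdd_A0C Phi : in_A0C Phi -> exists K, line_bdd Phi K.
Proof. by move=> [F [[f [h [S0 rep]]] ->]]; exists S0; exact: line_bdd_tilde rep. Qed.

Lemma rhoD Phi Psi : in_A0C Phi -> in_A0C Psi ->
  rho (fun w => Phi w + Psi w) = (fun x => rho Phi x + rho Psi x).
Proof.
move=> iP iQ; have [[lP [M PM]] P1] := rho_spec iP; have [[lQ [M' QM]] Q1] := rho_spec iQ.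
have [K bP] := line_bdd_A0C iP; have [K' bQ] := line_bdd_A0C iQ.
apply: rhoE; split.
  split; first by move=> a x y; rewrite lP lQ scalerDr addrACA.
  exists (M + M') => x; apply: le_trans (nrmD Hip _ _) _.
  by rewrite mulrDl lerD.
move=> x z; rewrite ipDl// (_ : (fun n => _) = (fun n => Lam ip T n x z Phi + Lam ip T n x z Psi)).
  exact: ccvgD.
by apply/funext => n; exact: (LamD HH Cb0 SG n x z bP bQ).
Qed.

Lemma rhoZ a Phi : in_A0C Phi -> rho (fun w => a * Phi w) = (fun x => a *: rho Phi x).
Proof.
move=> iP; have [[lP [M PM]] P1] := rho_spec iP; have [K bP] := line_bdd_A0C iP.
apply: rhoE; split.
  split; first by move=> c x y; rewrite lP scalerDr !scalerA mulrC.
  by exists (cabs a * M) => x; rewrite nrmZ// -mulrA ler_wpM2l ?cabs_ge0.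
move=> x z; rewrite ipZl// (_ : (fun n => _) = (fun n => a * Lam ip T n x z Phi)).
  by apply: ccvgM => //; exact: ccvg_cst.
by apply/funext => n; exact: (LamZ HH Cb0 SG n x z a bP).
Qed.

Lemma rhoM Phi Psi : in_A0C Phi -> in_A0C Psi ->
  rho (fun w => Phi w * Psi w) = rho Phi \o rho Psi.
Proof.
move=> [F [[f [h [S0 repF]]] ->]] [G [[f' [h' [S0' repG]]] ->]].
have [S [b [PS Fb SE SB]]] := tilde_op repF.
have [S' [c [PS' Gc SE' SB']]] := tilde_op repG.
rewrite (rhoE PS) (rhoE PS'); apply: rhoE; split.
  have [[lS _] _] := PS; have [[lS' _] _] := PS'.
  split; first by move=> a x y /=; rewrite lS' lS.
  exists (Cb ^+ 2 * S0 * (Cb ^+ 2 * S0')) => x /=; apply: le_trans (SB _) _.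
  rewrite -[leRHS]mulrA; apply: ler_wpM2l => //.
  rewrite mulr_ge0 ?exprn_ge0 ?(ltW Cb0)//.
  exact: A0_rep_ge0 repF.
by move=> x z; exact: (Lam_tilde2_cvg HH Cb0 SG x z repF Fb SE repG Gc SE').
Qed.

(** The bound [Cb]^2 S0 holds for every representation of every F that extends to Phi, hence for the
    infimum. *)
Lemma opnorm_rho Phi : in_A0C Phi -> opnorm ip (rho Phi) <= Cb ^+ 2 * normA0C Phi.
Proof.
move=> iP; have c20 : 0 < Cb ^+ 2 by rewrite exprn_gt0.
rewrite mulrC -ler_pdivrMr//; apply: normA0C_ge => // F f h S0 rep PhiF.
have [S [_ [PS _ _ SB]]] := tilde_op rep.
rewrite PhiF (rhoE PS) ler_pdivrMr// mulrC; apply: (opnorm_le Hip) => //.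
by rewrite mulr_ge0 ?(ltW c20)//; exact: A0_rep_ge0 rep.
Qed.

Lemma rho_alg_hom : is_bdd_alg_hom ip rho.
Proof.
split; first by move=> Phi /rho_spec[].
split; first exact: rhoD.
split; first exact: rhoZ.
split; first exact: rhoM.
by exists (Cb ^+ 2); exact: opnorm_rho.
Qed.

Lemma rho_laplace b : L1_pos b -> is_int_bT ip T b (rho (laplace b)).
Proof.
move=> /cintegrable_pos bi.
have b0 (t : R) : t < 0 -> pos b t = 0 by exact: pos_lt0.
(* Both sides of the claim see b only on the half-line; the cut-off supplies the vanishing on t < 0
   that the convergence lemma asks for. *)
have -> : laplace b = laplace (pos b).
  by apply/funext => w; rewrite !laplaceE; apply: eq_cint => t _; rewrite /pos; case: ifP.
have PS : is_rho (laplace (pos b)) (sop ip T (pos b)).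
  by split; [exact: (sop_op HH Cb0 SG)|move=> x z; exact: (Lam_laplace_cvg HH Cb0 SG bi b0)].
move=> x y; rewrite (rhoE PS) (ip_sop HH Cb0 SG)// cint_pos; apply: eq_cint => t _.
by rewrite /pos /orb; case: (leP 0 t) => // _; rewrite mul0r.
Qed.

End rho.

Section uniqueness.
Context {R : realType} {H : lmodType (complex R)}.
Variable ip : H -> H -> complex R.
Hypothesis Hip : is_inner_product ip.
Local Notation C := (complex R).
Local Notation nrm := (hnorm ip).

(** Both maps agree on Laplace transforms, and by density Phi is a Laplace transform plus a
    remainder of norm at most 1 / (j + 1), on which they differ by at most (|M1| + |M2|) / (j +
    1). *)
Lemma bdd_alg_hom_unique (T : R -> H -> H) (rho1 rho2 : (Cplus R -> C) -> H -> H) :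
  is_bdd_alg_hom ip rho1 -> (forall b, L1_pos b -> is_int_bT ip T b (rho1 (laplace b))) ->
  is_bdd_alg_hom ip rho2 -> (forall b, L1_pos b -> is_int_bT ip T b (rho2 (laplace b))) ->
  forall Phi, in_A0C Phi -> rho1 Phi = rho2 Phi.
Proof.
move=> [op1 [D1 [_ [_ [M1 B1]]]]] L1 [op2 [D2 [_ [_ [M2 B2]]]]] L2 _ [F [[f [h [S0 rep]]] ->]].
apply/funext => x; apply/eqP; rewrite -subr_eq0; apply/eqP; apply: (nrm_eq0 Hip).
apply/eqP; rewrite eq_le nrm_ge0 andbT.
apply: (@le_harm _ _ _ ((`|M1| + `|M2|) * nrm x)) => j; rewrite add0r.
have [b [bi b0 bA [f' [h' [S' [rep' S'le]]]]]] := A0_rep_density rep (harm_gt0 j).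
pose G t := F t - chk b t.
have iG : in_A0R G by exists f', h', S'.
have iGC : in_A0C (tildeF G) by exists G.
have tE : tildeF (chk b) = laplace b by apply/funext => w; exact: tildeF_chk.
have iL : in_A0C (laplace b) by exists (chk b).
have bL : L1_pos b.
  apply/cintegrable_pos; apply: cintegrable_ext bi => // t _.
  by rewrite /pos; case: (leP 0 t) => // /b0.
have -> : tildeF F = fun w => laplace b w + tildeF G w.
  apply/funext => w; rewrite /G (tildeFB w (A0_rep_meas rep) (A0_rep_bound rep)
    (cmeas_chk (cintegrable_meas bi)) (fun u => cabs_chk u bi)) tildeF_chk// subrKC//.
have nG : normA0C (tildeF G) <= j.+1%:R^-1.
  by apply: le_trans (normA0C_le iG) _; apply: le_trans S'le; exact: normA0R_le rep'.
have bd (rho : (Cplus R -> C) -> H -> H) M : (forall Phi, in_A0C Phi -> is_bounded_op ip (rho Phi)) ->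
    (forall Phi, in_A0C Phi -> opnorm ip (rho Phi) <= M * normA0C Phi) ->
    nrm (rho (tildeF G) x) <= `|M| * nrm x * j.+1%:R^-1.
  move=> op B; apply: le_trans (nrm_opnorm Hip _ (op _ iGC)) _.
  rewrite mulrAC ler_wpM2r ?nrm_ge0//; apply: le_trans (B _ iGC) _.
  apply: (@le_trans _ _ (`|M| * normA0C (tildeF G))); last by rewrite ler_wpM2l.
  by rewrite ler_wpM2r ?normA0C_ge0 ?ler_norm.
rewrite D1// D2//.
have -> : rho1 (laplace b) x = rho2 (laplace b) x by apply: (ip_inj Hip) => z; rewrite L1// L2.
rewrite opprD addrACA subrr add0r; apply: le_trans (nrmB Hip _ _) _.
by rewrite mulrDl mulrDl lerD ?bd.
Qed.

End uniqueness.

(** * From C_0-semigroups to explicit bounds *)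

Section C0_semigroups.
Context {R : realType} {H : lmodType (complex R)}.
Variable ip : H -> H -> complex R.
Variable T : R -> H -> H.
Hypotheses (Hip : is_inner_product ip) (T_sg : is_C0_semigroup ip T).
Local Notation nrm := (hnorm ip).

Lemma C0_bdd_sg K : (forall t x, 0 <= t -> nrm (T t x) <= K * nrm x) -> bdd_sg ip T K.
Proof.
move=> TK; have [op [T0 [TD TC]]] := T_sg; split.
- by move=> t t0; have [] := op t t0.
- by move=> x; rewrite T0.
- by move=> s t s0 t0 x; rewrite TD.
- by move=> t t0 x; exact: TK.
- move=> x e e0; have /cvgrPdist_le/(_ e e0)[d /= d0 Hd] := TC x.
  exists (d / 2); first by rewrite divr_gt0.
  move=> t; rewrite le_eqVlt => /predU1P[<- _|t0 td].
    by rewrite T0 /= subrr nrm0// ltW.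
  have tb : `|0 - t| < d.
    rewrite sub0r normrN gtr0_norm//; apply: le_lt_trans td _.
    by rewrite ltr_pdivrMr// ltr_pMr// ltr1n.
  by have := Hd t tb t0; rewrite /= sub0r normrN ger0_norm ?nrm_ge0.
Qed.

Hypothesis T_bdd : is_bounded_semigroup ip T.

Lemma sg_boundP t x : 0 <= t -> nrm (T t x) <= sg_bound ip T * nrm x.
Proof.
move=> t0; have [op _] := T_sg; have [M TM] := T_bdd.
apply: le_trans (nrm_opnorm Hip x (op t t0)) _; rewrite ler_wpM2r ?nrm_ge0//.
apply: ub_le_sup; last by exists t => //; apply/ge0_itvcy.
by exists M => _ [s /ge0_itvcy s0 <-]; exact: TM.
Qed.

(** T_0 is the identity, so the bound at t = 0 reads |x| <= C |x|. Thus C fails to be positive only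
    on the zero space. *)
Lemma sg_bound_le0 : sg_bound ip T <= 0 -> forall x, nrm x = 0.
Proof.
move=> C0 x; have [_ [T0 _]] := T_sg; apply/eqP; rewrite eq_le nrm_ge0 andbT.
have := sg_boundP x (lexx 0); rewrite T0 /= => /le_trans; apply.
by rewrite mulr_le0_ge0 ?nrm_ge0.
Qed.

End C0_semigroups.

Theorem mainTheorem10 (R : realType) (H : lmodType (complex R))
    (ip : H -> H -> complex R) (T : R -> H -> H) :
  is_hilbert ip ->
  is_C0_semigroup ip T ->
  is_bounded_semigroup ip T ->
  exists rho : (Cplus R -> complex R) -> H -> H,
    is_bdd_alg_hom ip rho /\
    (forall b : R -> complex R, L1_pos b -> is_int_bT ip T b (rho (laplace b))) /\
    (forall rho' : (Cplus R -> complex R) -> H -> H,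
       is_bdd_alg_hom ip rho' ->
       (forall b : R -> complex R, L1_pos b -> is_int_bT ip T b (rho' (laplace b))) ->
       forall Phi, in_A0C Phi -> rho' Phi = rho Phi) /\
    (forall Phi, in_A0C Phi ->
       opnorm ip (rho Phi) <= sg_bound ip T ^+ 2 * normA0C Phi).
Proof.
move=> HH Tsg Tb; have [Hip _] := HH.
have [Cb [Cb0 SG bnd]] : exists Cb, [/\ 0 < Cb, bdd_sg ip T Cb & forall Phi, in_A0C Phi ->
    opnorm ip (rho ip T Phi) <= sg_bound ip T ^+ 2 * normA0C Phi].
  have [C0|C0] := ltP 0 (sg_bound ip T).
    have SG := C0_bdd_sg Hip Tsg (fun t x t0 => sg_boundP Hip Tsg Tb x t0).
    by exists (sg_bound ip T); split => // Phi; exact: (opnorm_rho HH C0 SG).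
  (* On the zero space the construction runs with the positive constant 1, and the norm bound holds
     because all norms vanish. *)
  have n0 := sg_bound_le0 Hip Tsg Tb C0.
  exists 1; split; [exact: ltr01|by apply: C0_bdd_sg => // t x _; rewrite !n0 mulr0|].
  move=> Phi iP; apply: (@le_trans _ _ 0).
    by apply: (opnorm_le Hip) => // x; rewrite !n0 mulr0.
  by rewrite mulr_ge0 ?normA0C_ge0// exprn_even_ge0.
exists (rho ip T); split; first exact: (rho_alg_hom HH Cb0 SG).
split; first exact: (rho_laplace HH Cb0 SG).
split=> // rho' h1 h2; apply: (bdd_alg_hom_unique Hip h1 h2).
  exact: (rho_alg_hom HH Cb0 SG).
exact: (rho_laplace HH Cb0 SG).
Qed.
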